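(* Let $\sigma>1$, $k=\varepsilon^\sigma$, $\varepsilon\ll1$, and let the period be $d=O(\varepsilon^{1-\sigma-\delta})$ for some $0<\delta<1$ (so that $d\ll\lambda$ still holds and $d\to\infty$ as $\varepsilon\to0$). Let $u=u_\varepsilon$ be the solution of the scattering problem for the perforated slab with incident magnetic field $u^i=e^{i(\kappa x_1-\zeta(x_2-1))}$, $\kappa=k\sin\theta$, $\zeta=k\cos\theta$, and $E_\varepsilon=[E_{\varepsilon,1},E_{\varepsilon,2},0]$ the associated electric field. Then $$u=2x_2+O(\varepsilon^\delta)\qquad\text{and}\qquad E_{\varepsilon,1}=\frac{2i}{\varepsilon^\sigma\sqrt{\tau_0/\mu_0}}+O(\varepsilon^{\delta-\sigma})$$ in the slits.
   Context: Geometry: a perfectly conducting slab $0<x_2<1$ perforated by the slits $\bigcup_{n\in\mathbb{Z}}\big((0,\varepsilon)\times(0,1)+(nd,0)\big)$; $\Omega_\varepsilon$ is the union of $\{x_2>1\}$, $\{x_2<0\}$ and the slits (with their open ends). ''In the slits'' refers, as in the corresponding results for $d$ of order one, to the slit region $x_2\gg\varepsilon$, $1-x_2\gg\varepsilon$. $\lambda=2\pi/k$ is the wavelength and $|\theta|<\theta_0<\pi/2$ for some fixed $\theta_0$. The relation $d=O(\varepsilon^{1-\sigma-\delta})$ is meant as $d$ being of the order $\varepsilon^{1-\sigma-\delta}$. Scattering problem: the total field $u_\varepsilon=u^i+u^s_\varepsilon$ above the slab (and $u_\varepsilon=u^s_\varepsilon$ below) satisfies $\Delta u_\varepsilon+k^2u_\varepsilon=0$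 in $\Omega_\varepsilon$, $\partial_\nu u_\varepsilon=0$ on $\partial\Omega_\varepsilon$, $u_\varepsilon(x_1+d,x_2)=e^{i\kappa d}u_\varepsilon(x_1,x_2)$, and the outgoing condition $u^s_\varepsilon=\sum_nu_n^{s,\pm}e^{i\kappa_nx_1\pm i\zeta_nx_2}$ in $\{x_2>1\}$ ($+$) and $\{x_2<0\}$ ($-$), with $\kappa_n=\kappa+2\pi n/d$, $\zeta_n=\sqrt{k^2-\kappa_n^2}$ if $|\kappa_n|<k$ and $\zeta_n=i\sqrt{\kappa_n^2-k^2}$ if $|\kappa_n|>k$. The magnetic field is $H_\varepsilon=[0,0,u_\varepsilon]$, and the electric field is given by $[\partial_{x_2}u_\varepsilon,-\partial_{x_1}u_\varepsilon,0]=-i\omega\tau_0E_\varepsilon$, where $\tau_0,\mu_0$ are the vacuum permittivity and permeability and $k=\omega\sqrt{\tau_0\mu_0}$.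
   Formalization: In the n-th slit both leading terms carry the quasi-periodic factor e^{iκnd} (1 in the reference slit), and the E_1 estimate is for x_2 and 1-x_2 at least Kε ln(1/ε) rather than merely ≫ε; without these changes the claims fail. *)

(* Defs.v *)
(* Vanilla Stdlib reals with Coquelicot: complex fields are functions
   R * R -> C, and partial derivatives are taken in one real variable. *)
From Stdlib Require Import Reals ZArith.
From Coquelicot Require Import Coquelicot.
Open Scope R_scope.

Definition cexp (z : C) : C := (exp (Re z) * cos (Im z), exp (Re z) * sin (Im z)).

(* ** Geometry *)

Definition slit (eps d : R) (n : Z) (p : R * R) : Prop :=
  IZR n * d < fst p < IZR n * d + eps /\ 0 < snd p < 1.

(* The slits are joined to the two half-planes through their open ends, so
   here x2 = 0 and x2 = 1 are allowed in the slits. *)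
Definition Omega (eps d : R) (p : R * R) : Prop :=
  1 < snd p \/ snd p < 0 \/
  exists n : Z, IZR n * d < fst p < IZR n * d + eps /\ 0 <= snd p <= 1.

(* The boundary of Omega without the corners of the slits, where there is no
   normal.  The normal is along x2 on the faces and along x1 on the walls. *)
Definition slab_face (eps d : R) (p : R * R) : Prop :=
  (snd p = 0 \/ snd p = 1) /\
  forall n : Z, ~ (IZR n * d <= fst p <= IZR n * d + eps).

Definition slit_wall (eps d : R) (p : R * R) : Prop :=
  0 < snd p < 1 /\
  exists n : Z, fst p = IZR n * d \/ fst p = IZR n * d + eps.

(* ** Partial derivatives of complex-valued functions *)

Definition CDerive (f : R -> C) (t : R) : C :=
  (Derive (fun s => Re (f s)) t, Derive (fun s => Im (f s)) t).

Definition d1 (u : R * R -> C) (p : R * R) : C :=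
  CDerive (fun t => u (t, snd p)) (fst p).

Definition d2 (u : R * R -> C) (p : R * R) : C :=
  CDerive (fun t => u (fst p, t)) (snd p).

Definition C1_on (D : R * R -> Prop) (u : R * R -> C) : Prop :=
  forall p, D p ->
    ex_derive (fun t : R => u (t, snd p)) (fst p) /\
    ex_derive (fun t : R => u (fst p, t)) (snd p) /\
    continuous (d1 u) p /\ continuous (d2 u) p.

Definition C2_on (D : R * R -> Prop) (u : R * R -> C) : Prop :=
  C1_on D u /\ C1_on D (d1 u) /\ C1_on D (d2 u).

(* ** Scattering problem *)

Definition kappa (k theta : R) : R := k * sin theta.
Definition zeta (k theta : R) : R := k * cos theta.

Definition incident (k theta : R) (p : R * R) : C :=
  cexp (Ci * RtoC (kappa k theta * fst p - zeta k theta * (snd p - 1)))%C.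

Definition kappa_n (k theta d : R) (n : Z) : R :=
  kappa k theta + 2 * PI * IZR n / d.

Definition zeta_n (k theta d : R) (n : Z) : C :=
  if Rlt_dec (Rabs (kappa_n k theta d n)) k
  then RtoC (sqrt (k ^ 2 - kappa_n k theta d n ^ 2))
  else (Ci * RtoC (sqrt (kappa_n k theta d n ^ 2 - k ^ 2)))%C.

(* s = +1 for the waves going up, s = -1 for the waves going down. *)
Definition rayleigh_mode (s k theta d : R) (n : Z) (p : R * R) : C :=
  cexp (Ci * RtoC (kappa_n k theta d n * fst p)
        + RtoC s * Ci * zeta_n k theta d n * RtoC (snd p))%C.

Definition is_Zseries (a : Z -> C) (l : C) : Prop :=
  exists l1 l2 : C,
    is_series (fun m : nat => a (Z.of_nat m)) l1 /\
    is_series (fun m : nat => a (- Z.of_nat (S m))%Z) l2 /\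
    l = (l1 + l2)%C.

Definition outgoing (s k theta d : R) (D : R * R -> Prop) (v : R * R -> C) : Prop :=
  exists a : Z -> C, forall p, D p ->
    is_Zseries (fun n => (a n * rayleigh_mode s k theta d n p)%C) (v p).

(* Classical solutions, continuous up to the boundary, corners included (this
   is what excludes the solutions of infinite energy at the corners).
   In [sol_cont], nothing is required at points outside the closure of Omega:
   there, [within] makes the filter degenerate.
   In the Neumann condition, the normal derivative at a boundary point is the
   limit of the derivative in the normal direction from inside Omega. *)
Record scattering_solution (eps d k theta : R) (u : R * R -> C) : Prop := {
  sol_C2 : C2_on (Omega eps d) u;
  sol_cont : forall p : R * R,
    filterlim u (within (Omega eps d) (locally p)) (locally (u p));
  sol_helmholtz : forall p, Omega eps d p ->
    (d1 (d1 u) p + d2 (d2 u) p + RtoC (k ^ 2) * u p)%C = RtoC 0;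
  sol_neumann_face : forall p : R * R, slab_face eps d p ->
    filterlim (d2 u) (within (Omega eps d) (locally p)) (locally (RtoC 0));
  sol_neumann_wall : forall p : R * R, slit_wall eps d p ->
    filterlim (d1 u) (within (Omega eps d) (locally p)) (locally (RtoC 0));
  sol_quasiperiodic : forall p : R * R, Omega eps d p ->
    u (fst p + d, snd p) = (cexp (Ci * RtoC (kappa k theta * d)) * u p)%C;
  sol_outgoing_up :
    outgoing 1 k theta d (fun p => 1 < snd p)
      (fun p => (u p - incident k theta p)%C);
  sol_outgoing_down :
    outgoing (-1) k theta d (fun p => snd p < 0) u
}.

(* [d2 u, - d1 u, 0] = - i omega tau0 [E1, E2, 0], the third component being
   trivial. *)
Definition electric_field (eps d omega tau0 : R) (u E1 E2 : R * R -> C) : Prop :=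
  forall p, Omega eps d p ->
    d2 u p = (- Ci * RtoC (omega * tau0) * E1 p)%C /\
    (- d1 u p)%C = (- Ci * RtoC (omega * tau0) * E2 p)%C.

(* Main.v *)
(** The incident wave and its reflection by an unperforated slab form a standing wave, which is
    [2 + O(k eps)] at the aperture of the slit.  What remains above the slab is radiated by the
    aperture.  All its modes but one are evanescent and negligible at height
    [d (1 + ln (1 / eps))]; the propagating one is subtracted in the form of a standing wave
    which agrees with it at this height.  The modulus of the difference is compared with the
    barrier [A min (P, Z)], where [A] bounds the field in the slit, [P] is a periodic logarithm
    and [Z] is quadratic in the slit; a small multiple of a function that is infinite at the
    corners keeps the maximum away from them.  The propagating mode is a Fourier coefficient on
    the line at height [d], so the barrier bounds it, by [O(A eps / (k d)) = O(A eps^delta)].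
    Hence the radiated field is [O(A eps^delta)] at the aperture.  The same holds below the slab.

    So [u] is [2 x2 + O(eps^delta)] at both ends of the slit and, by the maximum principle in a
    rectangle, inside.  For the derivative, [u(x, y) - u(x', y)] is, up to [O(k^2)], a harmonic
    function of three variables that vanishes for [x = x'], so it decays exponentially away from
    the ends; comparison for the odd part of [u - 2 x2] about a horizontal line then bounds
    [d2 u - 2] there. *)

Require Import Defs.
From Stdlib Require Import Reals ZArith Lra Lia Psatz.
From Coquelicot Require Import Coquelicot.
Open Scope R_scope.

(** Two obstacles shape the comparison. The term [k^2 u] has the wrong sign for a maximum principle:
    the barrier is made strictly superharmonic, and a bound by [2 M] times it improves to a bound by
    [M] times it, so any finite bound can be halved down to the wanted one. And [|W|] is neither
    real nor smooth: at a maximum it is replaced by a real projection with frozen direction, which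
    touches it from below. The height [d (1 + L)], [L = ln (1 / eps)], serves twice. Evanescent
    modes lose a factor [eps^4] or more between [d] and that height. At height [d] the propagating
    mode and the standing wave differ by about [zeta d L] times the coefficient, and this [L]
    cancels the logarithm in the barrier there. For the derivative, the size [eps^delta] of
    [u - 2 x2] alone would yield only [eps^(delta - 1) / L] at distance [eps L] from the ends. But
    where the oscillation across the slit is negligible, the field is affine in [y] up to a far
    smaller error; the affine part has slope [O(eps^delta)], and only the error is divided by
    [eps L]. *)

(** * Cluster points of maximising families and one-variable calculus *)

Lemma cluster_1d (I : Type) (S : R -> I -> Prop) (p : I -> R) (X : R) :
  (forall e e' i, e <= e' -> S e i -> S e' i) ->
  (forall e, 0 < e -> exists i, S e i) ->
  (forall e i, S e i -> Rabs (p i) <= X) ->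
  exists x, forall e, 0 < e -> exists i, S e i /\ Rabs (p i - x) < e.
Proof.
intros Hmono Hne Hb.
(* The values reached or exceeded by [p] on every [S e] with [e > 0]; their supremum is the upper
   limit of [p] along [S]. *)
set (E := fun t => forall e, 0 < e -> exists i, S e i /\ t <= p i).
destruct (completeness E) as [x [Hub Hlub]].
- exists X; intros t Ht.
  destruct (Ht 1 Rlt_0_1) as [i [Hi Hti]].
  pose proof (Hb _ _ Hi) as H; apply Rabs_le_between in H; lra.
- exists (- X); intros e He.
  destruct (Hne e He) as [i Hi]; exists i; split; [exact Hi|].
  pose proof (Hb _ _ Hi) as H; apply Rabs_le_between in H; lra.
- exists x; intros e He.
  assert (H1 : exists t, E t /\ x - e < t).
  { apply Classical_Prop.NNPP; intros Hn.
    assert (x <= x - e); [|lra].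
    apply Hlub; intros t Ht.
    destruct (Rle_lt_dec t (x - e)); [assumption|].
    elim Hn; exists t; split; assumption. }
  destruct H1 as [t [Ht Hxt]].
  assert (H2 : exists e0, 0 < e0 /\ forall i, S e0 i -> p i < x + e / 2).
  { apply Classical_Prop.NNPP; intros Hn.
    assert (x + e / 2 <= x); [|lra].
    apply Hub; intros e0 He0.
    apply Classical_Prop.NNPP; intros Hn'.
    apply Hn; exists e0; split; [exact He0|].
    intros i Hi; destruct (Rlt_le_dec (p i) (x + e / 2)); [assumption|].
    elim Hn'; exists i; split; assumption. }
  destruct H2 as [e0 [He0 H2]].
  destruct (Ht (Rmin e e0)) as [i [Hi Hti]].
  { apply Rmin_glb_lt; assumption. }
  exists i; split.
  + apply Hmono with (2 := Hi); apply Rmin_l.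
  + assert (Hi0 : S e0 i) by (apply Hmono with (2 := Hi); apply Rmin_r).
    specialize (H2 i Hi0); apply Rabs_def1; lra.
Qed.

(** Closeness to the limit already found is added to [S] before the next coordinate is treated, so
    that one index serves all three. *)
Lemma cluster_3d (I : Type) (S : R -> I -> Prop) (px py pz : I -> R) (X : R) :
  (forall e e' i, e <= e' -> S e i -> S e' i) ->
  (forall e, 0 < e -> exists i, S e i) ->
  (forall e i, S e i -> Rabs (px i) <= X /\ Rabs (py i) <= X /\ Rabs (pz i) <= X) ->
  exists x y z, forall e, 0 < e -> exists i,
    S e i /\ Rabs (px i - x) < e /\ Rabs (py i - y) < e /\ Rabs (pz i - z) < e.
Proof.
intros Hmono Hne Hb.
destruct (cluster_1d I S px X Hmono Hne) as [x Hx].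
{ intros e i Hi; apply (Hb e i Hi). }
destruct (cluster_1d I (fun e i => S e i /\ Rabs (px i - x) < e) py X) as [y Hy].
{ intros e e' i Hee [H1 H2]; split; [now apply Hmono with (1 := Hee)|lra]. }
{ exact Hx. }
{ intros e i [Hi _]; apply (Hb e i Hi). }
destruct (cluster_1d I (fun e i => (S e i /\ Rabs (px i - x) < e)
            /\ Rabs (py i - y) < e) pz X) as [z Hz].
{ intros e e' i Hee [[H1 H2] H3]; repeat split;
    [now apply Hmono with (1 := Hee)|lra|lra]. }
{ exact Hy. }
{ intros e i [[Hi _] _]; apply (Hb e i Hi). }
exists x, y, z; intros e He.
destruct (Hz e He) as [i [[[H1 H2] H3] H4]]; exists i; repeat split; assumption.
Qed.

(** A supremum over a set that is not closed need not be attained, but a maximising family still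
    clusters somewhere; the maximum principles below argue at such a cluster point. Three
    coordinates are provided for a comparison in three variables; planar uses set the last one to
    [0]. *)
Lemma sup_cluster (I : Type) (Om : I -> Prop) (f px py pz : I -> R) (X N : R) (i0 : I) :
  (forall i, Om i -> Rabs (px i) <= X /\ Rabs (py i) <= X /\ Rabs (pz i) <= X) ->
  (forall i, Om i -> f i <= N) -> Om i0 ->
  exists m x y z, (forall i, Om i -> f i <= m) /\
    forall e, 0 < e -> exists i, Om i /\ Rabs (px i - x) < e
      /\ Rabs (py i - y) < e /\ Rabs (pz i - z) < e /\ m - e < f i.
Proof.
intros Hb HN H0.
destruct (completeness (fun t => exists i, Om i /\ t = f i)) as [m [Hub Hlub]].
{ exists N; intros t [i [Hi ->]]; now apply HN. }
{ exists (f i0), i0; split; [assumption|reflexivity]. }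
destruct (cluster_3d I (fun e i => Om i /\ m - e < f i) px py pz X) as [x [y [z H]]].
{ intros e e' i Hee [H1 H2]; split; [assumption|lra]. }
{ intros e He; apply Classical_Prop.NNPP; intros Hn.
  assert (m <= m - e); [|lra].
  apply Hlub; intros t [i [Hi ->]].
  destruct (Rle_lt_dec (f i) (m - e)); [assumption|].
  elim Hn; exists i; split; assumption. }
{ intros e i [Hi _]; now apply Hb. }
exists m, x, y, z; split.
- intros i Hi; apply Hub; exists i; split; [assumption|reflexivity].
- intros e He; destruct (H e He) as [i [[H1 H2] [H3 [H4 H5]]]].
  exists i; repeat split; assumption.
Qed.

Lemma locally_bounded_bounded (Om : R -> R -> Prop) (f : R -> R -> R) (X : R) :
  (forall x y, Om x y -> Rabs x <= X /\ Rabs y <= X) ->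
  (forall x y, exists del N, 0 < del /\ forall x' y', Om x' y' ->
     Rabs (x' - x) < del -> Rabs (y' - y) < del -> f x' y' <= N) ->
  exists N, forall x y, Om x y -> f x y <= N.
Proof.
intros Hb Hloc.
apply Classical_Prop.NNPP; intros Hn.
(* The quantifier over [e' >= e] makes the family monotone for [e <= 0] as well, where [1 / e] alone
   would not be. *)
destruct (cluster_3d (R * R)
  (fun e p => Om (fst p) (snd p) /\ forall e', e <= e' -> 0 < e' -> 1 / e' < f (fst p) (snd p))
  fst snd (fun _ => 0) (Rmax X 0)) as [x [y [z H]]].
- intros e e' p Hee [H1 H2]; split; [assumption|].
  intros e2 He2; apply H2; lra.
- intros e He; apply Classical_Prop.NNPP; intros Hn'.
  apply Hn; exists (1 / e); intros x y Hxy.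
  destruct (Rle_lt_dec (f x y) (1 / e)); [assumption|].
  elim Hn'; exists (x, y); split; [assumption|].
  intros e' He' He'0; apply Rle_lt_trans with (2 := r).
  unfold Rdiv; rewrite !Rmult_1_l; apply Rinv_le_contravar; assumption.
- intros e p [Hp _]; destruct (Hb _ _ Hp).
  rewrite Rabs_R0; repeat split;
    (eapply Rle_trans; [eassumption|apply Rmax_l]) || apply Rmax_r.
- destruct (Hloc x y) as [del [N [Hdel HN]]].
  set (M := Rmax N 1).
  assert (HM : 0 < M) by (apply Rlt_le_trans with 1; [lra|apply Rmax_r]).
  assert (HM' : 0 < / M) by now apply Rinv_0_lt_compat.
  destruct (H (Rmin del (/ M))) as [[x' y'] [[H1 H2] [H3 [H4 _]]]].
  { apply Rmin_glb_lt; assumption. }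
  simpl in *.
  specialize (H2 (/ M) (Rmin_r _ _) HM').
  assert (f x' y' <= N).
  { apply HN; [assumption| |]; (eapply Rlt_le_trans; [eassumption|apply Rmin_l]). }
  assert (N <= M) by apply Rmax_l.
  unfold Rdiv in H2; rewrite Rinv_inv, Rmult_1_l in H2; lra.
Qed.

Lemma derive_lower_bound (F F1 : R -> R) (s t c : R) :
  s <= t -> (forall x, s <= x <= t -> is_derive F x (F1 x)) ->
  (forall x, s <= x <= t -> c <= F1 x) -> F s + c * (t - s) <= F t.
Proof.
intros Hst HF Hc.
destruct (MVT_gen F s t F1) as [z [Hz Heq]].
- intros x; rewrite Rmin_left, Rmax_right by assumption; intros; apply HF; lra.
- intros x; rewrite Rmin_left, Rmax_right by assumption; intros.
  apply derivable_continuous_pt; exists (F1 x).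
  apply is_derive_Reals, HF; lra.
- rewrite Rmin_left, Rmax_right in Hz by assumption.
  specialize (Hc z Hz); nra.
Qed.

(** Were [F2 > 0], [F1] would be positive just to the right of its zero [t0], and [F] would increase
    there. *)
Lemma max_second_derivative (F F1 : R -> R) (t0 F2 del : R) :
  0 < del -> (forall t, Rabs (t - t0) < del -> is_derive F t (F1 t)) ->
  is_derive F1 t0 F2 -> (forall t, Rabs (t - t0) < del -> F t <= F t0) -> F2 <= 0.
Proof.
intros Hdel HF HF1 Hmax.
assert (H0 : F1 t0 = 0).
{ assert (Hd : derivable_pt_lim F t0 (F1 t0)).
  { apply is_derive_Reals, HF; rewrite Rminus_diag, Rabs_R0; assumption. }
  set (pr := exist _ (F1 t0) Hd : derivable_pt F t0).
  change (derive_pt F t0 pr = 0).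
  apply deriv_maximum with (t0 - del) (t0 + del); try lra.
  intros x H1 H2; apply Hmax, Rabs_def1; lra. }
destruct (Rle_lt_dec F2 0) as [|HF2]; [assumption|exfalso].
apply is_derive_Reals in HF1.
destruct (HF1 (F2 / 2)) as [del' Hdel']; [lra|].
set (h := Rmin del del' / 2).
assert (Hm : 0 < Rmin del del') by (apply Rmin_glb_lt; [assumption|apply cond_pos]).
assert (Hm1 := Rmin_l del del'); assert (Hm2 := Rmin_r del del').
destruct (MVT_cor2 F F1 t0 (t0 + h)) as [c [Hc1 Hc2]].
- unfold h; lra.
- intros c Hc; apply is_derive_Reals, HF, Rabs_def1; unfold h in *; lra.
- assert (0 < F1 c).
  { specialize (Hdel' (c - t0)).
    replace (t0 + (c - t0)) with c in Hdel' by ring.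
    assert (Hq : Rabs ((F1 c - F1 t0) / (c - t0) - F2) < F2 / 2).
    { apply Hdel'; [lra|]. apply Rabs_def1; unfold h in *; lra. }
    rewrite H0, Rminus_0_r in Hq.
    apply Rabs_def2 in Hq.
    replace (F1 c) with ((F1 c / (c - t0)) * (c - t0)) by (field; lra).
    apply Rmult_lt_0_compat; lra. }
  assert (F (t0 + h) <= F t0).
  { apply Hmax, Rabs_def1; unfold h; lra. }
  replace (t0 + h - t0) with h in Hc1 by ring.
  assert (0 < F1 c * h) by (apply Rmult_lt_0_compat; unfold h; lra).
  lra.
Qed.

(** * The Laplacian in coordinates and the maximum principle in a rectangle *)

(** The first derivatives are named because boundary conditions and slopes refer to them. The second
    ones matter only through their sum, and only derivatives along the axes are asked for, since a
    maximum is tested along each axis separately. *)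
Definition lap_on (O : R -> R -> Prop) (v v1 v2 L : R -> R -> R) : Prop :=
  exists v11 v22 : R -> R -> R, forall x y, O x y ->
    is_derive (fun t => v t y) x (v1 x y) /\
    is_derive (fun t => v x t) y (v2 x y) /\
    is_derive (fun t => v1 t y) x (v11 x y) /\
    is_derive (fun t => v2 x t) y (v22 x y) /\
    v11 x y + v22 x y = L x y.

Lemma is_derive_lin (f g : R -> R) (a b x f' g' : R) :
  is_derive f x f' -> is_derive g x g' ->
  is_derive (fun t => a * f t + b * g t) x (a * f' + b * g').
Proof.
intros Hf Hg.
apply @is_derive_plus with (f := fun t => a * f t) (g := fun t => b * g t);
  apply is_derive_scal; assumption.
Qed.

Lemma lap_on_lin (O : R -> R -> Prop) (a b : R)
    (v v1 v2 L w w1 w2 K : R -> R -> R) :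
  lap_on O v v1 v2 L -> lap_on O w w1 w2 K ->
  lap_on O (fun x y => a * v x y + b * w x y)
    (fun x y => a * v1 x y + b * w1 x y) (fun x y => a * v2 x y + b * w2 x y)
    (fun x y => a * L x y + b * K x y).
Proof.
intros [v11 [v22 Hv]] [w11 [w22 Hw]].
exists (fun x y => a * v11 x y + b * w11 x y),
  (fun x y => a * v22 x y + b * w22 x y); intros x y Hxy.
destruct (Hv x y Hxy) as [V1 [V2 [V11 [V22 VL]]]].
destruct (Hw x y Hxy) as [W1 [W2 [W11 [W22 WL]]]].
split; [|split; [|split; [|split]]].
- now apply (is_derive_lin (fun t => v t y) (fun t => w t y)).
- now apply (is_derive_lin (fun t => v x t) (fun t => w x t)).
- now apply (is_derive_lin (fun t => v1 t y) (fun t => w1 t y)).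
- now apply (is_derive_lin (fun t => v2 x t) (fun t => w2 x t)).
- rewrite <- VL, <- WL; ring.
Qed.

Lemma lap_on_sub (O O' : R -> R -> Prop) (v v1 v2 L : R -> R -> R) :
  (forall x y, O' x y -> O x y) -> lap_on O v v1 v2 L -> lap_on O' v v1 v2 L.
Proof.
intros HO [v11 [v22 Hv]]; exists v11, v22; intros x y Hxy; apply Hv, HO, Hxy.
Qed.

Lemma Rmin_pos (a b : R) : 0 < a -> 0 < b -> 0 < Rmin a b.
Proof. apply Rmin_glb_lt. Qed.

Lemma cluster_between (x a b : R) :
  (forall e, 0 < e -> exists t, a <= t <= b /\ Rabs (t - x) < e) -> a <= x <= b.
Proof.
intros H; split; apply Rnot_lt_le; intros Hlt.
- destruct (H (a - x)) as [t [Ht1 Ht2]]; [lra|].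
  apply Rabs_def2 in Ht2; lra.
- destruct (H (x - b)) as [t [Ht1 Ht2]]; [lra|].
  apply Rabs_def2 in Ht2; lra.
Qed.

Definition near2 (P : R -> R -> Prop) (x y : R) : Prop :=
  exists del, 0 < del /\
    forall x' y', Rabs (x' - x) < del -> Rabs (y' - y) < del -> P x' y'.

Lemma near2_impl (P Q : R -> R -> Prop) x y :
  (forall x' y', P x' y' -> Q x' y') -> near2 P x y -> near2 Q x y.
Proof.
intros H [del [Hd HP]]; exists del; split; [assumption|]; intros; now apply H, HP.
Qed.

Lemma near2_and (P Q : R -> R -> Prop) x y :
  near2 P x y -> near2 Q x y -> near2 (fun a b => P a b /\ Q a b) x y.
Proof.
intros [d1 [H1 HP]] [d2 [H2 HQ]]; exists (Rmin d1 d2); split.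
- now apply Rmin_pos.
- intros x' y' Hx Hy.
  assert (A1 := Rmin_l d1 d2); assert (A2 := Rmin_r d1 d2).
  split; [apply HP|apply HQ]; lra.
Qed.

Lemma cont2_near (f : R -> R -> R) x y e :
  continuity_2d_pt f x y -> 0 < e -> near2 (fun a b => Rabs (f a b - f x y) < e) x y.
Proof.
intros Hf He; destruct (Hf (mkposreal e He)) as [del Hdel].
exists del; split; [apply cond_pos|exact Hdel].
Qed.

Lemma is_derive_sub (F g : R -> R) (x F' g' l : R) :
  is_derive F x F' -> is_derive g x g' -> l = F' - g' ->
  is_derive (fun t => F t - g t) x l.
Proof. intros HF Hg ->; now apply @is_derive_minus. Qed.

(** A small multiple of [(x - eps/2)^2] makes the barrier strict at the walls. *)
Lemma rectangle_max (eps a b c al be ga : R) (v v1 v2 L : R -> R -> R)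
    (rect := fun x y => 0 < x < eps /\ a < y < b)
    (h := fun y => al + be * y - ga * y ^ 2) :
  c < 2 * ga ->
  lap_on rect v v1 v2 L ->
  (forall x y, rect x y -> - c <= L x y) ->
  (forall x y, rect x y -> continuity_2d_pt v x y) ->
  (exists N, forall x y, rect x y -> v x y <= N) ->
  (forall x y e, x = 0 \/ x = eps -> a < y < b -> 0 < e ->
     near2 (fun x' y' => rect x' y' -> Rabs (v1 x' y') <= e) x y) ->
  (forall x y e, 0 <= x <= eps -> y = a \/ y = b -> 0 < e ->
     near2 (fun x' y' => rect x' y' -> v x' y' <= h y' + e) x y) ->
  forall x y, rect x y -> v x y <= h y.
Proof.
intros Hc [v11 [v22 Hv]] HL Hcont [N HN] Hwall Hend x0 y0 Hq0.
apply Rnot_lt_le; intros Hlt.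
assert (Heps : 0 < eps) by (destruct Hq0; lra).
(* Subtracting [xi (x - eps/2)^2] costs at most [xi eps^2], less than the assumed violation, and
   [c < 2 * ga] leaves room for its second derivative [2 xi]. *)
assert (Hxi : exists xi, 0 < xi /\ xi * eps ^ 2 < v x0 y0 - h y0 /\ c + 2 * xi < 2 * ga).
{ exists (Rmin ((v x0 y0 - h y0) / (2 * eps ^ 2)) ((2 * ga - c) / 4)).
  assert (He2 : 0 < eps ^ 2) by (apply pow_lt; assumption).
  split; [|split].
  - apply Rmin_pos; [|lra]. apply Rdiv_lt_0_compat; lra.
  - apply Rle_lt_trans with ((v x0 y0 - h y0) / (2 * eps ^ 2) * eps ^ 2).
    + apply Rmult_le_compat_r; [lra|apply Rmin_l].
    + replace ((v x0 y0 - h y0) / (2 * eps ^ 2) * eps ^ 2)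
        with ((v x0 y0 - h y0) / 2) by (field; lra). lra.
  - assert (H := Rmin_r ((v x0 y0 - h y0) / (2 * eps ^ 2)) ((2 * ga - c) / 4)); lra. }
destruct Hxi as [xi [Hxi [Hxi1 Hxi2]]].
set (f := fun x y => v x y - h y - xi * (x - eps / 2) ^ 2).
destruct (sup_cluster (R * R) (fun p => rect (fst p) (snd p)) (fun p => f (fst p) (snd p))
  fst snd (fun _ => 0) (Rabs eps + Rabs a + Rabs b) (N + Rabs al + Rabs be * (Rabs a + Rabs b) + Rabs ga * (Rabs a + Rabs b) ^ 2) (x0, y0))
  as [m [x [y [z [Hm Hcl]]]]].
{ intros [x y] [[H1 H2] [H3 H4]]; simpl in *.
  rewrite Rabs_R0.
  assert (A1 := Rabs_pos eps); assert (A2 := Rabs_pos a); assert (A3 := Rabs_pos b).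
  assert (B1 := Rle_abs eps); assert (B2 := Rle_abs (- a)); assert (B3 := Rle_abs b).
  rewrite Rabs_Ropp in B2.
  split; [apply Rabs_le; lra|split; [apply Rabs_le; lra|lra]]. }
{ intros [x y] Hr; simpl; unfold f, h.
  specialize (HN x y Hr).
  assert (Hy : Rabs y <= Rabs a + Rabs b).
  { destruct Hr as [_ Hy]; simpl in Hy.
    assert (A2 := Rabs_pos a); assert (A3 := Rabs_pos b).
    assert (B2 := Rle_abs (- a)); assert (B3 := Rle_abs b).
    rewrite Rabs_Ropp in B2. apply Rabs_le; lra. }
  assert (C1 := Rle_abs (- al)); rewrite Rabs_Ropp in C1.
  assert (C2 : - (Rabs be * (Rabs a + Rabs b)) <= be * y).
  { assert (C2 := Rle_abs (- (be * y))); rewrite Rabs_Ropp, Rabs_mult in C2.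
    assert (Rabs be * Rabs y <= Rabs be * (Rabs a + Rabs b))
      by (apply Rmult_le_compat_l; [apply Rabs_pos|assumption]).
    lra. }
  assert (C3 : ga * y ^ 2 <= Rabs ga * (Rabs a + Rabs b) ^ 2).
  { apply Rle_trans with (1 := Rle_abs _).
    rewrite Rabs_mult, <- RPow_abs.
    apply Rmult_le_compat_l; [apply Rabs_pos|].
    apply pow_incr; split; [apply Rabs_pos|assumption]. }
  assert (C4 : 0 <= xi * (x - eps / 2) ^ 2).
  { apply Rmult_le_pos; [lra|apply pow2_ge_0]. }
  lra. }
{ exact Hq0. }
assert (Hm0 : 0 < m).
{ apply Rlt_le_trans with (f x0 y0); [|apply (Hm (x0, y0) Hq0)].
  unfold f. destruct Hq0 as [Hx0 _].
  assert ((x0 - eps / 2) ^ 2 <= eps ^ 2) by nra.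
  assert (xi * (x0 - eps / 2) ^ 2 <= xi * eps ^ 2) by (apply Rmult_le_compat_l; lra).
  lra. }
assert (Hx : 0 <= x <= eps).
{ apply cluster_between; intros e He; destruct (Hcl e He) as [[x' y'] [[H1 H2] [H3 _]]].
  exists x'; simpl in *; split; [lra|assumption]. }
assert (Hy : a <= y <= b).
{ apply cluster_between; intros e He; destruct (Hcl e He) as [[x' y'] [[H1 H2] [_ [H3 _]]]].
  exists y'; simpl in *; split; [lra|assumption]. }
assert (Hcl' : forall e, 0 < e -> exists x' y', rect x' y' /\ Rabs (x' - x) < e
   /\ Rabs (y' - y) < e /\ m - e < f x' y').
{ intros e He; destruct (Hcl e He) as [[x' y'] [H1 [H2 [H3 [_ H4]]]]].
  exists x', y'; repeat (split; [assumption|]); assumption. }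
assert (Hm' : forall x y, rect x y -> f x y <= m) by (intros x' y'; apply (Hm (x', y'))).
clear Hcl Hm.
destruct (Classical_Prop.classic (y = a \/ y = b)) as [Hye|Hye].
{ destruct (Hend x y (m / 4) Hx Hye) as [del [Hdel Hn]]; [lra|].
  destruct (Hcl' (Rmin del (m / 4))) as [x' [y' [Hr [H1 [H2 H3]]]]].
  { apply Rmin_pos; lra. }
  assert (A1 := Rmin_l del (m / 4)); assert (A2 := Rmin_r del (m / 4)).
  specialize (Hn x' y' ltac:(lra) ltac:(lra) Hr).
  unfold f in H3.
  assert (0 <= xi * (x' - eps / 2) ^ 2) by (apply Rmult_le_pos; [lra|apply pow2_ge_0]).
  lra. }
assert (Hy' : a < y < b).
{ split; apply Rnot_le_lt; intros H; apply Hye; [left|right]; lra. }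
assert (Df : forall x y, rect x y ->
  is_derive (fun t => f t y) x (v1 x y - 2 * xi * (x - eps / 2))).
{ intros x' y' Hr; destruct (Hv x' y' Hr) as [V1 _].
  apply (is_derive_sub (fun t => v t y' - h y') (fun t => xi * (t - eps / 2) ^ 2))
    with (v1 x' y') (2 * xi * (x' - eps / 2)); [| |reflexivity].
  - apply (is_derive_sub (fun t => v t y') (fun _ => h y')) with (1 := V1) (g' := 0);
      [apply @is_derive_const|ring].
  - auto_derive; [exact I|simpl; field]. }
(* At a wall, with [|v1| <= xi eps / 4], the term in [xi] makes [f] grow inwards with slope at least
   [xi eps / 4]; a move by [r] gains more than what [f] lacks to its supremum. *)
destruct (Classical_Prop.classic (x = 0 \/ x = eps)) as [Hxe|Hxe].
{ destruct (Hwall x y (xi * eps / 4) Hxe Hy') as [del [Hdel Hn]].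
  { apply Rdiv_lt_0_compat; [apply Rmult_lt_0_compat|]; lra. }
  set (r := Rmin (Rmin del (eps / 4)) (Rmin (y - a) (b - y)) / 2).
  assert (Hr : 0 < r /\ 2 * r <= del /\ 8 * r <= eps /\ r < y - a /\ r < b - y).
  { assert (A1 := Rmin_l (Rmin del (eps / 4)) (Rmin (y - a) (b - y))).
    assert (A2 := Rmin_r (Rmin del (eps / 4)) (Rmin (y - a) (b - y))).
    assert (A3 := Rmin_l del (eps / 4)). assert (A4 := Rmin_r del (eps / 4)).
    assert (A5 := Rmin_l (y - a) (b - y)). assert (A6 := Rmin_r (y - a) (b - y)).
    assert (0 < r).
    { apply Rdiv_lt_0_compat; [|lra]. repeat apply Rmin_pos; lra. }
    unfold r in *; lra. }
  clearbody r; destruct Hr as [Hr0 [Hr1 [Hr2 [Hr3 Hr4]]]].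
  assert (Hgain : 0 < xi * eps / 4 * r).
  { apply Rmult_lt_0_compat; [|assumption].
    apply Rdiv_lt_0_compat; [apply Rmult_lt_0_compat|]; lra. }
  destruct (Hcl' (Rmin r (xi * eps / 4 * r))) as [x' [y' [Hq [H1 [H2 H3]]]]].
  { apply Rmin_pos; assumption. }
  assert (A1 := Rmin_l r (xi * eps / 4 * r)); assert (A2 := Rmin_r r (xi * eps / 4 * r)).
  apply Rabs_def2 in H1; apply Rabs_def2 in H2.
  destruct Hq as [Hq1 Hq2].
  destruct Hxe as [-> | ->].
  - assert (Hpush := derive_lower_bound (fun t => f t y')
      (fun t => v1 t y' - 2 * xi * (t - eps / 2)) x' (x' + r) (xi * eps / 4)).
    assert (f x' y' + xi * eps / 4 * (x' + r - x') <= f (x' + r) y').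
    { apply Hpush; [lra| |].
      - intros t Ht; apply Df; split; lra.
      - intros t Ht.
        assert (Hv1 : Rabs (v1 t y') <= xi * eps / 4).
        { apply Hn; [apply Rabs_def1; lra|apply Rabs_def1; lra|split; lra]. }
        apply Rabs_le_between in Hv1. nra. }
    assert (f (x' + r) y' <= m) by (apply Hm'; split; lra).
    replace (x' + r - x') with r in * by ring. lra.
  - assert (Hpush := derive_lower_bound (fun t => - f t y')
      (fun t => - (v1 t y' - 2 * xi * (t - eps / 2))) (x' - r) x' (xi * eps / 4)).
    assert (- f (x' - r) y' + xi * eps / 4 * (x' - (x' - r)) <= - f x' y').
    { apply Hpush; [lra| |].
      - intros t Ht. apply @is_derive_opp with (f := fun t => f t y').
        apply Df; split; lra.
      - intros t Ht.
        assert (Hv1 : Rabs (v1 t y') <= xi * eps / 4).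
        { apply Hn; [apply Rabs_def1; lra|apply Rabs_def1; lra|split; lra]. }
        apply Rabs_le_between in Hv1. nra. }
    assert (f (x' - r) y' <= m) by (apply Hm'; split; lra).
    replace (x' - (x' - r)) with r in * by ring. lra. }
assert (Hx' : 0 < x < eps).
{ split; apply Rnot_le_lt; intros H; apply Hxe; [left|right]; lra. }
assert (Hp : rect x y) by (split; assumption).
assert (Hfp : f x y = m).
{ apply Rle_antisym; [now apply Hm'|].
  apply Rnot_lt_le; intros Hl.
  assert (Hcf : continuity_2d_pt f x y).
  { unfold f, h.
    apply continuity_2d_pt_minus; [apply continuity_2d_pt_minus; [now apply Hcont|]|].
    - apply (continuity_1d_2d_pt_comp (fun y => al + be * y - ga * y ^ 2) (fun _ y => y)).
      + apply derivable_continuous_pt; reg.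
      + apply continuity_2d_pt_id2.
    - apply (continuity_1d_2d_pt_comp (fun x => xi * (x - eps / 2) ^ 2) (fun x _ => x)).
      + apply derivable_continuous_pt; reg.
      + apply continuity_2d_pt_id1. }
  destruct (cont2_near f x y ((m - f x y) / 2) Hcf) as [del [Hdel Hn]]; [lra|].
  destruct (Hcl' (Rmin del ((m - f x y) / 2))) as [x' [y' [Hr [H1 [H2 H3]]]]].
  { apply Rmin_pos; lra. }
  assert (A1 := Rmin_l del ((m - f x y) / 2)); assert (A2 := Rmin_r del ((m - f x y) / 2)).
  specialize (Hn x' y' ltac:(lra) ltac:(lra)); apply Rabs_def2 in Hn; lra. }
destruct (Hv x y Hp) as [_ [_ [V11 [V22 VL]]]].
assert (T1 : v11 x y - 2 * xi <= 0).
{ apply max_second_derivative with (fun t => f t y)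
    (fun t => v1 t y - 2 * xi * (t - eps / 2)) x (Rmin x (eps - x)).
  - apply Rmin_pos; lra.
  - intros t Ht; apply Df; split; [|assumption].
    assert (A1 := Rmin_l x (eps - x)); assert (A2 := Rmin_r x (eps - x)).
    apply Rabs_def2 in Ht; lra.
  - apply is_derive_sub with (1 := V11) (g' := 2 * xi); [|reflexivity].
    auto_derive; [exact I|ring].
  - intros t Ht; rewrite Hfp; apply Hm'; split; [|assumption].
    assert (A1 := Rmin_l x (eps - x)); assert (A2 := Rmin_r x (eps - x)).
    apply Rabs_def2 in Ht; lra. }
assert (T2 : v22 x y + 2 * ga <= 0).
{ apply max_second_derivative with (fun t => f x t)
    (fun t => v2 x t - (be - 2 * ga * t)) y (Rmin (y - a) (b - y)).
  - apply Rmin_pos; lra.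
  - intros t Ht.
    assert (Hrt : rect x t).
    { split; [assumption|].
      assert (A1 := Rmin_l (y - a) (b - y)); assert (A2 := Rmin_r (y - a) (b - y)).
      apply Rabs_def2 in Ht; lra. }
    destruct (Hv x t Hrt) as [_ [V2 _]].
    apply (is_derive_sub (fun t => v x t - h t) (fun _ => xi * (x - eps / 2) ^ 2))
      with (v2 x t - (be - 2 * ga * t)) 0; [|apply @is_derive_const|ring].
    apply is_derive_sub with (1 := V2) (g' := be - 2 * ga * t); [|reflexivity].
    unfold h; auto_derive; [exact I|ring].
  - apply is_derive_sub with (1 := V22) (g' := - 2 * ga); [|ring].
    auto_derive; [exact I|ring].
  - intros t Ht; rewrite Hfp; apply Hm'; split; [assumption|].
    assert (A1 := Rmin_l (y - a) (b - y)); assert (A2 := Rmin_r (y - a) (b - y)).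
    apply Rabs_def2 in Ht; lra. }
(* [T1] and [T2] add up to [L <= 2 xi - 2 ga < - c]. *)
specialize (HL x y Hp). lra.
Qed.

(** * Exponential decay of the oscillation across the slit *)

Lemma cos_ge_half (x : R) : 0 <= x <= 1 -> 1 / 2 <= cos x.
Proof.
intros Hx; rewrite <- cos_PI3.
assert (HPI := PI2_3_2).
apply cos_decr_1; lra.
Qed.

Lemma exp_neg_ge_half (x : R) : 0 <= x <= 1 / 2 -> 1 / 2 <= exp (- x).
Proof. intros Hx; assert (H := exp_ineq1_le (- x)); lra. Qed.

(** A function with values on two abscissae, [v x y - v x' y], is harmonic in the three
    variables [x], [x'], [y] up to the source; it vanishes on the diagonal, so it decays
    exponentially away from the ends of the slit. *)
Lemma oscillation_decay (eps a b c N : R) (v v1 v2 L : R -> R -> R)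
    (rect := fun x y => 0 < x < eps /\ a < y < b) :
  0 < c -> 0 <= N ->
  lap_on rect v v1 v2 L ->
  (forall x y, rect x y -> Rabs (L x y) <= c) ->
  (forall x y, rect x y -> continuity_2d_pt v x y) ->
  (forall x y, rect x y -> Rabs (v x y) <= N) ->
  (forall x y e, x = 0 \/ x = eps -> a < y < b -> 0 < e ->
     near2 (fun x' y' => rect x' y' -> Rabs (v1 x' y') <= e) x y) ->
  (forall x y e, 0 <= x <= eps -> a < y < b -> 0 < e -> exists l,
     near2 (fun x' y' => rect x' y' -> Rabs (v x' y' - l) <= e) x y) ->
  forall x x' y, 0 < x' < x -> x < eps -> a < y < b ->
  v x y - v x' y <= 8 * N * (exp (- ((y - a) / eps)) + exp (- ((b - y) / eps)))
                    + 4 * c * eps ^ 2.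
Proof.
intros Hc HN0 [v11 [v22 Hv]] HL Hcont HN Hwall Hlim xa xb y0 Hx1 Hx2 Hy0.
assert (Heps : 0 < eps) by lra.
set (E := fun y => exp (- ((y - a) / eps)) + exp (- ((b - y) / eps))).
assert (HE : forall y, 0 < E y).
{ intros y; unfold E; apply Rplus_lt_0_compat; apply exp_pos. }
(* Barrier in [t = x - x']. The cosine has frequency [3/4 / eps] in [x] and again in [x'], and twice
   [9/16] exceeds [1], which beats the second derivative [E / eps^2] of the exponentials. The shift
   [5/4] keeps its argument positive and at most [1], so the cosine is at least [1/2] and increases
   with [t]. The parabola absorbs the two sources, at most [2 c] together, and has slope at least
   [2 c eps] on [[0, eps]]. *)
set (q := fun t y => 8 * N * cos (3 / 4 * (5 / 4 - t / eps)) * E y + c * (4 * eps * t - t ^ 2)).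
set (q1 := fun t y => 8 * N * (3 / 4 / eps) * sin (3 / 4 * (5 / 4 - t / eps)) * E y
                      + c * (4 * eps - 2 * t)).
set (q11 := fun t y => - 8 * N * (9 / 16 / eps ^ 2) * cos (3 / 4 * (5 / 4 - t / eps)) * E y
                      - 2 * c).
set (q2 := fun t y => 8 * N * cos (3 / 4 * (5 / 4 - t / eps)) *
     ((- exp (- ((y - a) / eps)) + exp (- ((b - y) / eps))) / eps)).
set (q22 := fun t y => 8 * N * cos (3 / 4 * (5 / 4 - t / eps)) * (E y / eps ^ 2)).
(* Half of the square of abscissae: its sides are a wall for [x], a wall for [x'], and the diagonal,
   where the difference vanishes. *)
set (T := fun x x' y => 0 < x' < x /\ x < eps /\ a < y < b).
set (f := fun x x' y => (v x y - v x' y) - q (x - x') y).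
assert (Harg : forall t, 0 <= t <= eps -> 0 < 3 / 4 * (5 / 4 - t / eps) <= 1).
{ intros t Ht; assert (0 <= t / eps <= 1).
  { split; [apply Rdiv_le_0_compat; lra|].
    apply Rmult_le_reg_r with eps; [assumption|].
    unfold Rdiv; rewrite Rmult_assoc, Rinv_l; lra. }
  lra. }
assert (Hq : forall t y, 0 <= t <= eps ->
   4 * N * E y <= q t y /\ q t y <= 8 * N * E y + 4 * c * eps ^ 2
   /\ 2 * c * eps <= q1 t y /\ 0 < - 2 * q11 t y - q22 t y - 2 * c).
{ intros t y Ht; specialize (Harg t Ht); specialize (HE y).
  assert (Hcos := cos_ge_half (3 / 4 * (5 / 4 - t / eps)) ltac:(lra)).
  assert (Hcos1 := COS_bound (3 / 4 * (5 / 4 - t / eps))).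
  assert (HPI := PI2_3_2).
  assert (Hsin : 0 < sin (3 / 4 * (5 / 4 - t / eps))) by (apply sin_gt_0; lra).
  assert (HNE : 0 <= N * E y) by (apply Rmult_le_pos; lra).
  split; [|split; [|split]].
  - unfold q.
    assert (0 <= c * (4 * eps * t - t ^ 2)) by (apply Rmult_le_pos; nra).
    nra.
  - unfold q.
    assert (c * (4 * eps * t - t ^ 2) <= c * (4 * eps ^ 2)) by (apply Rmult_le_compat_l; nra).
    nra.
  - unfold q1.
    assert (c * (2 * eps) <= c * (4 * eps - 2 * t)) by (apply Rmult_le_compat_l; lra).
    assert (0 <= 8 * N * (3 / 4 / eps) * sin (3 / 4 * (5 / 4 - t / eps)) * E y).
    { replace (8 * N * (3 / 4 / eps) * sin (3 / 4 * (5 / 4 - t / eps)) * E y)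
        with (6 * (N * E y) * (/ eps) * sin (3 / 4 * (5 / 4 - t / eps))) by (field; lra).
      assert (0 < / eps) by now apply Rinv_0_lt_compat.
      apply Rmult_le_pos; [|lra]. apply Rmult_le_pos; lra. }
    lra.
  - unfold q11, q22.
    replace (-2 * (-8 * N * (9 / 16 / eps ^ 2) * cos (3 / 4 * (5 / 4 - t / eps)) * E y - 2 * c) -
      8 * N * cos (3 / 4 * (5 / 4 - t / eps)) * (E y / eps ^ 2) - 2 * c)
    with (N * E y * cos (3 / 4 * (5 / 4 - t / eps)) * (/ eps ^ 2) + 2 * c) by (field; lra).
    assert (0 < / eps ^ 2) by (apply Rinv_0_lt_compat, pow_lt; assumption).
    assert (0 <= N * E y * cos (3 / 4 * (5 / 4 - t / eps)) * (/ eps ^ 2)).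
    { apply Rmult_le_pos; [|lra]. apply Rmult_le_pos; lra. }
    lra. }
assert (Dq1 : forall t y, is_derive (fun t => q t y) t (q1 t y)).
{ intros t y; unfold q, q1; auto_derive; [lra|]; unfold Rminus, Rdiv; field; lra. }
assert (Dq11 : forall t y, is_derive (fun t => q1 t y) t (q11 t y)).
{ intros t y; unfold q1, q11; auto_derive; [lra|]; unfold Rminus, Rdiv; field; lra. }
assert (Dq2 : forall t y, is_derive (fun y => q t y) y (q2 t y)).
{ intros t y; unfold q, q2, E; auto_derive; [exact I|]; unfold Rminus, Rdiv; field; lra. }
assert (Dq22 : forall t y, is_derive (fun y => q2 t y) y (q22 t y)).
{ intros t y; unfold q2, q22, E; auto_derive; [exact I|]; unfold Rminus, Rdiv; field; lra. }
apply Rnot_lt_le; intros Hlt.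
destruct (sup_cluster (R * R * R) (fun p => T (fst (fst p)) (snd (fst p)) (snd p))
  (fun p => f (fst (fst p)) (snd (fst p)) (snd p))
  (fun p => fst (fst p)) (fun p => snd (fst p)) snd (Rabs eps + Rabs a + Rabs b) (2 * N) (xa, xb, y0))
  as [m [x [x' [y [Hm Hcl]]]]].
{ intros [[x x'] y] [H1 [H2 H3]]; simpl in *.
  assert (A1 := Rabs_pos eps); assert (A2 := Rabs_pos a); assert (A3 := Rabs_pos b).
  assert (B1 := Rle_abs eps); assert (B2 := Rle_abs (- a)); assert (B3 := Rle_abs b).
  rewrite Rabs_Ropp in B2.
  split; [apply Rabs_le; lra|split; apply Rabs_le; lra]. }
{ intros [[x x'] y] [H1 [H2 H3]]; simpl in *; unfold f.
  assert (A1 := HN x y ltac:(split; lra)); assert (A2 := HN x' y ltac:(split; lra)).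
  apply Rabs_le_between in A1; apply Rabs_le_between in A2.
  destruct (Hq (x - x') y) as [A3 _]; [lra|].
  assert (0 <= 4 * N * E y) by (apply Rmult_le_pos; [lra|apply Rlt_le, HE]).
  lra. }
{ unfold T; simpl; lra. }
assert (Hm0 : 0 < m).
{ apply Rlt_le_trans with (f xa xb y0); [|apply (Hm (xa, xb, y0)); unfold T; simpl; lra].
  unfold f. destruct (Hq (xa - xb) y0) as [_ [A3 _]]; [lra|]. fold (E y0) in Hlt. lra. }
assert (Hcl' : forall e, 0 < e -> exists u u' w, T u u' w /\ Rabs (u - x) < e
   /\ Rabs (u' - x') < e /\ Rabs (w - y) < e /\ m - e < f u u' w).
{ intros e He; destruct (Hcl e He) as [[[u u'] w] H].
  exists u, u', w; exact H. }
assert (Hm' : forall u u' w, T u u' w -> f u u' w <= m)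
  by (intros u u' w; apply (Hm (u, u', w))).
clear Hcl Hm.
assert (Hx : 0 <= x <= eps).
{ apply cluster_between; intros e He; destruct (Hcl' e He) as [u [u' [w [HT H]]]].
  exists u; unfold T in HT; split; [lra|apply H]. }
assert (Hx' : 0 <= x' <= eps).
{ apply cluster_between; intros e He; destruct (Hcl' e He) as [u [u' [w [HT H]]]].
  exists u'; unfold T in HT; split; [lra|apply H]. }
assert (Hxx : 0 <= x - x' <= eps).
{ apply cluster_between; intros e He; destruct (Hcl' (e / 2)) as [u [u' [w [HT [H1 [H2 _]]]]]].
  { lra. }
  exists (u - u'); unfold T in HT; split; [lra|].
  apply Rabs_def2 in H1; apply Rabs_def2 in H2; apply Rabs_def1; lra. }
assert (Hy : a <= y <= b).
{ apply cluster_between; intros e He; destruct (Hcl' e He) as [u [u' [w [HT H]]]].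
  exists w; unfold T in HT; split; [lra|apply H]. }
(* Near the ends [E >= 1/2], so [q >= 4 N E >= 2 N] is above any difference of two values. *)
destruct (Classical_Prop.classic (y = a \/ y = b)) as [Hye|Hye].
{ destruct (Hcl' (Rmin m (eps / 2))) as [u [u' [w [HT [H1 [H2 [H3 H4]]]]]]].
  { apply Rmin_pos; lra. }
  assert (A1 := Rmin_l m (eps / 2)); assert (A2 := Rmin_r m (eps / 2)).
  apply Rabs_def2 in H3.
  assert (HE1 : 1 / 2 <= E w).
  { unfold E.
    assert (B1 := exp_pos (- ((w - a) / eps))); assert (B2 := exp_pos (- ((b - w) / eps))).
    assert (Hdiv : forall s, 0 <= s <= eps / 2 -> 0 <= s / eps <= 1 / 2).
    { intros s Hs; split; [apply Rdiv_le_0_compat; lra|].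
      apply Rmult_le_reg_r with eps; [assumption|].
      unfold Rdiv; rewrite Rmult_assoc, Rinv_l; lra. }
    unfold T in HT.
    destruct Hye as [-> | ->].
    - assert (B3 := exp_neg_ge_half ((w - a) / eps) (Hdiv (w - a) ltac:(lra))); lra.
    - assert (B3 := exp_neg_ge_half ((b - w) / eps) (Hdiv (b - w) ltac:(lra))); lra. }
  unfold f in H4; unfold T in HT.
  assert (B1 := HN u w ltac:(split; lra)); assert (B2 := HN u' w ltac:(split; lra)).
  apply Rabs_le_between in B1; apply Rabs_le_between in B2.
  destruct (Hq (u - u') w) as [B3 _]; [lra|].
  nra. }
assert (Hy' : a < y < b).
{ split; apply Rnot_le_lt; intros H; apply Hye; [left|right]; lra. }
(* On the diagonal both values approach the limit given by [Hlim], which also covers the diagonal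
   points on a wall. *)
destruct (Classical_Prop.classic (x = x')) as [<-|Hne].
{ destruct (Hlim x y (m / 8) Hx Hy') as [l [del [Hdel Hn]]]; [lra|].
  destruct (Hcl' (Rmin del (m / 2))) as [u [u' [w [HT [H1 [H2 [H3 H4]]]]]]].
  { apply Rmin_pos; lra. }
  assert (A1 := Rmin_l del (m / 2)); assert (A2 := Rmin_r del (m / 2)).
  unfold T in HT.
  assert (B1 := Hn u w ltac:(lra) ltac:(lra) ltac:(split; lra)).
  assert (B2 := Hn u' w ltac:(lra) ltac:(lra) ltac:(split; lra)).
  apply Rabs_le_between in B1; apply Rabs_le_between in B2.
  unfold f in H4.
  destruct (Hq (u - u') w) as [A3 _]; [lra|].
  assert (0 <= 4 * N * E w) by (apply Rmult_le_pos; [lra|apply Rlt_le, HE]).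
  lra. }
assert (Hlt' : 0 < x - x') by (destruct (Rdichotomy _ _ Hne); lra).
assert (Df : forall u u' w, T u u' w ->
  is_derive (fun t => f t u' w) u (v1 u w - q1 (u - u') w)).
{ intros u u' w HT; destruct (Hv u w) as [V1 _]; [unfold T in HT; split; lra|].
  apply (is_derive_sub (fun t => v t w - v u' w) (fun t => q (t - u') w))
    with (v1 u w) (q1 (u - u') w); [| |reflexivity].
  - apply (is_derive_sub (fun t => v t w) (fun _ => v u' w)) with (1 := V1) (g' := 0);
      [apply @is_derive_const|ring].
  - replace (q1 (u - u') w) with (1 * q1 (u - u') w) by ring.
    apply (is_derive_comp (fun t => q t w) (fun t => t - u')); [apply Dq1|].
    auto_derive; [exact I|ring]. }
assert (Df' : forall u u' w, T u u' w ->
  is_derive (fun t => f u t w) u' (- v1 u' w + q1 (u - u') w)).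
{ intros u u' w HT; destruct (Hv u' w) as [V1 _]; [unfold T in HT; split; lra|].
  apply (is_derive_sub (fun t => v u w - v t w) (fun t => q (u - t) w))
    with (0 - v1 u' w) (- q1 (u - u') w); [| |ring].
  - apply (is_derive_sub (fun t => v u w) (fun t => v t w)) with 0 (v1 u' w);
      [apply @is_derive_const|exact V1|reflexivity].
  - replace (- q1 (u - u') w) with ((-1) * q1 (u - u') w) by ring.
    apply (is_derive_comp (fun t => q t w) (fun t => u - t)); [apply Dq1|].
    auto_derive; [exact I|ring]. }
(* Half of the least slope of [q]: when [|v1| <= g0] near a wall, a gain of [g0] per unit of length
   remains. *)
set (g0 := c * eps).
assert (Hg0 : 0 < g0) by (apply Rmult_lt_0_compat; assumption).
destruct (Classical_Prop.classic (x = eps)) as [Hxe|Hxe].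
{ destruct (Hwall x y g0 (or_intror Hxe) Hy' Hg0) as [del [Hdel Hn]].
  set (r := Rmin (Rmin del (x - x')) (Rmin (y - a) (b - y)) / 4).
  assert (Hr : 0 < r /\ 4 * r <= del /\ 4 * r <= x - x' /\ 4 * r <= y - a /\ 4 * r <= b - y).
  { assert (A1 := Rmin_l (Rmin del (x - x')) (Rmin (y - a) (b - y))).
    assert (A2 := Rmin_r (Rmin del (x - x')) (Rmin (y - a) (b - y))).
    assert (A3 := Rmin_l del (x - x')). assert (A4 := Rmin_r del (x - x')).
    assert (A5 := Rmin_l (y - a) (b - y)). assert (A6 := Rmin_r (y - a) (b - y)).
    assert (0 < r).
    { apply Rdiv_lt_0_compat; [|lra]. repeat apply Rmin_pos; lra. }
    unfold r in *; lra. }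
  clearbody r; destruct Hr as [Hr0 [Hr1 [Hr2 [Hr3 Hr4]]]].
  assert (Hgain : 0 < g0 * r) by (apply Rmult_lt_0_compat; assumption).
  destruct (Hcl' (Rmin r (g0 * r))) as [u [u' [w [HT [H1 [H2 [H3 H4]]]]]]].
  { apply Rmin_pos; assumption. }
  assert (A1 := Rmin_l r (g0 * r)); assert (A2 := Rmin_r r (g0 * r)).
  apply Rabs_def2 in H1; apply Rabs_def2 in H2; apply Rabs_def2 in H3.
  unfold T in HT.
  assert (Hpush : - f (u - r) u' w + g0 * (u - (u - r)) <= - f u u' w).
  { apply (derive_lower_bound (fun t => - f t u' w) (fun t => - (v1 t w - q1 (t - u') w)));
      [lra| |].
    - intros t Ht; apply @is_derive_opp with (f := fun t => f t u' w).
      apply Df; unfold T; lra.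
    - intros t Ht.
      assert (Hv1 : Rabs (v1 t w) <= g0).
      { apply Hn; [apply Rabs_def1; lra|apply Rabs_def1; lra|split; lra]. }
      apply Rabs_le_between in Hv1.
      destruct (Hq (t - u') w) as [_ [_ [B1 _]]]; [lra|]. unfold g0 in *; lra. }
  assert (f (u - r) u' w <= m) by (apply Hm'; unfold T; lra).
  replace (u - (u - r)) with r in * by ring. lra. }
destruct (Classical_Prop.classic (x' = 0)) as [Hxe'|Hxe'].
{ destruct (Hwall x' y g0 (or_introl Hxe') Hy' Hg0) as [del [Hdel Hn]].
  set (r := Rmin (Rmin del (x - x')) (Rmin (y - a) (b - y)) / 4).
  assert (Hr : 0 < r /\ 4 * r <= del /\ 4 * r <= x - x' /\ 4 * r <= y - a /\ 4 * r <= b - y).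
  { assert (A1 := Rmin_l (Rmin del (x - x')) (Rmin (y - a) (b - y))).
    assert (A2 := Rmin_r (Rmin del (x - x')) (Rmin (y - a) (b - y))).
    assert (A3 := Rmin_l del (x - x')). assert (A4 := Rmin_r del (x - x')).
    assert (A5 := Rmin_l (y - a) (b - y)). assert (A6 := Rmin_r (y - a) (b - y)).
    assert (0 < r).
    { apply Rdiv_lt_0_compat; [|lra]. repeat apply Rmin_pos; lra. }
    unfold r in *; lra. }
  clearbody r; destruct Hr as [Hr0 [Hr1 [Hr2 [Hr3 Hr4]]]].
  assert (Hgain : 0 < g0 * r) by (apply Rmult_lt_0_compat; assumption).
  destruct (Hcl' (Rmin r (g0 * r))) as [u [u' [w [HT [H1 [H2 [H3 H4]]]]]]].
  { apply Rmin_pos; assumption. }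
  assert (A1 := Rmin_l r (g0 * r)); assert (A2 := Rmin_r r (g0 * r)).
  apply Rabs_def2 in H1; apply Rabs_def2 in H2; apply Rabs_def2 in H3.
  unfold T in HT.
  assert (Hpush : f u u' w + g0 * (u' + r - u') <= f u (u' + r) w).
  { apply (derive_lower_bound (fun t => f u t w) (fun t => - v1 t w + q1 (u - t) w));
      [lra| |].
    - intros t Ht; apply Df'; unfold T; lra.
    - intros t Ht.
      assert (Hv1 : Rabs (v1 t w) <= g0).
      { apply Hn; [apply Rabs_def1; lra|apply Rabs_def1; lra|split; lra]. }
      apply Rabs_le_between in Hv1.
      destruct (Hq (u - t) w) as [_ [_ [B1 _]]]; [lra|]. unfold g0 in *; lra. }
  assert (f u (u' + r) w <= m) by (apply Hm'; unfold T; lra).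
  replace (u' + r - u') with r in * by ring. lra. }
assert (HT : T x x' y) by (unfold T; lra).
assert (Hfp : f x x' y = m).
{ apply Rle_antisym; [now apply Hm'|].
  apply Rnot_lt_le; intros Hl.
  set (e := (m - f x x' y) / 4). assert (He : 0 < e) by (unfold e; lra).
  destruct (cont2_near v x y e (Hcont x y ltac:(split; lra)) He) as [d1 [Hd1 Hn1]].
  destruct (cont2_near v x' y e (Hcont x' y ltac:(split; lra)) He) as [d2 [Hd2 Hn2]].
  assert (Hcq : continuity_2d_pt q (x - x') y).
  { unfold q. apply continuity_2d_pt_plus.
    - apply (continuity_2d_pt_mult (fun t _ => 8 * N * cos (3 / 4 * (5 / 4 - t / eps))) (fun _ y => E y)).
      + apply (continuity_1d_2d_pt_comp (fun t => 8 * N * cos (3 / 4 * (5 / 4 - t / eps)))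
          (fun t _ => t)); [|apply continuity_2d_pt_id1].
        apply derivable_continuous_pt; eexists; apply is_derive_Reals; auto_derive; [exact I|reflexivity].
      + apply (continuity_1d_2d_pt_comp E (fun _ y => y)); [|apply continuity_2d_pt_id2].
        unfold E; apply derivable_continuous_pt; eexists; apply is_derive_Reals;
          auto_derive; [exact I|reflexivity].
    - apply (continuity_1d_2d_pt_comp (fun t => c * (4 * eps * t - t ^ 2))
          (fun t _ => t)); [|apply continuity_2d_pt_id1].
      apply derivable_continuous_pt; eexists; apply is_derive_Reals; auto_derive; [exact I|reflexivity]. }
  destruct (cont2_near q (x - x') y e Hcq He) as [d3 [Hd3 Hn3]].
  destruct (Hcl' (Rmin (Rmin d1 d2) (Rmin (d3 / 2) e))) as [u [u' [w [HT' [H1 [H2 [H3 H4]]]]]]].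
  { repeat apply Rmin_pos; lra. }
  assert (A1 := Rmin_l (Rmin d1 d2) (Rmin (d3 / 2) e)).
  assert (A2 := Rmin_r (Rmin d1 d2) (Rmin (d3 / 2) e)).
  assert (A3 := Rmin_l d1 d2); assert (A4 := Rmin_r d1 d2).
  assert (A5 := Rmin_l (d3 / 2) e); assert (A6 := Rmin_r (d3 / 2) e).
  assert (B1 := Hn1 u w ltac:(lra) ltac:(lra)).
  assert (B2 := Hn2 u' w ltac:(lra) ltac:(lra)).
  assert (B3 : Rabs (q (u - u') w - q (x - x') y) < e).
  { apply Hn3; [|lra]. apply Rabs_def2 in H1; apply Rabs_def2 in H2; apply Rabs_def1; lra. }
  apply Rabs_def2 in B1; apply Rabs_def2 in B2; apply Rabs_def2 in B3.
  unfold f in H4; unfold e, f in *; lra. }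
unfold T in HT.
set (r := Rmin (Rmin (eps - x) (Rmin x' (x - x'))) (Rmin (y - a) (b - y))).
assert (Hr : 0 < r /\ r <= eps - x /\ r <= x' /\ r <= x - x' /\ r <= y - a /\ r <= b - y).
{ assert (A1 := Rmin_l (Rmin (eps - x) (Rmin x' (x - x'))) (Rmin (y - a) (b - y))).
  assert (A2 := Rmin_r (Rmin (eps - x) (Rmin x' (x - x'))) (Rmin (y - a) (b - y))).
  assert (A3 := Rmin_l (eps - x) (Rmin x' (x - x'))). 
  assert (A4 := Rmin_r (eps - x) (Rmin x' (x - x'))).
  assert (A7 := Rmin_l x' (x - x')). assert (A8 := Rmin_r x' (x - x')).
  assert (A5 := Rmin_l (y - a) (b - y)). assert (A6 := Rmin_r (y - a) (b - y)).
  assert (0 < r) by (repeat apply Rmin_pos; lra).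
  unfold r in *; lra. }
clearbody r; destruct Hr as [Hr0 [Hr1 [Hr2 [Hr3 [Hr4 Hr5]]]]].
destruct (Hv x y) as [_ [_ [V11 [V22 VL]]]]; [split; lra|].
destruct (Hv x' y) as [_ [_ [V11' [V22' VL']]]]; [split; lra|].
assert (T1 : v11 x y - q11 (x - x') y <= 0).
{ apply max_second_derivative with (fun t => f t x' y)
    (fun t => v1 t y - q1 (t - x') y) x r.
  - assumption.
  - intros t Ht; apply Rabs_def2 in Ht; apply Df; unfold T; lra.
  - apply is_derive_sub with (1 := V11) (g' := 1 * q11 (x - x') y); [|ring].
    apply (is_derive_comp (fun t => q1 t y) (fun t => t - x')); [apply Dq11|].
    auto_derive; [exact I|ring].
  - intros t Ht; apply Rabs_def2 in Ht; rewrite Hfp; apply Hm'; unfold T; lra. }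
assert (T2 : - v11 x' y - q11 (x - x') y <= 0).
{ apply max_second_derivative with (fun t => f x t y)
    (fun t => - v1 t y + q1 (x - t) y) x' r.
  - assumption.
  - intros t Ht; apply Rabs_def2 in Ht; apply Df'; unfold T; lra.
  - replace (- v11 x' y - q11 (x - x') y) with (plus (opp (v11 x' y)) ((-1) * q11 (x - x') y))
      by (unfold plus, opp; simpl; ring).
    apply @is_derive_plus.
    + apply @is_derive_opp with (f := fun t => v1 t y); exact V11'.
    + apply (is_derive_comp (fun t => q1 t y) (fun t => x - t)); [apply Dq11|].
      auto_derive; [exact I|ring].
  - intros t Ht; apply Rabs_def2 in Ht; rewrite Hfp; apply Hm'; unfold T; lra. }
assert (T3 : v22 x y - v22 x' y - q22 (x - x') y <= 0).
{ apply max_second_derivative with (fun t => f x x' t)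
    (fun t => v2 x t - v2 x' t - q2 (x - x') t) y r.
  - assumption.
  - intros t Ht; apply Rabs_def2 in Ht.
    destruct (Hv x t) as [_ [V2 _]]; [split; lra|].
    destruct (Hv x' t) as [_ [V2' _]]; [split; lra|].
    apply (is_derive_sub (fun t => v x t - v x' t) (fun t => q (x - x') t))
      with (v2 x t - v2 x' t) (q2 (x - x') t); [|apply Dq2|reflexivity].
    apply is_derive_sub with (1 := V2) (2 := V2'); reflexivity.
  - apply is_derive_sub with (v22 x y - v22 x' y) (q22 (x - x') y); [|apply Dq22|reflexivity].
    apply is_derive_sub with (1 := V22) (2 := V22'); reflexivity.
  - intros t Ht; apply Rabs_def2 in Ht; rewrite Hfp; apply Hm'; unfold T; lra. }
assert (L1 := HL x y ltac:(split; lra)); assert (L2 := HL x' y ltac:(split; lra)).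
apply Rabs_le_between in L1; apply Rabs_le_between in L2.
destruct (Hq (x - x') y) as [_ [_ [_ B4]]]; [lra|].
lra.
Qed.

(** * Neumann fields in the slit and their vertical derivative *)

Definition rect (eps a b x y : R) : Prop := 0 < x < eps /\ a < y < b.

(** The shape shared by the projections of the solution, their negatives, affine corrections and
    reflections. Nothing is prescribed on the ends [y = a] and [y = b], where each use supplies its
    own bound. *)
Record neumann_field (eps a b c : R) (v v1 v2 : R -> R -> R) : Prop := {
  nf_lap : exists L, lap_on (rect eps a b) v v1 v2 L /\
    forall x y, rect eps a b x y -> Rabs (L x y) <= c;
  nf_cont : forall x y, rect eps a b x y -> continuity_2d_pt v x y;
  nf_wall : forall x y e, x = 0 \/ x = eps -> a < y < b -> 0 < e ->
    near2 (fun x' y' => rect eps a b x' y' -> Rabs (v1 x' y') <= e) x y;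
  nf_lim : forall x y e, 0 <= x <= eps -> a < y < b -> 0 < e -> exists l,
    near2 (fun x' y' => rect eps a b x' y' -> Rabs (v x' y' - l) <= e) x y }.

Lemma neumann_field_max (eps a b c al be ga : R) (v v1 v2 : R -> R -> R)
    (h := fun y => al + be * y - ga * y ^ 2) :
  neumann_field eps a b c v v1 v2 -> c < 2 * ga ->
  (exists N, forall x y, rect eps a b x y -> v x y <= N) ->
  (forall x y e, 0 <= x <= eps -> y = a \/ y = b -> 0 < e ->
     near2 (fun x' y' => rect eps a b x' y' -> v x' y' <= h y' + e) x y) ->
  forall x y, rect eps a b x y -> v x y <= h y.
Proof.
intros [[L [HL HLc]] Hcont Hwall _] Hc HN Hend.
apply (rectangle_max eps a b c al be ga v v1 v2 L); try assumption.
intros x y Hr; specialize (HLc x y Hr); apply Rabs_le_between in HLc; lra.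
Qed.

Lemma neumann_field_opp eps a b c v v1 v2 :
  neumann_field eps a b c v v1 v2 ->
  neumann_field eps a b c (fun x y => - v x y) (fun x y => - v1 x y) (fun x y => - v2 x y).
Proof.
intros [[L [[v11 [v22 HL]] HLc]] Hcont Hwall Hlim]; split.
- exists (fun x y => - L x y); split.
  + exists (fun x y => - v11 x y), (fun x y => - v22 x y); intros x y Hr.
    destruct (HL x y Hr) as [V1 [V2 [V11 [V22 VL]]]].
    split; [|split; [|split; [|split]]].
    * now apply @is_derive_opp with (f := fun t => v t y).
    * now apply @is_derive_opp with (f := fun t => v x t).
    * now apply @is_derive_opp with (f := fun t => v1 t y).
    * now apply @is_derive_opp with (f := fun t => v2 x t).
    * lra.
  + intros x y Hr; rewrite Rabs_Ropp; now apply HLc.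
- intros x y Hr; apply continuity_2d_pt_opp; now apply Hcont.
- intros x y e Hx Hy He; apply near2_impl with (2 := Hwall x y e Hx Hy He).
  intros x' y' H Hr; rewrite Rabs_Ropp; now apply H.
- intros x y e Hx Hy He; destruct (Hlim x y e Hx Hy He) as [l Hl]; exists (- l).
  apply near2_impl with (2 := Hl); intros x' y' H Hr.
  replace (- v x' y' - - l) with (- (v x' y' - l)) by ring.
  rewrite Rabs_Ropp; now apply H.
Qed.

Lemma neumann_field_restrict eps a b a' b' c v v1 v2 :
  a <= a' -> b' <= b -> neumann_field eps a b c v v1 v2 ->
  neumann_field eps a' b' c v v1 v2.
Proof.
intros Ha Hb [[L [HL HLc]] Hcont Hwall Hlim].
assert (Hr : forall x y, rect eps a' b' x y -> rect eps a b x y)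
  by (intros x y [H1 H2]; split; lra).
split.
- exists L; split; [now apply lap_on_sub with (2 := HL)|].
  intros x y H; apply HLc, Hr, H.
- intros x y H; apply Hcont, Hr, H.
- intros x y e Hx Hy He; apply near2_impl with (2 := Hwall x y e Hx ltac:(lra) He).
  intros x' y' H H'; apply H, Hr, H'.
- intros x y e Hx Hy He; destruct (Hlim x y e Hx ltac:(lra) He) as [l Hl]; exists l.
  apply near2_impl with (2 := Hl); intros x' y' H H'; apply H, Hr, H'.
Qed.

Lemma neumann_field_affine eps a b c v v1 v2 al be :
  neumann_field eps a b c v v1 v2 ->
  neumann_field eps a b c (fun x y => v x y - (al + be * y)) v1 (fun x y => v2 x y - be).
Proof.
intros [[L [[v11 [v22 HL]] HLc]] Hcont Hwall Hlim]; split.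
- exists L; split; [|assumption].
  exists v11, v22; intros x y Hr.
  destruct (HL x y Hr) as [V1 [V2 [V11 [V22 VL]]]].
  split; [|split; [|split; [|split]]]; try assumption.
  + apply is_derive_sub with (1 := V1) (g' := 0); [apply @is_derive_const|ring].
  + apply is_derive_sub with (1 := V2) (g' := be); [|reflexivity].
    auto_derive; [exact I|ring].
  + apply is_derive_sub with (1 := V22) (g' := 0); [apply @is_derive_const|ring].
- intros x y Hr; apply continuity_2d_pt_minus; [now apply Hcont|].
  apply (continuity_1d_2d_pt_comp (fun y => al + be * y) (fun _ y => y));
    [|apply continuity_2d_pt_id2].
  apply derivable_continuous_pt; reg.
- assumption.
- intros x y e Hx Hy He; destruct (Hlim x y (e / 2) Hx Hy ltac:(lra)) as [l [del [Hdel Hl]]].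
  exists (l - (al + be * y)).
  assert (Hb : 0 < 2 * (Rabs be + 1)) by (assert (H := Rabs_pos be); lra).
  exists (Rmin del (e / (2 * (Rabs be + 1)))); split.
  { apply Rmin_pos; [assumption|]. apply Rdiv_lt_0_compat; assumption. }
  intros x' y' Hx' Hy' Hr.
  assert (A1 := Rmin_l del (e / (2 * (Rabs be + 1)))).
  assert (A2 := Rmin_r del (e / (2 * (Rabs be + 1)))).
  specialize (Hl x' y' ltac:(lra) ltac:(lra) Hr).
  replace (v x' y' - (al + be * y') - (l - (al + be * y)))
    with ((v x' y' - l) + - (be * (y' - y))) by ring.
  apply Rle_trans with (1 := Rabs_triang _ _).
  rewrite Rabs_Ropp, Rabs_mult.
  assert (Rabs be * Rabs (y' - y) <= e / 2); [|lra].
  apply Rle_trans with ((Rabs be + 1) * (e / (2 * (Rabs be + 1)))).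
  + apply Rmult_le_compat; [apply Rabs_pos|apply Rabs_pos|lra|lra].
  + apply Req_le; field. lra.
Qed.

(** Twice the odd part about [y0]. It vanishes on [s = 0], so a bound linear in [s] controls its
    vertical derivative on that line; the sources from both sides add up to [2 * c]. *)
Lemma neumann_field_reflect eps a b c v v1 v2 y0 l :
  a <= y0 - l -> y0 + l <= b ->
  neumann_field eps a b c v v1 v2 ->
  neumann_field eps 0 l (2 * c) (fun x s => v x (y0 + s) - v x (y0 - s))
    (fun x s => v1 x (y0 + s) - v1 x (y0 - s))
    (fun x s => v2 x (y0 + s) + v2 x (y0 - s)).
Proof.
intros Ha Hb [[L [[v11 [v22 HL]] HLc]] Hcont Hwall Hlim].
assert (Hp : forall x s, rect eps 0 l x s -> rect eps a b x (y0 + s))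
  by (intros x s [H1 H2]; split; lra).
assert (Hm : forall x s, rect eps 0 l x s -> rect eps a b x (y0 - s))
  by (intros x s [H1 H2]; split; lra).
assert (Dp : forall (F : R -> R) s F', is_derive F (y0 + s) F' ->
   is_derive (fun t => F (y0 + t)) s F').
{ intros F s F' HF; replace F' with (1 * F') by ring.
  apply (is_derive_comp F (fun t => y0 + t)); [exact HF|auto_derive; [exact I|ring]]. }
assert (Dm : forall (F : R -> R) s F', is_derive F (y0 - s) F' ->
   is_derive (fun t => F (y0 - t)) s (- F')).
{ intros F s F' HF; replace (- F') with ((-1) * F') by ring.
  apply (is_derive_comp F (fun t => y0 - t)); [exact HF|auto_derive; [exact I|ring]]. }
split.
- exists (fun x s => L x (y0 + s) - L x (y0 - s)); split.
  + exists (fun x s => v11 x (y0 + s) - v11 x (y0 - s)),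
      (fun x s => v22 x (y0 + s) - v22 x (y0 - s)).
    intros x s Hr.
    destruct (HL x (y0 + s) (Hp _ _ Hr)) as [V1 [V2 [V11 [V22 VL]]]].
    destruct (HL x (y0 - s) (Hm _ _ Hr)) as [W1 [W2 [W11 [W22 WL]]]].
    split; [|split; [|split; [|split]]].
    * now apply is_derive_sub with (1 := V1) (2 := W1).
    * apply (is_derive_sub (fun t => v x (y0 + t)) (fun t => v x (y0 - t)))
        with (1 := Dp _ _ _ V2) (2 := Dm _ _ _ W2); ring.
    * now apply is_derive_sub with (1 := V11) (2 := W11).
    * replace (v22 x (y0 + s) - v22 x (y0 - s))
        with (plus (v22 x (y0 + s)) (- v22 x (y0 - s))) by reflexivity.
      apply @is_derive_plus with (1 := Dp _ _ _ V22) (2 := Dm _ _ _ W22).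
    * lra.
  + intros x s Hr.
    assert (A1 := HLc _ _ (Hp _ _ Hr)); assert (A2 := HLc _ _ (Hm _ _ Hr)).
    apply Rabs_le_between in A1; apply Rabs_le_between in A2; apply Rabs_le; lra.
- intros x s Hr e.
  destruct (Hcont x (y0 + s) (Hp _ _ Hr) (mkposreal (e / 2) ltac:(apply is_pos_div_2)))
    as [d1 H1].
  destruct (Hcont x (y0 - s) (Hm _ _ Hr) (mkposreal (e / 2) ltac:(apply is_pos_div_2)))
    as [d2 H2].
  exists (mkposreal (Rmin d1 d2) ltac:(apply Rmin_pos; apply cond_pos)).
  simpl in *; intros x' s' Hx' Hs'.
  assert (A1 := Rmin_l d1 d2); assert (A2 := Rmin_r d1 d2).
  specialize (H1 x' (y0 + s') ltac:(lra)).
  specialize (H2 x' (y0 - s') ltac:(lra)).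
  replace (y0 + s' - (y0 + s)) with (s' - s) in H1 by ring.
  replace (y0 - s' - (y0 - s)) with (- (s' - s)) in H2 by ring.
  rewrite Rabs_Ropp in H2.
  specialize (H1 ltac:(lra)); specialize (H2 ltac:(lra)).
  apply Rabs_def2 in H1; apply Rabs_def2 in H2; apply Rabs_def1; lra.
- intros x s e Hx Hs He.
  destruct (Hwall x (y0 + s) (e / 2) Hx ltac:(lra) ltac:(lra)) as [d1 [Hd1 H1]].
  destruct (Hwall x (y0 - s) (e / 2) Hx ltac:(lra) ltac:(lra)) as [d2 [Hd2 H2]].
  exists (Rmin d1 d2); split; [now apply Rmin_pos|].
  intros x' s' Hx' Hs' Hr.
  assert (A1 := Rmin_l d1 d2); assert (A2 := Rmin_r d1 d2).
  specialize (H1 x' (y0 + s') ltac:(lra)).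
  specialize (H2 x' (y0 - s') ltac:(lra)).
  replace (y0 + s' - (y0 + s)) with (s' - s) in H1 by ring.
  replace (y0 - s' - (y0 - s)) with (- (s' - s)) in H2 by ring.
  rewrite Rabs_Ropp in H2.
  specialize (H1 ltac:(lra) (Hp _ _ Hr)); specialize (H2 ltac:(lra) (Hm _ _ Hr)).
  apply Rabs_le_between in H1; apply Rabs_le_between in H2; apply Rabs_le; lra.
- intros x s e Hx Hs He.
  destruct (Hlim x (y0 + s) (e / 2) Hx ltac:(lra) ltac:(lra)) as [l1 [d1 [Hd1 H1]]].
  destruct (Hlim x (y0 - s) (e / 2) Hx ltac:(lra) ltac:(lra)) as [l2 [d2 [Hd2 H2]]].
  exists (l1 - l2), (Rmin d1 d2); split; [now apply Rmin_pos|].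
  intros x' s' Hx' Hs' Hr.
  assert (A1 := Rmin_l d1 d2); assert (A2 := Rmin_r d1 d2).
  specialize (H1 x' (y0 + s') ltac:(lra)).
  specialize (H2 x' (y0 - s') ltac:(lra)).
  replace (y0 + s' - (y0 + s)) with (s' - s) in H1 by ring.
  replace (y0 - s' - (y0 - s)) with (- (s' - s)) in H2 by ring.
  rewrite Rabs_Ropp in H2.
  specialize (H1 ltac:(lra) (Hp _ _ Hr)); specialize (H2 ltac:(lra) (Hm _ _ Hr)).
  apply Rabs_le_between in H1; apply Rabs_le_between in H2; apply Rabs_le; lra.
Qed.

(** At distance [la] from the ends both exponentials of [oscillation_decay] are at most
    [exp (- (la / eps))]; the order of [x] and [x'] is removed by passing to [- v]. *)
Lemma slit_oscillation (eps c B la : R) (v v1 v2 : R -> R -> R) :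
  0 < eps -> 0 < c -> 0 < la ->
  neumann_field eps 0 1 c v v1 v2 ->
  (forall x y, rect eps 0 1 x y -> Rabs (v x y) <= B) ->
  forall x x' y, 0 < x < eps -> 0 < x' < eps -> la <= y <= 1 - la ->
  v x y - v x' y <= 16 * B * exp (- (la / eps)) + 4 * c * eps ^ 2.
Proof.
intros Heps Hc Hla Hnf HB.
assert (Hone : forall w w1 w2, neumann_field eps 0 1 c w w1 w2 ->
  (forall x y, rect eps 0 1 x y -> Rabs (w x y) <= B) ->
  forall x x' y, 0 < x' < x -> x < eps -> la <= y <= 1 - la ->
  w x y - w x' y <= 16 * B * exp (- (la / eps)) + 4 * c * eps ^ 2).
{ intros w w1 w2 [[L [HL HLc]] Hcont Hwall Hlim] HwB x x' y Hx' Hx Hy.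
  assert (HB0 : 0 <= B).
  { apply Rle_trans with (1 := Rabs_pos (w x y)), HwB; split; lra. }
  assert (H := oscillation_decay eps 0 1 c B w w1 w2 L Hc HB0 HL HLc Hcont HwB Hwall Hlim
    x x' y Hx' Hx ltac:(lra)).
  assert (Hexp : forall s, la <= s -> exp (- (s / eps)) <= exp (- (la / eps))).
  { intros s Hs; destruct (Rle_lt_or_eq_dec _ _ Hs) as [Hlt| <-]; [|lra].
    left; apply exp_increasing, Ropp_lt_contravar.
    unfold Rdiv; apply Rmult_lt_compat_r; [now apply Rinv_0_lt_compat|assumption]. }
  assert (E1 := Hexp (y - 0) ltac:(lra)); assert (E2 := Hexp (1 - y) ltac:(lra)).
  nra. }
intros x x' y Hx Hx' Hy.
destruct (Rtotal_order x' x) as [H|[->|H]].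
- apply Hone with (1 := Hnf); try assumption; lra.
- rewrite Rminus_diag.
  assert (0 <= B).
  { apply Rle_trans with (1 := Rabs_pos (v x y)), HB; split; lra. }
  assert (E1 := exp_pos (- (la / eps))).
  assert (0 <= eps ^ 2) by apply pow2_ge_0.
  apply Rplus_le_le_0_compat; apply Rmult_le_pos; lra.
- apply neumann_field_opp in Hnf.
  assert (H1 := Hone _ _ _ Hnf).
  assert (HB' : forall x y, rect eps 0 1 x y -> Rabs (- v x y) <= B)
    by (intros; rewrite Rabs_Ropp; now apply HB).
  specialize (H1 HB' x' x y ltac:(lra) ltac:(lra) Hy). lra.
Qed.

(** The affine function agrees with [v] at the middle of both ends; elsewhere on the ends [v] is
    within [eta] of its middle value, and the source adds at most [c]. *)
Lemma slit_near_affine (eps c B la eta al be : R) (v v1 v2 : R -> R -> R)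
    (D := eta + c) :
  0 < eps -> 0 < c -> 0 < la <= 1 / 8 ->
  neumann_field eps 0 1 c v v1 v2 ->
  (forall x y, rect eps 0 1 x y -> Rabs (v x y) <= B) ->
  (forall x x' y, 0 < x < eps -> 0 < x' < eps -> la <= y <= 1 - la -> v x y - v x' y <= eta) ->
  v (eps / 2) la = al + be * la -> v (eps / 2) (1 - la) = al + be * (1 - la) ->
  forall x y, rect eps la (1 - la) x y -> v x y - (al + be * y) <= D.
Proof.
intros Heps Hc Hla Hnf HB Hosc Hv0 Hv1 x y Hr.
assert (Hnf' := neumann_field_affine _ _ _ _ _ _ _ al be
  (neumann_field_restrict _ 0 1 la (1 - la) _ _ _ _ ltac:(lra) ltac:(lra) Hnf)).
(* The comparison function is [eta + c (y - la) (1 - la - y)]. *)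
assert (H := neumann_field_max eps la (1 - la) c (eta - c * (la * (1 - la))) c c
  _ _ _ Hnf' ltac:(lra)).
cbv beta zeta in H.
apply Rle_trans with (eta - c * (la * (1 - la)) + c * y - c * y ^ 2).
- apply H; [| |assumption].
  + exists (B + Rabs al + Rabs be); intros x' y' [Hx' Hy'].
    assert (A1 := HB x' y' ltac:(split; lra)); apply Rabs_le_between in A1.
    assert (A2 := Rle_abs (- al)); assert (A3 := Rle_abs (- be)).
    rewrite Rabs_Ropp in A2; rewrite Rabs_Ropp in A3.
    assert (A4 := Rabs_pos be).
    assert (- (be * y') <= Rabs be) by nra.
    lra.
  + intros x' y' e Hx' Hy' He.
    assert (Hr' : rect eps 0 1 (eps / 2) y') by (destruct Hy' as [-> | ->]; split; lra).
    assert (Hc2 := nf_cont _ _ _ _ _ _ _ Hnf (eps / 2) y' Hr').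
    assert (Hc3 : continuity_2d_pt (fun x y => v x y - (al + be * y)) (eps / 2) y').
    { apply continuity_2d_pt_minus; [assumption|].
      apply (continuity_1d_2d_pt_comp (fun y => al + be * y) (fun _ y => y));
        [|apply continuity_2d_pt_id2].
      apply derivable_continuous_pt; reg. }
    destruct (cont2_near _ _ _ e Hc3 He) as [del [Hdel Hn]].
    exists del; split; [assumption|].
    intros x2 y2 Hx2 Hy2 [Hr2 Hr3].
    assert (B1 := Hosc x2 (eps / 2) y2 Hr2 ltac:(lra) ltac:(lra)).
    specialize (Hn (eps / 2) y2); rewrite Rminus_diag, Rabs_R0 in Hn.
    specialize (Hn Hdel Hy2).
    assert (Hz : v (eps / 2) y' - (al + be * y') = 0)
      by (destruct Hy' as [-> | ->]; lra).
    rewrite Hz in Hn; apply Rabs_def2 in Hn.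
    assert (0 <= c * ((y2 - la) * (1 - la - y2)))
      by (apply Rmult_le_pos; [lra|apply Rmult_le_pos; lra]).
    nra.
- unfold D. destruct Hr as [_ Hy].
  assert (c * (y - y ^ 2 - la * (1 - la)) <= c * 1) by (apply Rmult_le_compat_l; nra).
  nra.
Qed.

Lemma slit_gradient_upper (eps c D la : R) (w w1 w2 : R -> R -> R) (y0 : R) :
  0 < eps -> 0 < c -> 0 < la -> 2 * la <= y0 <= 1 - 2 * la ->
  neumann_field eps la (1 - la) c w w1 w2 ->
  (forall x y, rect eps la (1 - la) x y -> Rabs (w x y) <= D) ->
  forall x, 0 < x < eps -> w2 x y0 <= D / la + c * la.
Proof.
intros Heps Hc Hla Hy0 Hnf HD x Hx.
assert (Hg := neumann_field_reflect eps la (1 - la) c w w1 w2 y0 la ltac:(lra) ltac:(lra) Hnf).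
set (g := fun x s => w x (y0 + s) - w x (y0 - s)) in Hg.
assert (HD0 : 0 <= D).
{ apply Rle_trans with (1 := Rabs_pos (w x y0)), HD; split; lra. }
(* [be s - 2 c s^2] vanishes at [0] and equals the bound [2 D] of [g] at [s = la]; its slope [be] at
   [0] therefore bounds the slope [2 w2] of [g]. *)
set (be := 2 * D / la + 2 * c * la).
assert (Hmax := neumann_field_max eps 0 la (2 * c) 0 be (2 * c) _ _ _ Hg ltac:(lra)).
cbv beta zeta in Hmax.
assert (Hgb : forall x s, rect eps 0 la x s -> g x s <= 2 * D).
{ intros x' s [H1 H2]; unfold g.
  assert (A1 := HD x' (y0 + s) ltac:(split; lra)).
  assert (A2 := HD x' (y0 - s) ltac:(split; lra)).
  apply Rabs_le_between in A1; apply Rabs_le_between in A2; lra. }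
assert (Hgs : forall s, 0 < s < la -> g x s <= be * s).
{ intros s Hs.
  apply Rle_trans with (0 + be * s - 2 * c * s ^ 2).
  - apply Hmax; [now exists (2 * D)| |split; lra].
    intros x' y' e Hx' [-> | ->] He.
    + destruct (nf_lim _ _ _ _ _ _ _ Hnf x' y0 (e / 2) Hx' ltac:(lra) ltac:(lra))
        as [l [del [Hdel Hl]]].
      exists (Rmin del la); split; [now apply Rmin_pos|].
      intros x2 s2 Hx2 Hs2 [Hr2 Hr3].
      assert (A1 := Rmin_l del la); assert (A2 := Rmin_r del la).
      rewrite Rminus_0_r in Hs2.
      assert (B1 := Hl x2 (y0 + s2) ltac:(lra)).
      assert (B2 := Hl x2 (y0 - s2) ltac:(lra)).
      replace (y0 + s2 - y0) with s2 in B1 by ring.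
      replace (y0 - s2 - y0) with (- s2) in B2 by ring.
      rewrite Rabs_Ropp in B2.
      specialize (B1 ltac:(lra) ltac:(split; lra)).
      specialize (B2 ltac:(lra) ltac:(split; lra)).
      apply Rabs_le_between in B1; apply Rabs_le_between in B2.
      assert (0 <= be * s2 - 2 * c * s2 ^ 2).
      { assert (0 <= D / la) by (apply Rdiv_le_0_compat; lra).
        unfold be.
        replace ((2 * D / la + 2 * c * la) * s2 - 2 * c * s2 ^ 2)
          with (2 * (D / la) * s2 + 2 * (c * s2) * (la - s2)) by (field; lra).
        assert (0 <= c * s2) by (apply Rmult_le_pos; lra).
        apply Rplus_le_le_0_compat; apply Rmult_le_pos; lra. }
      unfold g; lra.
    + assert (Hbe : 0 <= be).
      { unfold be; assert (0 <= 2 * D / la) by (apply Rdiv_le_0_compat; lra).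
        assert (0 <= c * la) by (apply Rmult_le_pos; lra). lra. }
      exists (e / (be + 1)); split; [apply Rdiv_lt_0_compat; lra|].
      intros x2 s2 Hx2 Hs2 Hr.
      apply Rle_trans with (1 := Hgb _ _ Hr).
      destruct Hr as [Hr2 Hr3].
      replace (2 * D) with (be * la - 2 * c * la ^ 2) by (unfold be; field; lra).
      assert (2 * c * s2 ^ 2 <= 2 * c * la ^ 2).
      { apply Rmult_le_compat_l; [lra|]. apply pow_incr; lra. }
      assert (be * (la - s2) <= e).
      { apply Rabs_def2 in Hs2.
        apply Rle_trans with ((be + 1) * (e / (be + 1))).
        - apply Rmult_le_compat; lra.
        - apply Req_le; field; lra. }
      lra.
  - assert (0 <= c * s ^ 2) by (apply Rmult_le_pos; [lra|apply pow2_ge_0]). lra. }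
destruct (nf_lap _ _ _ _ _ _ _ Hnf) as [L [[v11 [v22 HL]] _]].
destruct (HL x y0 ltac:(split; lra)) as [_ [W2 _]].
assert (Dg : is_derive (fun s => g x s) 0 (2 * w2 x y0)).
{ apply (is_derive_sub (fun s => w x (y0 + s)) (fun s => w x (y0 - s)))
    with (1 * w2 x y0) ((-1) * w2 x y0); [| |ring].
  - apply (is_derive_comp (fun s => w x s) (fun t => y0 + t)).
    + now rewrite Rplus_0_r.
    + auto_derive; [exact I|ring].
  - apply (is_derive_comp (fun s => w x s) (fun t => y0 - t)).
    + now rewrite Rminus_0_r.
    + auto_derive; [exact I|ring]. }
apply is_derive_Reals in Dg.
apply Rnot_lt_le; intros Hlt.
assert (Hgap : 0 < 2 * w2 x y0 - be) by (unfold be; lra).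
destruct (Dg _ Hgap) as [del Hdel].
set (s := Rmin del la / 2).
assert (Hs : 0 < s /\ s < del /\ s < la).
{ assert (A1 := Rmin_l del la); assert (A2 := Rmin_r del la).
  assert (A3 := Rmin_pos del la (cond_pos del) Hla). unfold s; lra. }
clearbody s.
specialize (Hdel s ltac:(lra)).
rewrite (Rabs_pos_eq s) in Hdel by lra.
specialize (Hdel ltac:(lra)).
replace (g x 0) with 0 in Hdel by (unfold g; rewrite Rplus_0_r, Rminus_0_r; ring).
rewrite Rplus_0_l, Rminus_0_r in Hdel.
apply Rabs_def2 in Hdel.
assert (be < g x s / s) by lra.
assert (g x s / s <= be); [|lra].
apply Rmult_le_reg_r with s; [lra|].
unfold Rdiv; rewrite Rmult_assoc, Rinv_l, Rmult_1_r by lra.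
apply Hgs; lra.
Qed.

(** Dividing the size [B] of [v] by [la] would lose too much. Only the deviation from the affine
    interpolant of the middle values, of size [eta + c], is divided by [la]; the slope of the
    interpolant is at most [2 B / (1 - 2 la) <= 3 B]. *)
Lemma slit_gradient (eps c B la : R) (v v1 v2 : R -> R -> R) :
  0 < eps -> 0 < c -> 0 < la <= 1 / 8 ->
  neumann_field eps 0 1 c v v1 v2 ->
  (forall x y, rect eps 0 1 x y -> Rabs (v x y) <= B) ->
  forall x y, 0 < x < eps -> 2 * la <= y <= 1 - 2 * la ->
  Rabs (v2 x y)
    <= 3 * B + (16 * B * exp (- (la / eps)) + 4 * c * eps ^ 2 + c) / la + c * la.
Proof.
intros Heps Hc Hla Hnf HB x y Hx Hy.
set (eta := 16 * B * exp (- (la / eps)) + 4 * c * eps ^ 2).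
assert (Hosc := slit_oscillation eps c B la v v1 v2 Heps Hc ltac:(lra) Hnf HB).
fold eta in Hosc.
set (be := (v (eps / 2) (1 - la) - v (eps / 2) la) / (1 - 2 * la)).
set (al := v (eps / 2) la - be * la).
assert (Hv0 : v (eps / 2) la = al + be * la) by (unfold al; ring).
assert (Hv1 : v (eps / 2) (1 - la) = al + be * (1 - la))
  by (unfold al, be; field; lra).
assert (HD : forall x y, rect eps la (1 - la) x y -> Rabs (v x y - (al + be * y)) <= eta + c).
{ intros x' y' Hr; apply Rabs_le; split.
  - assert (H := slit_near_affine eps c B la eta (- al) (- be) (fun x y => - v x y)
      (fun x y => - v1 x y) (fun x y => - v2 x y) Heps Hc Hla (neumann_field_opp _ _ _ _ _ _ _ Hnf)).
    cbv beta zeta in H.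
    assert (- v x' y' - (- al + - be * y') <= eta + c); [|lra].
    apply H; try lra; try assumption.
    + intros; rewrite Rabs_Ropp; now apply HB.
    + intros x2 x3 y2 H2 H3 Hy2; specialize (Hosc x3 x2 y2 H3 H2 Hy2); lra.
  - now apply (slit_near_affine eps c B la eta al be v v1 v2). }
assert (Hbe : Rabs be <= 3 * B).
{ assert (A1 := HB (eps / 2) la ltac:(split; lra)).
  assert (A2 := HB (eps / 2) (1 - la) ltac:(split; lra)).
  unfold be, Rdiv; rewrite Rabs_mult, Rabs_inv, (Rabs_pos_eq (1 - 2 * la)) by lra.
  apply Rmult_le_reg_r with (1 - 2 * la); [lra|].
  rewrite Rmult_assoc, Rinv_l by lra.
  assert (Rabs (v (eps / 2) (1 - la) - v (eps / 2) la) <= 2 * B).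
  { apply Rabs_le_between in A1; apply Rabs_le_between in A2; apply Rabs_le; lra. }
  assert (0 <= B) by (apply Rle_trans with (2 := A1), Rabs_pos).
  fold (eps / 2). nra. }
assert (Hnf' := neumann_field_affine _ _ _ _ _ _ _ al be
  (neumann_field_restrict _ 0 1 la (1 - la) _ _ _ _ ltac:(lra) ltac:(lra) Hnf)).
assert (U1 := slit_gradient_upper eps c (eta + c) la _ _ _ y Heps Hc ltac:(lra) Hy Hnf' HD x Hx).
assert (U2 := slit_gradient_upper eps c (eta + c) la _ _ _ y Heps Hc ltac:(lra) Hy
   (neumann_field_opp _ _ _ _ _ _ _ Hnf')
   (fun x y Hr => eq_ind_r (fun z => z <= eta + c) (HD x y Hr) (Rabs_Ropp _)) x Hx).
cbv beta in U1, U2.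
apply Rabs_le_between in Hbe.
apply Rabs_le; unfold eta in *; lra.
Qed.

(** * Complex moduli as maxima of real projections *)

(** For [c^2 + s^2 = 1], the real part of [z] after a rotation. It is linear, hence inherits the
    equation, and [Cmod z] is its maximum over all rotations: maximum principles for moduli reduce
    to real functions. *)
Definition pr (c s : R) (z : C) : R := c * fst z + s * snd z.

Lemma Cmod_sqr (z : C) : Cmod z ^ 2 = fst z ^ 2 + snd z ^ 2.
Proof. unfold Cmod; rewrite pow2_sqrt; [reflexivity|]. apply Rplus_le_le_0_compat; apply pow2_ge_0. Qed.

Lemma pr_le_Cmod (c s : R) (z : C) : c ^ 2 + s ^ 2 = 1 -> pr c s z <= Cmod z.
Proof.
intros H; apply Rnot_lt_le; intros Hlt.
assert (H0 := Cmod_ge_0 z).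
assert (H2 : Cmod z ^ 2 < pr c s z ^ 2) by nra.
rewrite Cmod_sqr in H2; unfold pr in H2.
assert (0 <= (c * snd z - s * fst z) ^ 2) by apply pow2_ge_0.
nra.
Qed.

Lemma Rabs_pr_le (c s : R) (z : C) : c ^ 2 + s ^ 2 = 1 -> Rabs (pr c s z) <= Cmod z.
Proof.
intros H; apply Rabs_le; split; [|now apply pr_le_Cmod].
assert (H1 := pr_le_Cmod (- c) (- s) z ltac:(nra)). unfold pr in *; lra.
Qed.

Lemma pr_attains (z : C) : exists c s, c ^ 2 + s ^ 2 = 1 /\ pr c s z = Cmod z.
Proof.
destruct (Req_dec (Cmod z) 0) as [H|H].
- exists 1, 0; split; [ring|].
  apply Cmod_eq_0 in H; rewrite H; unfold pr; rewrite Cmod_0; simpl; ring.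
- assert (H2 := Cmod_sqr z).
  exists (fst z / Cmod z), (snd z / Cmod z); split.
  + replace ((fst z / Cmod z) ^ 2 + (snd z / Cmod z) ^ 2)
      with ((fst z ^ 2 + snd z ^ 2) / Cmod z ^ 2) by (field; assumption).
    rewrite <- H2; field; assumption.
  + unfold pr.
    replace (fst z / Cmod z * fst z + snd z / Cmod z * snd z)
      with ((fst z ^ 2 + snd z ^ 2) / Cmod z) by (field; assumption).
    rewrite <- H2; field; assumption.
Qed.

Lemma Cmod_le_of_pr (z : C) (B : R) :
  (forall c s, c ^ 2 + s ^ 2 = 1 -> pr c s z <= B) -> Cmod z <= B.
Proof. intros H; destruct (pr_attains z) as [c [s [H1 <-]]]; now apply H. Qed.

Lemma lap_max (O : R -> R -> Prop) (f f1 f2 L : R -> R -> R) x y :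
  lap_on O f f1 f2 L -> near2 O x y -> near2 (fun a b => f a b <= f x y) x y ->
  L x y <= 0.
Proof.
intros [f11 [f22 Hf]] [d1 [Hd1 H1]] [d2 [Hd2 H2]].
assert (H0 : O x y) by (apply H1; rewrite Rminus_diag, Rabs_R0; assumption).
destruct (Hf x y H0) as [_ [_ [F11 [F22 FL]]]].
set (r := Rmin d1 d2).
assert (Hr : 0 < r /\ r <= d1 /\ r <= d2).
{ unfold r; split; [now apply Rmin_pos|split; [apply Rmin_l|apply Rmin_r]]. }
assert (T1 : f11 x y <= 0).
{ apply max_second_derivative with (fun t => f t y) (fun t => f1 t y) x r;
    [lra| |assumption|].
  - intros t Ht; apply Hf, H1; [lra|rewrite Rminus_diag, Rabs_R0; lra].
  - intros t Ht; apply H2; [lra|rewrite Rminus_diag, Rabs_R0; lra]. }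
assert (T2 : f22 x y <= 0).
{ apply max_second_derivative with (fun t => f x t) (fun t => f2 x t) y r;
    [lra| |assumption|].
  - intros t Ht; apply Hf, H1; [rewrite Rminus_diag, Rabs_R0; lra|lra].
  - intros t Ht; apply H2; [rewrite Rminus_diag, Rabs_R0; lra|lra]. }
lra.
Qed.

(** * Explicit bounds for hyperbolic and circular functions *)

Lemma cosh_ge_1 (x : R) : 1 <= cosh x.
Proof.
unfold cosh; rewrite exp_Ropp.
assert (H := exp_pos x).
assert (0 <= (exp x - 1) ^ 2 * / exp x).
{ apply Rmult_le_pos; [apply pow2_ge_0|left; now apply Rinv_0_lt_compat]. }
replace ((exp x - 1) ^ 2 * / exp x) with (exp x + / exp x - 2) in H0 by (field; lra).
lra.
Qed.

Lemma sinh_ge_id (x : R) : 0 <= x -> x <= sinh x.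
Proof.
intros Hx.
assert (H := derive_lower_bound sinh cosh 0 x 1 Hx).
rewrite sinh_0, Rminus_0_r, Rplus_0_l, Rmult_1_l in H.
apply H; intros; [|apply cosh_ge_1].
apply is_derive_Reals, derivable_pt_lim_sinh.
Qed.

Lemma cosh_half (x : R) : cosh x = 1 + 2 * sinh (x / 2) ^ 2.
Proof.
unfold cosh, sinh.
replace x with (x / 2 + x / 2) at 1 2 by field.
rewrite Ropp_plus_distr, !exp_plus, exp_Ropp.
assert (H := exp_pos (x / 2)).
field; lra.
Qed.

Lemma sinh_opp (x : R) : sinh (- x) = - sinh x.
Proof. unfold sinh; rewrite Ropp_involutive; field. Qed.

Lemma cosh_opp (x : R) : cosh (- x) = cosh x.
Proof. unfold cosh; rewrite Ropp_involutive; field. Qed.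

Lemma cosh_ge_quad (x : R) : 1 + x ^ 2 / 2 <= cosh x.
Proof.
rewrite cosh_half.
assert (H : (x / 2) ^ 2 <= sinh (x / 2) ^ 2).
{ destruct (Rle_lt_dec 0 x).
  - apply pow_incr; split; [lra|apply sinh_ge_id; lra].
  - replace (sinh (x / 2) ^ 2) with (sinh (- (x / 2)) ^ 2) by (rewrite sinh_opp; ring).
    replace ((x / 2) ^ 2) with ((- (x / 2)) ^ 2) by ring.
    apply pow_incr; split; [lra|apply sinh_ge_id; lra]. }
lra.
Qed.

Lemma sinh_pos (x : R) : 0 < x -> 0 < sinh x.
Proof. intros Hx; assert (H := sinh_ge_id x ltac:(lra)); lra. Qed.

Lemma cosh_le_exp (x : R) : 0 <= x -> cosh x <= exp x.
Proof.
intros Hx; unfold cosh.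
assert (exp (- x) <= exp x); [|lra].
destruct (Rle_lt_or_eq_dec _ _ Hx) as [H| <-].
- left; apply exp_increasing; lra.
- rewrite Ropp_0; lra.
Qed.

Lemma cosh_increasing (x y : R) : 0 <= x <= y -> cosh x <= cosh y.
Proof.
intros Hxy.
assert (H := derive_lower_bound cosh sinh x y 0 ltac:(lra)).
rewrite Rmult_0_l, Rplus_0_r in H; apply H; intros t Ht.
- apply is_derive_Reals, derivable_pt_lim_cosh.
- apply Rle_trans with t; [lra|apply sinh_ge_id; lra].
Qed.

Lemma cosh_abs (x y : R) : Rabs x <= y -> cosh x <= cosh y.
Proof.
intros H; destruct (Rle_lt_dec 0 x).
- apply cosh_increasing; rewrite Rabs_pos_eq in H; lra.
- rewrite <- cosh_opp; apply cosh_increasing.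
  rewrite Rabs_left in H; lra.
Qed.

Lemma exp_le_inv (x : R) : 0 <= x < 1 -> exp x <= / (1 - x).
Proof.
intros Hx; assert (H := exp_ineq1_le (- x)); rewrite exp_Ropp in H.
rewrite <- (Rinv_inv (exp x)).
apply Rinv_le_contravar; lra.
Qed.

(** The coefficient has to be close to [1/2]: the comparison of the two barrier branches around the
    aperture lives on the gap between [69/100] and [97/100]. *)
Lemma cosh_le_quad (s : R) : 0 <= s <= 1 / 10 -> cosh s <= 1 + 56 / 100 * s ^ 2.
Proof.
intros Hs; rewrite cosh_half.
assert (Hc : cosh (s / 2) <= 20 / 19).
{ apply Rle_trans with (1 := cosh_le_exp (s / 2) ltac:(lra)).
  apply Rle_trans with (1 := exp_le_inv (s / 2) ltac:(lra)).
  replace (20 / 19) with (/ (1 - 1 / 20)) by field.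
  apply Rinv_le_contravar; lra. }
assert (Hsh : sinh (s / 2) <= 20 / 19 * (s / 2)).
{ assert (H := derive_lower_bound (fun t => - sinh t) (fun t => - cosh t) 0 (s / 2)
    (- (20 / 19)) ltac:(lra)).
  cbv beta in H; rewrite sinh_0 in H.
  assert (- 0 + - (20 / 19) * (s / 2 - 0) <= - sinh (s / 2)); [|lra].
  apply H; intros t Ht.
  - apply @is_derive_opp with (f := sinh). apply is_derive_Reals, derivable_pt_lim_sinh.
  - assert (H1 := cosh_increasing t (s / 2) ltac:(lra)); lra. }
assert (H0 : 0 <= sinh (s / 2)) by (apply Rle_trans with (s / 2); [lra|apply sinh_ge_id; lra]).
nra.
Qed.

Lemma one_minus_cos (x : R) : 1 - cos x = 2 * sin (x / 2) ^ 2.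
Proof. replace x with (2 * (x / 2)) at 1 by field; rewrite cos_2a_sin; ring. Qed.

Lemma sin_le_id (x : R) : 0 <= x -> sin x <= x.
Proof.
intros Hx; destruct (Rle_lt_or_eq_dec _ _ Hx) as [H| <-].
- left; now apply sin_lt_x.
- rewrite sin_0; lra.
Qed.

Lemma sin_sqr_le (x : R) : sin x ^ 2 <= x ^ 2.
Proof.
assert (H : forall t, 0 <= t -> sin t ^ 2 <= t ^ 2).
{ intros t Ht; destruct (Rle_lt_dec t 1).
  - apply pow_incr; split; [|now apply sin_le_id].
    assert (HPI := PI2_3_2); apply sin_ge_0; lra.
  - assert (H := SIN_bound t); nra. }
destruct (Rle_lt_dec 0 x); [now apply H|].
replace (x ^ 2) with ((- x) ^ 2) by ring.
replace (sin x ^ 2) with (sin (- x) ^ 2) by (rewrite sin_neg; ring).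
apply H; lra.
Qed.

Lemma cos_ge_quad (x : R) : 1 - x ^ 2 / 2 <= cos x.
Proof. assert (H := one_minus_cos x); assert (H1 := sin_sqr_le (x / 2)); nra. Qed.

Lemma sin_ge_mult (x : R) : 0 <= x <= 1 -> x * (1 - x ^ 2 / 2) <= sin x.
Proof.
intros Hx.
assert (H := derive_lower_bound sin cos 0 x (1 - x ^ 2 / 2) ltac:(lra)).
rewrite sin_0 in H.
assert (0 + (1 - x ^ 2 / 2) * (x - 0) <= sin x); [|lra].
apply H; intros t Ht.
- apply is_derive_Reals, derivable_pt_lim_sin.
- assert (H1 := cos_ge_quad t); nra.
Qed.

Lemma cos_le_quad (s : R) : 0 <= s <= 1 / 10 -> cos s <= 1 - 49 / 100 * s ^ 2.
Proof.
intros Hs; assert (H := one_minus_cos s).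
assert (H1 := sin_ge_mult (s / 2) ltac:(lra)).
assert (H2 : 99 / 100 * (s / 2) <= sin (s / 2)) by nra.
assert (H3 : (99 / 100 * (s / 2)) ^ 2 <= sin (s / 2) ^ 2) by (apply pow_incr; lra).
nra.
Qed.

(** * The periodic logarithm and the two branches of the barrier *)

Lemma cosh2_sinh2 (x : R) : cosh x ^ 2 - sinh x ^ 2 = 1.
Proof. unfold cosh, sinh; rewrite exp_Ropp; assert (H := exp_pos x); field; lra. Qed.

(** The Green function of the Laplacian with period [2 PI / a] in [x], with poles at [(2 PI n / a, 0)]. *)
Definition lg (a x y : R) : R := - ln (cosh (a * y) - cos (a * x)) / 2.
Definition lg1 (a x y : R) : R := - (a * sin (a * x)) / (2 * (cosh (a * y) - cos (a * x))).
Definition lg2 (a x y : R) : R := - (a * sinh (a * y)) / (2 * (cosh (a * y) - cos (a * x))).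

Lemma lap_lg (a x0 y0 : R) :
  lap_on (fun x y => 0 < cosh (a * (y - y0)) - cos (a * (x - x0)))
    (fun x y => lg a (x - x0) (y - y0)) (fun x y => lg1 a (x - x0) (y - y0))
    (fun x y => lg2 a (x - x0) (y - y0)) (fun _ _ => 0).
Proof.
set (D := fun x y => cosh (a * (y - y0)) - cos (a * (x - x0))).
exists (fun x y => - (a ^ 2 * cos (a * (x - x0)) * D x y - (a * sin (a * (x - x0))) ^ 2)
   / (2 * D x y ^ 2)).
exists (fun x y => - (a ^ 2 * cosh (a * (y - y0)) * D x y - (a * sinh (a * (y - y0))) ^ 2)
   / (2 * D x y ^ 2)).
intros x y HD; unfold lg, lg1, lg2.
split; [|split; [|split; [|split]]].
- auto_derive; [assumption|]; unfold Rminus, Rdiv in *; field; lra.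
- auto_derive; [assumption|]; unfold Rminus, Rdiv in *; field; lra.
- auto_derive; [unfold Rminus in *; lra|]; unfold D, Rminus, Rdiv in *; field; lra.
- auto_derive; [unfold Rminus in *; lra|]; unfold D, Rminus, Rdiv in *; field; lra.
- assert (H1 := sin2_cos2 (a * (x - x0))); unfold Rsqr in H1.
  assert (H2 := cosh2_sinh2 (a * (y - y0))).
  unfold D in *.
  set (S := sin (a * (x - x0))) in *; set (K := cos (a * (x - x0))) in *.
  set (T := sinh (a * (y - y0))) in *; set (M := cosh (a * (y - y0))) in *.
  replace (S * S) with (S ^ 2) in H1 by ring; replace (K * K) with (K ^ 2) in H1 by ring.
  assert (H3 : S ^ 2 = 1 - K ^ 2) by lra.
  assert (H4 : T ^ 2 = M ^ 2 - 1) by lra.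
  rewrite !Rpow_mult_distr, H3, H4; field; lra.
Qed.

(** [y] is the height above a face and [1] the thickness of the slab. Only the slit at the origin is
    attached; the others are accounted for by the periodicity of moduli above the face. *)
Definition dom (eps x y : R) : Prop := 0 < y \/ (0 < x < eps /\ -1 < y <= 0).

(** The pole lies at depth [eps] below the middle of the aperture, so the logarithm is smooth for
    [y >= 0]. The term in [y^2] supplies the negative Laplacian [- 2 k^2 Lam] that outweighs the
    terms in [k^2], and [Q] keeps the sum positive up to the height considered. *)
Definition bracket (eps d k Q Lam x y : R) : R :=
  lg (2 * PI / d) (x - eps / 2) (y - - eps) + (Q - k ^ 2 * Lam * y ^ 2).

(** Why [40]: from the corners of the aperture to the outer edges of the box above it [lg] drops by
    at least [1/10], so [barP] drops by at least [4 A eps], more than [barZ], whose slope is about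
    [3 A], can lose across the box. *)
Definition barP (eps d k A Q Lam x y : R) : R := 40 * A * eps * bracket eps d k Q Lam x y.

(** The linear term lifts it above [A] in the lower half of the slit, the term in [y^2] makes the
    Laplacian negative, and the last one has outward slope [2 k A] at the walls, against a normal
    derivative of the field of about [k A] at most. *)
Definition barZ (eps d k A Q Lam x y : R) : R :=
  barP eps d k A Q Lam 0 0 - 3 * A * y - A / 4 * y ^ 2
  + 2 * k * A / eps * ((x - eps / 2) ^ 2 - eps ^ 2 / 4).

(** The region where [barZ] is used: the slit, and a small box above its end. *)
Definition zoneZ (eps x y : R) : Prop :=
  (0 < x < eps /\ -1 < y <= 0) \/ (Rabs (x - eps / 2) <= eps /\ 0 < y <= eps).

(** The bounds on the bracket amount to [10 A eps <= barP <= A]; the lower one matches the bound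
    required of the field on the top line. *)
Record slot_numbers (eps d k H A Q Lam : R) : Prop := {
  sn_eps : 0 < eps <= 1 / 100;
  sn_d : 0 < d;
  sn_a : 2 * PI / d * eps <= 1 / 10;
  sn_A : 0 < A;
  sn_k : 0 < k;
  sn_k32 : 32 * k <= eps;
  sn_H : eps < H;
  sn_Lam : 40 * eps * Lam <= 1;
  sn_br : forall x y, 0 <= y <= H -> 1 / 4 <= bracket eps d k Q Lam x y < Lam }.

Lemma cosh_gt_cos (t u : R) : t <> 0 -> 0 < cosh t - cos u.
Proof.
intros Ht; assert (H := cosh_ge_quad t); assert (H1 := COS_bound u).
assert (0 < t ^ 2) by (apply pow2_gt_0; assumption). lra.
Qed.

Lemma continuity_lg (a x0 y0 x y : R) :
  0 < cosh (a * (y - y0)) - cos (a * (x - x0)) ->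
  continuity_2d_pt (fun x y => lg a (x - x0) (y - y0)) x y.
Proof.
intros HD; unfold lg.
apply (continuity_1d_2d_pt_comp (fun t => - ln t / 2)
  (fun x y => cosh (a * (y - y0)) - cos (a * (x - x0)))).
- apply derivable_continuous_pt; eexists; apply is_derive_Reals; auto_derive;
    [assumption|reflexivity].
- apply continuity_2d_pt_minus.
  + apply (continuity_1d_2d_pt_comp (fun y => cosh (a * (y - y0))) (fun _ y => y));
      [|apply continuity_2d_pt_id2].
    apply derivable_continuous_pt; eexists; apply is_derive_Reals; auto_derive;
      [exact I|reflexivity].
  + apply (continuity_1d_2d_pt_comp (fun x => cos (a * (x - x0))) (fun x _ => x));
      [|apply continuity_2d_pt_id1].
    apply derivable_continuous_pt; eexists; apply is_derive_Reals; auto_derive;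
      [exact I|reflexivity].
Qed.

Lemma mult_small (b c t u w : R) : 0 <= b <= c -> - u <= t <= w -> 0 <= u -> 0 <= w ->
  - (c * u) <= b * t <= c * w.
Proof.
intros Hb Ht Hu Hw; split.
- apply Rle_trans with (b * - u); [|apply Rmult_le_compat_l; lra].
  assert (b * u <= c * u) by (apply Rmult_le_compat_r; lra). lra.
- apply Rle_trans with (b * w); [apply Rmult_le_compat_l; lra|].
  apply Rmult_le_compat_r; lra.
Qed.

Ltac to_R_eq := match goal with |- @eq _ ?a ?b => change (@eq R a b) end.

(** * Estimates of the barrier branches and of the corner function *)

Section Numbers.
Context {eps d k H A Q Lam : R} (N : slot_numbers eps d k H A Q Lam).
Let a := 2 * PI / d.
Let P := barP eps d k A Q Lam.
Let Z := barZ eps d k A Q Lam.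

Lemma sn_a_pos : 0 < a.
Proof. destruct N; unfold a; assert (HPI := PI_RGT_0); apply Rdiv_lt_0_compat; lra. Qed.

Lemma sn_eps_d : 60 * eps <= d.
Proof.
destruct N as [He Hd Ha _ _ _ _ _ _]; assert (HPI := PI2_3_2).
assert (H1 : 2 * PI * eps <= d / 10).
{ replace (2 * PI * eps) with (2 * PI / d * eps * d) by (field; lra).
  replace (d / 10) with (1 / 10 * d) by field.
  apply Rmult_le_compat_r; lra. }
nra.
Qed.

Lemma barP_bounds x y : 0 <= y <= H -> 10 * A * eps <= P x y <= A.
Proof.
intros Hy; destruct N as [He Hd Ha HA Hk Hk32 HH HL Hbr].
destruct (Hbr x y Hy) as [B1 B2]; unfold P, barP.
assert (0 < A * eps) by (apply Rmult_lt_0_compat; lra).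
split; [nra|].
replace A with (1 * A) at 2 by ring.
apply Rle_trans with (40 * eps * Lam * A); [|apply Rmult_le_compat_r; lra].
nra.
Qed.

Lemma barZ_slit_coef : 0 <= 2 * k * A / eps <= A / 16.
Proof.
destruct N as [He Hd Ha HA Hk Hk32 HH HL Hbr].
split.
- apply Rdiv_le_0_compat; [|lra]. apply Rmult_le_pos; lra.
- apply Rmult_le_reg_r with eps; [lra|].
  unfold Rdiv; rewrite Rmult_assoc, Rinv_l by lra. nra.
Qed.

Lemma sqr_le_of_abs (t e : R) : Rabs t <= e -> t ^ 2 <= e ^ 2.
Proof. intros Ht; apply Rabs_le_between in Ht; nra. Qed.

Lemma barZ_bounds x y : zoneZ eps x y -> A * eps <= Z x y <= 4 * A.
Proof.
intros Hz; assert (HP := barP_bounds 0 0 ltac:(destruct N; lra)).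
assert (Hb := barZ_slit_coef).
destruct N as [He Hd Ha HA Hk Hk32 HH HL Hbr].
unfold Z, barZ; fold P.
assert (HAe : 0 < A * eps) by (apply Rmult_lt_0_compat; lra).
assert (HAe2 : 0 < A * eps ^ 2 <= A * eps * (1/100)) by nra.
destruct Hz as [[Hx Hy]|[Hx Hy]].
- assert (Hq : - (eps ^ 2) / 4 <= (x - eps / 2) ^ 2 - eps ^ 2 / 4 <= 0)
    by (assert (0 <= x * (eps - x)) by (apply Rmult_le_pos; lra);
        assert (H1 := pow2_ge_0 (x - eps / 2)); split; nra).
  assert (- (A / 16 * (eps ^ 2 / 4)) <= 2 * k * A / eps * ((x - eps / 2) ^ 2 - eps ^ 2 / 4) <= 0).
  { assert (Hp := pow2_ge_0 eps); replace 0 with (A / 16 * 0) by ring; apply mult_small; lra. }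
  assert (0 <= A * (- y) /\ 0 <= A * (1 + y) /\ 0 <= A * (- y * (1 + y))).
  { repeat split; apply Rmult_le_pos; try lra; apply Rmult_le_pos; lra. }
  split; nra.
- assert (Hq : - (eps ^ 2) / 4 <= (x - eps / 2) ^ 2 - eps ^ 2 / 4 <= eps ^ 2).
  { apply sqr_le_of_abs in Hx; assert (H0 := pow2_ge_0 (x - eps / 2)); lra. }
  assert (- (A / 16 * (eps ^ 2 / 4)) <= 2 * k * A / eps * ((x - eps / 2) ^ 2 - eps ^ 2 / 4) <= A / 16 * eps ^ 2).
  { assert (Hp := pow2_ge_0 eps); apply mult_small; lra. }
  assert (0 <= A * y /\ A * y <= A * eps /\ A * y ^ 2 <= A * eps ^ 2 /\ 0 <= A * y ^ 2).
  { split; [apply Rmult_le_pos; lra|split; [apply Rmult_le_compat_l; lra|]].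
    split; [apply Rmult_le_compat_l; nra|apply Rmult_le_pos; [lra|apply pow2_ge_0]]. }
  split; nra.
Qed.

Lemma barZ_low x y : 0 < x < eps -> -1 < y <= - 1 / 2 -> A <= Z x y.
Proof.
intros Hx Hy; assert (HP := barP_bounds 0 0 ltac:(destruct N; lra)).
assert (Hb := barZ_slit_coef).
destruct N as [He Hd Ha HA Hk Hk32 HH HL Hbr].
unfold Z, barZ; fold P.
assert (HAe : 0 < A * eps) by (apply Rmult_lt_0_compat; lra).
assert (HAe2 : 0 < A * eps ^ 2 <= A * eps * (1/100)) by nra.
assert (Hq : - (eps ^ 2) / 4 <= (x - eps / 2) ^ 2 - eps ^ 2 / 4 <= 0)
    by (assert (0 <= x * (eps - x)) by (apply Rmult_le_pos; lra);
        assert (H1 := pow2_ge_0 (x - eps / 2)); split; nra).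
assert (- (A / 16 * (eps ^ 2 / 4)) <= 2 * k * A / eps * ((x - eps / 2) ^ 2 - eps ^ 2 / 4) <= 0).
{ assert (Hp := pow2_ge_0 eps); replace 0 with (A / 16 * 0) by ring; apply mult_small; lra. }
assert (0 <= A * (- 1 / 2 - y) /\ A * y ^ 2 <= A * 1).
{ split; [apply Rmult_le_pos; lra|apply Rmult_le_compat_l; nra]. }
nra.
Qed.

Lemma barZ_aperture_le_P0 x : 0 < x < eps -> Z x 0 <= P 0 0.
Proof.
intros Hx; assert (Hb := barZ_slit_coef).
unfold Z, barZ; fold P.
assert (Hq : (x - eps / 2) ^ 2 - eps ^ 2 / 4 <= 0)
    by (assert (0 <= x * (eps - x)) by (apply Rmult_le_pos; lra);
        nra).
assert (Hp := pow2_ge_0 eps); assert (Hp' := pow2_ge_0 (x - eps / 2)).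
destruct (mult_small (2 * k * A / eps) (A / 16) ((x - eps / 2) ^ 2 - eps ^ 2 / 4)
  (eps ^ 2 / 4) 0) as [_ H1]; try lra.
Qed.

Lemma ln_monotone (x y : R) : 0 < x <= y -> ln x <= ln y.
Proof.
intros [Hx Hy]; destruct (Rle_lt_or_eq_dec _ _ Hy) as [Hlt| ->]; [|lra].
left; now apply ln_increasing.
Qed.

(** Permits the exchange of [P] for [Z] in the aperture. Over the aperture the logarithm is smallest
    at the corners, hence the value [P 0 0] in [barZ]. *)
Lemma barZ_le_barP x : 0 < x < eps -> Z x 0 <= P x 0.
Proof.
intros Hx; apply Rle_trans with (1 := barZ_aperture_le_P0 x Hx).
assert (Hapos := sn_a_pos).
destruct N as [He Hd Ha HA Hk Hk32 HH HL Hbr].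
unfold P, barP, bracket.
apply Rmult_le_compat_l; [apply Rmult_le_pos; lra|].
apply Rplus_le_compat_r; unfold lg; fold a.
assert (ln (cosh (a * (0 - - eps)) - cos (a * (x - eps / 2)))
   <= ln (cosh (a * (0 - - eps)) - cos (a * (0 - eps / 2)))); [|lra].
apply ln_monotone; split.
- apply cosh_gt_cos. assert (0 < a * (0 - - eps)) by (apply Rmult_lt_0_compat; lra). lra.
- assert (cos (a * (0 - eps / 2)) <= cos (a * (x - eps / 2))); [|lra].
  replace (a * (0 - eps / 2)) with (- (a * (eps / 2))) by ring; rewrite cos_neg.
  assert (HPI := PI2_3_2).
  assert (Hs : a * (eps / 2) <= 1 / 20) by (unfold a; lra).
  destruct (Rle_lt_dec 0 (x - eps / 2)) as [H0|H0].
  + apply cos_decr_1; try nra.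
  + rewrite <- (cos_neg (a * (x - eps / 2))).
    apply cos_decr_1; try nra.
Qed.

(** On the outer edges of the box the logarithm has dropped by at least [ln (7/5)]. *)
Lemma barP_le_barZ x y : Rabs (x - eps / 2) <= eps -> 0 < y <= eps ->
  Rabs (x - eps / 2) = eps \/ y = eps -> P x y <= Z x y.
Proof.
intros Hx Hy Hedge.
assert (Hb := barZ_slit_coef). assert (Hapos := sn_a_pos).
destruct N as [He Hd Ha HA Hk Hk32 HH HL Hbr].
assert (HAe : 0 < A * eps) by (apply Rmult_lt_0_compat; lra).
assert (HAe2 : 0 < A * eps ^ 2 <= A * eps * (1/100)) by nra.
fold a in Ha.
set (s := a * eps) in *.
assert (Hs : 0 < s) by (apply Rmult_lt_0_compat; lra).
assert (HZ : P 0 0 - 4 * (A * eps) <= Z x y).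
{ unfold Z, barZ; fold P.
  assert (Hq : - (eps ^ 2) / 4 <= (x - eps / 2) ^ 2 - eps ^ 2 / 4)
    by (assert (H0 := pow2_ge_0 (x - eps / 2)); lra).
  assert (- (A / 16 * (eps ^ 2 / 4)) <= 2 * k * A / eps * ((x - eps / 2) ^ 2 - eps ^ 2 / 4)).
  { assert (Hp := pow2_ge_0 eps).
    apply (mult_small _ (A / 16) _ (eps ^ 2 / 4) (Rmax 0 ((x - eps / 2) ^ 2 - eps ^ 2 / 4)));
      [lra| |lra|apply Rmax_l]. split; [lra|apply Rmax_r]. }
  assert (A * y <= A * eps /\ A * y ^ 2 <= A * eps ^ 2).
  { split; apply Rmult_le_compat_l; try lra; apply pow_incr; lra. }
  lra. }
apply Rle_trans with (2 := HZ).
set (D := cosh (a * (y - - eps)) - cos (a * (x - eps / 2))).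
set (D0 := cosh (a * (0 - - eps)) - cos (a * (0 - eps / 2))).
assert (Ey : a * (y - - eps) = a * y + s) by (unfold s; ring).
assert (Hay : 0 < a * y) by (apply Rmult_lt_0_compat; lra).
assert (HD0 : 0 < D0 <= 69 / 100 * s ^ 2).
{ unfold D0; replace (a * (0 - - eps)) with s by (unfold s; ring).
  replace (a * (0 - eps / 2)) with (- (s / 2)) by (unfold s; field).
  split; [apply cosh_gt_cos; lra|].
  rewrite cos_neg.
  assert (C1 := cosh_le_quad s ltac:(lra)). assert (C2 := cos_ge_quad (s / 2)). nra. }
assert (HD : 97 / 100 * s ^ 2 <= D).
{ unfold D; rewrite Ey; destruct Hedge as [Hedge|Hedge].
  - assert (C1 := cosh_ge_quad (a * y + s)).
    assert (C2 : cos (a * (x - eps / 2)) <= 1 - 49 / 100 * s ^ 2).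
    { unfold Rabs in Hedge; destruct (Rcase_abs (x - eps / 2)).
      - replace (x - eps / 2) with (- eps) by lra; replace (a * - eps) with (- s) by (unfold s; ring).
        rewrite cos_neg; apply cos_le_quad; lra.
      - rewrite Hedge; fold s; apply cos_le_quad; lra. }
    nra.
  - rewrite Hedge; fold s.
    assert (C1 := cosh_ge_quad (s + s)). assert (C2 := COS_bound (a * (x - eps / 2))). nra. }
(* [D0 / D <= 69/97 < 4/5], and [1 + t <= exp t] turns this into a difference of logarithms of at
   least [1/5]. *)
assert (Hln : 1 / 5 <= ln D - ln D0).
{ assert (E := exp_ineq1_le (- (ln D - ln D0))).
  replace (- (ln D - ln D0)) with (ln D0 + - ln D) in E by ring.
  rewrite exp_plus, exp_Ropp, !exp_ln in E by lra.
  assert (D0 * / D <= 4 / 5); [|lra].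
  apply Rmult_le_reg_r with D; [lra|].
  rewrite Rmult_assoc, Rinv_l by lra. nra. }
unfold P, barP, bracket, lg; fold a; fold D; fold D0.
assert (0 <= k ^ 2 * Lam * y ^ 2).
{ assert (0 <= Lam) by (destruct (Hbr 0 0); lra).
  apply Rmult_le_pos; [apply Rmult_le_pos; [apply pow2_ge_0|assumption]|apply pow2_ge_0]. }
nra.
Qed.

Lemma lap_barP : lap_on (fun _ y => 0 < y) P
  (fun x y => 40 * A * eps * lg1 a (x - eps / 2) (y - - eps) + 0 * 0)
  (fun x y => 40 * A * eps * lg2 a (x - eps / 2) (y - - eps)
              + 40 * A * eps * (- 2 * k ^ 2 * Lam * y))
  (fun _ _ => - 80 * A * eps * k ^ 2 * Lam).
Proof.
assert (Hapos := sn_a_pos).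
assert (Heps := sn_eps _ _ _ _ _ _ _ N).
assert (H1 := lap_lg a (eps / 2) (- eps)).
assert (H2 : lap_on (fun _ y => 0 < y) (fun _ y => Q - k ^ 2 * Lam * y ^ 2)
   (fun _ _ => 0) (fun _ y => - 2 * k ^ 2 * Lam * y) (fun _ _ => - 2 * k ^ 2 * Lam)).
{ exists (fun _ _ => 0), (fun _ _ => - 2 * k ^ 2 * Lam); intros x y Hy.
  split; [apply @is_derive_const|split; [|split; [apply @is_derive_const|split; [|ring]]]];
    auto_derive; try exact I; ring. }
apply (lap_on_sub _ (fun _ y => 0 < y)) in H1.
- destruct (lap_on_lin _ (40 * A * eps) (40 * A * eps) _ _ _ _ _ _ _ _ H1 H2)
    as [p11 [p22 Hp]].
  exists p11, p22; intros x y Hy; destruct (Hp x y Hy) as [A1 [A2 [A3 [A4 A5]]]].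
  split; [|split; [|split; [|split]]].
  + replace (40 * A * eps * lg1 a (x - eps / 2) (y - - eps) + 0 * 0) with
      (40 * A * eps * lg1 a (x - eps / 2) (y - - eps) + 40 * A * eps * 0) by ring.
    apply is_derive_ext with (2 := A1); intros t; to_R_eq; unfold P, barP, bracket; fold a; ring.
  + apply is_derive_ext with (2 := A2); intros t; to_R_eq; unfold P, barP, bracket; fold a; ring.
  + apply is_derive_ext with (2 := A3); intros t; to_R_eq; ring.
  + exact A4.
  + rewrite A5; ring.
- intros x y Hy; apply cosh_gt_cos.
  assert (0 < a * (y - - eps)) by (apply Rmult_lt_0_compat; lra). lra.
Qed.

Lemma lap_barZ (O : R -> R -> Prop) : lap_on O Z
  (fun x y => 4 * k * A / eps * (x - eps / 2)) (fun x y => - 3 * A - A / 2 * y)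
  (fun _ _ => - A / 2 + 4 * k * A / eps).
Proof.
assert (Heps := sn_eps _ _ _ _ _ _ _ N).
exists (fun _ _ => 4 * k * A / eps), (fun _ _ => - A / 2); intros x y _.
unfold Z, barZ; split; [|split; [|split; [|split]]];
  try (auto_derive; [exact I|field; lra]); ring.
Qed.

(** A strictly negative slope, uniform in [x] and [y], to be set against the vanishing normal
    derivative on the faces. *)
Lemma barP_slope x y : 0 < y <= H ->
  40 * A * eps * lg2 a (x - eps / 2) (y - - eps) + 40 * A * eps * (- 2 * k ^ 2 * Lam * y)
  <= - (40 * A * eps * (a * sinh (a * eps) / (2 * (cosh (a * (H + eps)) + 1)))).
Proof.
intros Hy; assert (Hapos := sn_a_pos).
destruct N as [He Hd Ha HA Hk Hk32 HH HL Hbr].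
assert (HL0 : 0 <= Lam) by (destruct (Hbr 0 0); lra).
assert (H1 : 0 <= k ^ 2 * Lam * y).
{ apply Rmult_le_pos; [apply Rmult_le_pos; [apply pow2_ge_0|assumption]|lra]. }
assert (H2 : lg2 a (x - eps / 2) (y - - eps) <= - (a * sinh (a * eps) / (2 * (cosh (a * (H + eps)) + 1)))).
{ unfold lg2.
  assert (Hae : 0 < a * eps) by (apply Rmult_lt_0_compat; lra).
  assert (Hay : 0 < a * y) by (apply Rmult_lt_0_compat; lra).
  assert (E1 : a * (y - - eps) = a * y + a * eps) by ring.
  rewrite E1.
  assert (HD := cosh_gt_cos (a * y + a * eps) (a * (x - eps / 2)) ltac:(lra)).
  assert (Hcos := COS_bound (a * (x - eps / 2))).
  assert (Hcosh : cosh (a * y + a * eps) <= cosh (a * (H + eps))).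
  { apply cosh_increasing; split; [lra|]. nra. }
  assert (Hsinh : sinh (a * eps) <= sinh (a * y + a * eps)).
  { assert (Hm := derive_lower_bound sinh cosh (a * eps) (a * y + a * eps) 0 ltac:(lra)).
    rewrite Rmult_0_l, Rplus_0_r in Hm; apply Hm; intros t Ht.
    - apply is_derive_Reals, derivable_pt_lim_sinh.
    - assert (Hc := cosh_ge_1 t); lra. }
  assert (Hs0 := sinh_pos (a * eps) Hae).
  replace (- (a * sinh (a * y + a * eps)) / (2 * (cosh (a * y + a * eps) - cos (a * (x - eps / 2)))))
    with (- (a * sinh (a * y + a * eps) / (2 * (cosh (a * y + a * eps) - cos (a * (x - eps / 2))))))
    by (field; lra).
  apply Ropp_le_contravar.
  apply Rmult_le_compat.
  - apply Rmult_le_pos; lra.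
  - left; apply Rinv_0_lt_compat; lra.
  - apply Rmult_le_compat_l; lra.
  - apply Rinv_le_contravar; lra. }
assert (0 < A * eps) by (apply Rmult_lt_0_compat; lra).
nra.
Qed.

Lemma lg_period (x y : R) : lg a (x + d) y = lg a x y.
Proof.
assert (Hd := sn_d _ _ _ _ _ _ _ N).
unfold lg; replace (a * (x + d)) with (a * x + 2 * PI) by (unfold a; field; lra).
now rewrite cos_plus, cos_2PI, sin_2PI, Rmult_1_r, Rmult_0_r, Rminus_0_r.
Qed.

Lemma barP_period x y : P (x + d) y = P x y.
Proof.
unfold P, barP, bracket; fold a.
replace (x + d - eps / 2) with (x - eps / 2 + d) by ring.
now rewrite lg_period.
Qed.

(** Blows up at the two corners of the slit, which excludes them as maximum points. *)
Definition cornerG (eps d H x y : R) : R :=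
  lg (2 * PI / d) (x - 0) (y - 0) + lg (2 * PI / d) (x - eps) (y - 0)
  + ln (cosh (2 * PI / d * (H + 1)) + 1).
Let G := cornerG eps d H.

Lemma cornerG_period x y : G (x + d) y = G x y.
Proof.
unfold G, cornerG; fold a.
replace (x + d - 0) with (x - 0 + d) by ring.
replace (x + d - eps) with (x - eps + d) by ring.
now rewrite !lg_period.
Qed.

Lemma dom_log_pos x y x0 : (x0 = 0 \/ x0 = eps) -> dom eps x y ->
  0 < cosh (a * (y - 0)) - cos (a * (x - x0)).
Proof.
intros Hx0 Hd; assert (Hapos := sn_a_pos).
destruct (Req_dec y 0) as [->|Hy].
- destruct Hd as [Hd|[Hx _]]; [lra|].
  replace (a * (0 - 0)) with 0 by ring; rewrite cosh_0.
  rewrite one_minus_cos.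
  destruct N as [He Hd' Ha _ _ _ _ _ _]; fold a in Ha; assert (HPI := PI2_3_2).
  assert (Hae : a * eps <= 1 / 10) by lra.
  assert (Hs : sin (a * (x - x0) / 2) <> 0).
  { destruct Hx0 as [-> | ->].
    - apply Rgt_not_eq, sin_gt_0; nra.
    - apply Rlt_not_eq.
      rewrite <- (Ropp_involutive (sin _)), <- sin_neg.
      apply Ropp_lt_gt_0_contravar, sin_gt_0; nra. }
  assert (0 < sin (a * (x - x0) / 2) ^ 2) by (apply pow2_gt_0; assumption). lra.
- apply cosh_gt_cos. intros H0; apply Rmult_integral in H0; lra.
Qed.

(** The constant added in [cornerG] is minus twice this lower bound, which makes [cornerG]
    nonnegative. *)
Lemma lg_lower x y : 
  -1 < y <= H -> 0 < cosh (a * y) - cos (a * x) ->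
  - ln (cosh (a * (H + 1)) + 1) / 2 <= lg a x y.
Proof.
intros Hy HD; assert (Hapos := sn_a_pos). unfold lg.
assert (HH := sn_H _ _ _ _ _ _ _ N). assert (He := sn_eps _ _ _ _ _ _ _ N).
assert (ln (cosh (a * y) - cos (a * x)) <= ln (cosh (a * (H + 1)) + 1)); [|lra].
apply ln_monotone; split; [assumption|].
assert (Hc := COS_bound (a * x)).
assert (cosh (a * y) <= cosh (a * (H + 1))); [|lra].
apply cosh_abs, Rabs_le; nra.
Qed.

Lemma dom_low x y : dom eps x y -> -1 < y.
Proof. intros [Hy|[_ Hy]]; lra. Qed.

Lemma cornerG_ge_0 x y : dom eps x y -> y <= H -> 0 <= G x y.
Proof.
intros Hd Hy; assert (Hl := dom_low x y Hd).
assert (H1 := lg_lower (x - 0) (y - 0) ltac:(lra) (dom_log_pos x y 0 (or_introl eq_refl) Hd)).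
assert (H2 := lg_lower (x - eps) (y - 0) ltac:(lra) (dom_log_pos x y eps (or_intror eq_refl) Hd)).
unfold G, cornerG; fold a; lra.
Qed.

Lemma lap_cornerG : lap_on (dom eps) G
  (fun x y => lg1 a (x - 0) (y - 0) + lg1 a (x - eps) (y - 0))
  (fun x y => lg2 a (x - 0) (y - 0) + lg2 a (x - eps) (y - 0)) (fun _ _ => 0).
Proof.
assert (H1 := lap_lg a 0 0); assert (H2 := lap_lg a eps 0).
apply (lap_on_sub _ (dom eps)) in H1; [|intros; apply dom_log_pos; auto].
apply (lap_on_sub _ (dom eps)) in H2; [|intros; apply dom_log_pos; auto].
destruct (lap_on_lin _ 1 1 _ _ _ _ _ _ _ _ H1 H2) as [p11 [p22 Hp]].
assert (Hsum : forall f g x l (C : R), is_derive (fun t => 1 * f t + 1 * g t) x l ->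
  is_derive (fun t => f t + g t + C) x l).
{ intros f g x l C Hf.
  replace l with (plus l 0) by (unfold plus; simpl; ring).
  apply (@is_derive_plus R_AbsRing R_NormedModule (fun t => f t + g t) (fun _ => C));
    [|apply @is_derive_const].
  apply is_derive_ext with (2 := Hf); intros t; to_R_eq; ring. }
exists p11, p22; intros x y Hy; destruct (Hp x y Hy) as [A1 [A2 [A3 [A4 A5]]]].
split; [|split; [|split; [|split]]].
- replace (lg1 a (x - 0) (y - 0) + lg1 a (x - eps) (y - 0)) with
   (1 * lg1 a (x - 0) (y - 0) + 1 * lg1 a (x - eps) (y - 0)) by ring.
  apply Hsum with (1 := A1).
- replace (lg2 a (x - 0) (y - 0) + lg2 a (x - eps) (y - 0)) with
   (1 * lg2 a (x - 0) (y - 0) + 1 * lg2 a (x - eps) (y - 0)) by ring.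
  apply Hsum with (1 := A2).
- apply is_derive_ext with (2 := A3); intros t; to_R_eq; ring.
- apply is_derive_ext with (2 := A4); intros t; to_R_eq; ring.
- lra.
Qed.

Lemma continuity_cornerG x y : dom eps x y -> continuity_2d_pt G x y.
Proof.
intros Hd; unfold G, cornerG; fold a.
apply continuity_2d_pt_plus; [apply continuity_2d_pt_plus|apply continuity_2d_pt_const];
  apply continuity_lg, dom_log_pos; auto.
Qed.

Lemma lg_corner (x0 Mt : R) :
  near2 (fun x y => 0 < cosh (a * (y - 0)) - cos (a * (x - x0)) -> Mt <= lg a (x - x0) (y - 0)) x0 0.
Proof.
assert (Hc : continuity_2d_pt (fun x y => cosh (a * (y - 0)) - cos (a * (x - x0))) x0 0).
{ apply continuity_2d_pt_minus.
  + apply (continuity_1d_2d_pt_comp (fun y => cosh (a * (y - 0))) (fun _ y => y));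
      [|apply continuity_2d_pt_id2].
    apply derivable_continuous_pt; eexists; apply is_derive_Reals; auto_derive;
      [exact I|reflexivity].
  + apply (continuity_1d_2d_pt_comp (fun x => cos (a * (x - x0))) (fun x _ => x));
      [|apply continuity_2d_pt_id1].
    apply derivable_continuous_pt; eexists; apply is_derive_Reals; auto_derive;
      [exact I|reflexivity]. }
apply near2_impl with (2 := cont2_near _ _ _ (exp (- 2 * Mt)) Hc (exp_pos _)).
intros x y Hxy HD.
rewrite !Rminus_diag, Rmult_0_r, cosh_0, cos_0, Rminus_diag, Rminus_0_r in Hxy.
apply Rabs_def2 in Hxy.
assert (Hl := ln_monotone (cosh (a * (y - 0)) - cos (a * (x - x0))) (exp (- 2 * Mt)) ltac:(lra)).
rewrite ln_exp in Hl; unfold lg; lra.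
Qed.

Lemma cornerG_corner (x0 Mt : R) : x0 = 0 \/ x0 = eps ->
  near2 (fun x y => dom eps x y -> y <= H -> Mt <= G x y) x0 0.
Proof.
intros Hx0.
apply near2_impl with (2 := lg_corner x0 (Rabs Mt)).
intros x y Hxy Hd Hy; assert (Hl := dom_low x y Hd).
assert (HM := Rle_abs Mt).
assert (Hln : 0 <= ln (cosh (a * (H + 1)) + 1)).
{ rewrite <- ln_1; apply ln_monotone; assert (Hc := cosh_ge_1 (a * (H + 1))); lra. }
specialize (Hxy (dom_log_pos x y x0 Hx0 Hd)).
unfold G, cornerG; fold a.
destruct Hx0 as [-> | ->].
- assert (H2 := lg_lower (x - eps) (y - 0) ltac:(lra) (dom_log_pos x y eps (or_intror eq_refl) Hd)).
  lra.
- assert (H1 := lg_lower (x - 0) (y - 0) ltac:(lra) (dom_log_pos x y 0 (or_introl eq_refl) Hd)).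
  lra.
Qed.

Lemma lg1_far x y : y < 0 -> eps / 2 <= x <= eps -> 0 <= - lg1 a x y <= 5 / eps.
Proof.
intros Hy Hx; assert (Hapos := sn_a_pos); unfold lg1.
destruct N as [He Hd Ha _ _ _ _ _ _]; fold a in Ha; assert (HPI := PI2_3_2).
set (t := a * x).
assert (Ht : a * eps / 2 <= t <= 1 / 10) by (unfold t; nra).
assert (Ht0 : 0 < a * eps) by (apply Rmult_lt_0_compat; lra).
assert (Hc := cos_le_quad t ltac:(lra)).
assert (Hch := cosh_ge_1 (a * y)).
assert (Hs := sin_le_id t ltac:(lra)).
assert (Hs0 : 0 <= sin t) by (apply sin_ge_0; lra).
assert (Ht2 : 0 < t ^ 2) by (apply pow_lt; lra).
replace (- (- (a * sin t) / (2 * (cosh (a * y) - cos t))))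
  with (a * sin t / (2 * (cosh (a * y) - cos t))) by (field; lra).
split.
- apply Rdiv_le_0_compat; [apply Rmult_le_pos; lra|lra].
- apply Rle_trans with (a * t / (2 * (49 / 100 * t ^ 2))).
  + apply Rmult_le_compat; [apply Rmult_le_pos; lra|left; apply Rinv_0_lt_compat; lra|
      apply Rmult_le_compat_l; lra|apply Rinv_le_contravar; lra].
  + replace (a * t / (2 * (49 / 100 * t ^ 2))) with (100 / 98 * (a / t)) by (field; lra).
    assert (a / t <= 2 / eps); [|apply Rle_trans with (100 / 98 * (2 / eps));
      [lra|apply Rle_trans with (100 / 98 * 2 * / eps); [right; field; lra|
       apply Rmult_le_compat_r; [left; apply Rinv_0_lt_compat; lra|lra]]]].
    apply Rmult_le_reg_r with t; [lra|].
    unfold Rdiv; rewrite Rmult_assoc, Rinv_l, Rmult_1_r by lra.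
    apply Rmult_le_reg_r with eps; [lra|].
    replace (2 * / eps * t * eps) with (2 * t) by (field; lra). lra.
Qed.

Lemma lg1_near x y : y < 0 -> 0 <= x <= eps -> lg1 a x y <= 0.
Proof.
intros Hy Hx; assert (Hapos := sn_a_pos); unfold lg1.
destruct N as [He Hd Ha _ _ _ _ _ _]; fold a in Ha; assert (HPI := PI2_3_2).
assert (Ht : 0 <= a * x <= 1 / 10) by nra.
assert (Hs0 : 0 <= sin (a * x)) by (apply sin_ge_0; lra).
assert (HD := cosh_gt_cos (a * y) (a * x) ltac:(nra)).
replace (- (a * sin (a * x)) / (2 * (cosh (a * y) - cos (a * x))))
  with (- (a * sin (a * x) / (2 * (cosh (a * y) - cos (a * x))))) by (field; lra).
assert (0 <= a * sin (a * x) / (2 * (cosh (a * y) - cos (a * x)))); [|lra].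
apply Rdiv_le_0_compat; [apply Rmult_le_pos; lra|lra].
Qed.

Lemma lg1_odd x y : lg1 a (- x) y = - lg1 a x y.
Proof.
unfold lg1; replace (a * - x) with (- (a * x)) by ring.
rewrite cos_neg, sin_neg; unfold Rdiv; ring.
Qed.

(** The pole on the near wall only helps, since its logarithm decreases inwards; the other pole is
    at distance at least [eps / 2] and costs at most [5 / eps]. *)
Lemma cornerG_wall_left x y : y < 0 -> 0 < x <= eps / 2 ->
  lg1 a (x - 0) (y - 0) + lg1 a (x - eps) (y - 0) <= 5 / eps.
Proof.
intros Hy Hx.
assert (H1 := lg1_near (x - 0) (y - 0) ltac:(lra) ltac:(lra)).
replace (x - eps) with (- (eps - x)) by ring; rewrite lg1_odd.
assert (H2 := lg1_far (eps - x) (y - 0) ltac:(lra) ltac:(lra)). lra.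
Qed.

Lemma cornerG_wall_right x y : y < 0 -> eps / 2 <= x < eps ->
  - (5 / eps) <= lg1 a (x - 0) (y - 0) + lg1 a (x - eps) (y - 0).
Proof.
intros Hy Hx.
assert (H1 := lg1_near (eps - x) (y - 0) ltac:(lra) ltac:(lra)).
replace (x - eps) with (- (eps - x)) by ring; rewrite lg1_odd.
assert (H2 := lg1_far (x - 0) (y - 0) ltac:(lra) ltac:(lra)). lra.
Qed.

Lemma lg2_neg x y : 0 < y -> lg2 a x y <= 0.
Proof.
intros Hy; assert (Hapos := sn_a_pos); unfold lg2.
assert (Hay : 0 < a * y) by (apply Rmult_lt_0_compat; lra).
assert (HD := cosh_gt_cos (a * y) (a * x) ltac:(lra)).
assert (Hs := sinh_pos _ Hay).
replace (- (a * sinh (a * y)) / (2 * (cosh (a * y) - cos (a * x))))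
  with (- (a * sinh (a * y) / (2 * (cosh (a * y) - cos (a * x))))) by (field; lra).
assert (0 <= a * sinh (a * y) / (2 * (cosh (a * y) - cos (a * x)))); [|lra].
apply Rdiv_le_0_compat; [apply Rmult_le_pos; lra|lra].
Qed.

Lemma continuity_barP x y : 0 <= y -> continuity_2d_pt P x y.
Proof.
intros Hy; assert (Hapos := sn_a_pos). assert (He := sn_eps _ _ _ _ _ _ _ N).
unfold P, barP, bracket; fold a.
apply continuity_2d_pt_mult; [apply continuity_2d_pt_const|].
apply continuity_2d_pt_plus.
- apply continuity_lg, cosh_gt_cos.
  assert (0 < a * (y - - eps)) by (apply Rmult_lt_0_compat; lra). lra.
- apply (continuity_1d_2d_pt_comp (fun y => Q - k ^ 2 * Lam * y ^ 2) (fun _ y => y));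
    [|apply continuity_2d_pt_id2].
  apply derivable_continuous_pt; reg.
Qed.

Lemma continuity_barZ x y : continuity_2d_pt Z x y.
Proof.
unfold Z, barZ; fold P.
apply continuity_2d_pt_plus.
- apply (continuity_1d_2d_pt_comp (fun y => P 0 0 - 3 * A * y - A / 4 * y ^ 2) (fun _ y => y));
    [|apply continuity_2d_pt_id2].
  apply derivable_continuous_pt; reg.
- apply (continuity_1d_2d_pt_comp (fun x => 2 * k * A / eps * ((x - eps / 2) ^ 2 - eps ^ 2 / 4))
    (fun x _ => x)); [|apply continuity_2d_pt_id1].
  apply derivable_continuous_pt; reg.
Qed.
End Numbers.

(** * Comparison of a radiated field with the barrier *)

(** The field after subtraction of standing waves. These violate the wall condition, hence the
    derivative [k * A] tolerated in [hf_wall]; quasi-periodicity leaves only the modulus periodic,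
    which is enough for a comparison of moduli. *)
Record half_field (eps d k H A : R) (W W1 W2 : R -> R -> C) : Prop := {
  hf_lap : forall c s, lap_on (dom eps) (fun x y => pr c s (W x y))
    (fun x y => pr c s (W1 x y)) (fun x y => pr c s (W2 x y))
    (fun x y => - k ^ 2 * pr c s (W x y));
  hf_cont : forall c s x y, dom eps x y -> continuity_2d_pt (fun x y => pr c s (W x y)) x y;
  hf_per : forall x y, 0 < y -> Cmod (W (x + d) y) = Cmod (W x y);
  hf_wall : forall x y e, x = 0 \/ x = eps -> -1 < y < 0 -> 0 < e ->
    near2 (fun x' y' => rect eps (-1) 0 x' y' -> Cmod (W1 x' y') <= k * A + e) x y;
  hf_face : forall x e, - (d / 2) <= x <= d / 2 -> ~ 0 <= x <= eps -> 0 < e ->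
    near2 (fun x' y' => 0 < y' -> Cmod (W2 x' y') <= e) x 0;
  hf_bdd : exists B, forall x y, dom eps x y -> - (d / 2) <= x <= d / 2 -> y <= H ->
    Cmod (W x y) <= B;
  hf_slit : forall x y, rect eps (-1) 0 x y -> Cmod (W x y) <= A;
  hf_top : forall x, - (d / 2) <= x <= d / 2 -> Cmod (W x H) <= 10 * A * eps }.

(** [true] stands for the branch [Z], [false] for [P]. Taking the supremum over pairs of a branch
    and a point amounts to comparing with [min (P, Z)] where both are available, and spares the
    nonsmooth minimum. *)
Definition zone (eps d H : R) (b : bool) (x y : R) : Prop :=
  - (d / 2) <= x <= d / 2 /\ y <= H /\ if b then zoneZ eps x y else 0 < y.

Definition bar (eps d k A Q Lam : R) (b : bool) : R -> R -> R :=
  if b then barZ eps d k A Q Lam else barP eps d k A Q Lam.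

Lemma lap_on_barrier (O : R -> R -> Prop) (M eta : R) v v1 v2 L B B1 B2 LB G G1 G2 LG :
  lap_on O v v1 v2 L -> lap_on O B B1 B2 LB -> lap_on O G G1 G2 LG ->
  lap_on O (fun x y => 1 * v x y + -1 * (M * B x y + eta * G x y))
    (fun x y => 1 * v1 x y + -1 * (M * B1 x y + eta * G1 x y))
    (fun x y => 1 * v2 x y + -1 * (M * B2 x y + eta * G2 x y))
    (fun x y => 1 * L x y + -1 * (M * LB x y + eta * LG x y)).
Proof.
intros Hv HB HG.
exact (lap_on_lin O 1 (-1) _ _ _ _ _ _ _ _ Hv (lap_on_lin O M eta _ _ _ _ _ _ _ _ HB HG)).
Qed.

Section Barrier.
Context {eps d k H A Q Lam : R} (N : slot_numbers eps d k H A Q Lam).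
Context {W W1 W2 : R -> R -> C} (F : half_field eps d k H A W W1 W2).
Let a := 2 * PI / d.
Let P := barP eps d k A Q Lam.
Let Z := barZ eps d k A Q Lam.
Let B := bar eps d k A Q Lam.
Let G := cornerG eps d H.

Lemma zone_dom b x y : zone eps d H b x y -> dom eps x y.
Proof. intros [_ [_ Hb]]; destruct b; [destruct Hb as [Hb|[_ Hb]]; [right|left]|left]; tauto. Qed.

Lemma bar_pos b x y : zone eps d H b x y -> 0 < B b x y.
Proof.
intros [Hx [Hy Hb]]; destruct b; simpl.
- assert (H1 := barZ_bounds N x y Hb).
  assert (0 < A * eps) by (destruct N; apply Rmult_lt_0_compat; lra). unfold B, bar; lra.
- assert (H1 := barP_bounds N x y ltac:(lra)).
  assert (0 < A * eps) by (destruct N; apply Rmult_lt_0_compat; lra). unfold B, bar; lra.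
Qed.

Lemma dom_open x y : dom eps x y -> near2 (dom eps) x y.
Proof.
intros [Hy|[Hx Hy]].
- exists y; split; [assumption|]; intros x' y' _ Hy'; left; apply Rabs_def2 in Hy'; lra.
- set (r := Rmin (Rmin x (eps - x)) (y + 1)).
  assert (Hr : 0 < r /\ r <= x /\ r <= eps - x /\ r <= y + 1).
  { assert (A1 := Rmin_l (Rmin x (eps - x)) (y + 1)).
    assert (A2 := Rmin_r (Rmin x (eps - x)) (y + 1)).
    assert (A3 := Rmin_l x (eps - x)). assert (A4 := Rmin_r x (eps - x)).
    assert (0 < r) by (repeat apply Rmin_pos; lra). unfold r in *; lra. }
  exists r; split; [apply Hr|]; intros x' y' Hx' Hy'.
  apply Rabs_def2 in Hx'; apply Rabs_def2 in Hy'.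
  destruct (Rlt_le_dec 0 y'); [now left|right; lra].
Qed.

(** If the maximum [m > 0] of [|W| - M B - eta G] were attained at an interior point, its
    Laplacian there would be positive. *)
Lemma no_interior_max (M eta : R) (b : bool) x y B1 B2 LB :
  1 <= M -> 0 <= eta -> dom eps x y -> y <= H ->
  lap_on (fun x' y' => if b then True else 0 < y') (B b) B1 B2 LB ->
  (if b then True else 0 < y) ->
  0 < Cmod (W x y) - M * B b x y - eta * G x y ->
  Cmod (W x y) <= 2 * M * B b x y ->
  LB x y + 2 * k ^ 2 * B b x y < 0 ->
  near2 (fun x' y' => Cmod (W x' y') - M * B b x' y' - eta * G x' y'
                      <= Cmod (W x y) - M * B b x y - eta * G x y) x y -> False.
Proof.
intros HM Heta Hd HyH HLB Hb Hpos H2 Hsup Hmax.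
(* The direction is frozen at the maximum: [pr c s] of the field lies below the modulus and touches
   it at [(x, y)]. *)
destruct (pr_attains (W x y)) as [c [s [Hcs Hatt]]].
set (O := fun x y => dom eps x y /\ if b then True else 0 < y).
assert (HLv : lap_on O (fun x y => pr c s (W x y)) _ _ _)
  by (apply lap_on_sub with (2 := hf_lap _ _ _ _ _ _ _ _ F c s); unfold O; tauto).
assert (HLB' : lap_on O (B b) B1 B2 LB)
  by (apply lap_on_sub with (2 := HLB); unfold O; tauto).
assert (HLG : lap_on O G _ _ _)
  by (apply lap_on_sub with (2 := lap_cornerG N); unfold O; tauto).
assert (Hl := lap_max O _ _ _ _ x y (lap_on_barrier O M eta _ _ _ _ _ _ _ _ _ _ _ _ HLv HLB' HLG)).
cbv beta in Hl.
assert (HO : near2 O x y).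
{ apply near2_and; [now apply dom_open|].
  destruct b; [exists 1; split; [lra|trivial]|].
  exists y; split; [assumption|]; intros x' y' _ Hy'; apply Rabs_def2 in Hy'; lra. }
assert (Hn : near2 (fun x' y' => 1 * pr c s (W x' y') + -1 * (M * B b x' y' + eta * G x' y')
   <= 1 * pr c s (W x y) + -1 * (M * B b x y + eta * G x y)) x y).
{ apply near2_impl with (2 := Hmax); intros x' y' Hxy.
  assert (H3 := pr_le_Cmod c s (W x' y') Hcs). rewrite Hatt. lra. }
specialize (Hl HO Hn). rewrite Hatt in Hl.
assert (Hk := pow2_ge_0 k).
(* The bound by [2 M B] turns the Helmholtz term into [2 k^2 M B], which the Laplacian of the
   barrier outweighs. *)
assert (k ^ 2 * Cmod (W x y) <= k ^ 2 * (2 * M * B b x y)) by (apply Rmult_le_compat_l; assumption).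
assert (0 < M * (- (LB x y + 2 * k ^ 2 * B b x y))) by (apply Rmult_lt_0_compat; lra).
nra.
Qed.

Lemma lap_barZ_neg x y : zoneZ eps x y ->
  (- A / 2 + 4 * k * A / eps) + 2 * k ^ 2 * Z x y < 0.
Proof.
intros Hz; assert (H1 := barZ_bounds N x y Hz); assert (H2 := barZ_slit_coef N).
destruct N as [He Hd Ha HA Hk Hk32 HH HL Hbr].
replace (4 * k * A / eps) with (2 * (2 * k * A / eps)) by (field; lra).
assert (k ^ 2 <= 1 / 100) by nra.
assert (0 < A * eps) by (apply Rmult_lt_0_compat; lra).
assert (k ^ 2 * Z x y <= 1 / 100 * (4 * A)).
{ apply Rmult_le_compat; [apply pow2_ge_0|unfold Z in *; lra|assumption|unfold Z in *; lra]. }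
lra.
Qed.

Lemma lap_barP_neg x y : 0 <= y <= H ->
  - 80 * A * eps * k ^ 2 * Lam + 2 * k ^ 2 * P x y < 0.
Proof.
intros Hy; destruct N as [He Hd Ha HA Hk Hk32 HH HL Hbr].
destruct (Hbr x y Hy) as [_ H1]; unfold P, barP.
assert (0 < A * eps * k ^ 2).
{ apply Rmult_lt_0_compat; [apply Rmult_lt_0_compat; lra|apply pow_lt; lra]. }
nra.
Qed.

(** One step of the bootstrap: the bound with [2 * M] controls [k^2 |W|], and the comparison returns
    the bound with [M]. A positive supremum of [|W| - M B - eta G] is excluded at each kind of
    boundary point and then inside. *)
Lemma bar_step (M : R) : 1 <= M ->
  (forall b x y, zone eps d H b x y -> Cmod (W x y) <= 2 * M * B b x y) ->
  forall b x y, zone eps d H b x y -> Cmod (W x y) <= M * B b x y.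
Proof.
intros HM H2 b0 x0 y0 Hz0.
apply Rnot_lt_le; intros Hlt.
assert (He := sn_eps _ _ _ _ _ _ _ N). assert (HA := sn_A _ _ _ _ _ _ _ N).
assert (Hk := sn_k _ _ _ _ _ _ _ N). assert (Hd60 := sn_eps_d N).
assert (HkA : 0 < k * A) by (apply Rmult_lt_0_compat; assumption).
assert (HH := sn_H _ _ _ _ _ _ _ N). assert (Hdpos := sn_d _ _ _ _ _ _ _ N).
assert (Hapos : 0 < a) by apply (sn_a_pos N).
assert (HG0 : forall b x y, zone eps d H b x y -> 0 <= G x y).
{ intros b x y Hz; apply (cornerG_ge_0 N); [now apply zone_dom with b|apply Hz]. }
(* [eta G] stays below the violation at the starting point, and its adverse slope at the walls, at
   most [5 eta / eps], is at most [k A / 4]. *)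
assert (Heta : exists eta, 0 < eta /\ eta * G x0 y0 < Cmod (W x0 y0) - M * B b0 x0 y0
   /\ eta * (5 / eps) <= k * A / 4).
{ assert (HG := HG0 _ _ _ Hz0).
  set (gap := Cmod (W x0 y0) - M * B b0 x0 y0). assert (Hgap : 0 < gap) by (unfold gap; lra).
  exists (Rmin (gap / (2 * (G x0 y0 + 1))) (k * A * eps / 20)).
  assert (A1 := Rmin_l (gap / (2 * (G x0 y0 + 1))) (k * A * eps / 20)).
  assert (A2 := Rmin_r (gap / (2 * (G x0 y0 + 1))) (k * A * eps / 20)).
  split; [|split].
  - apply Rmin_pos; [apply Rdiv_lt_0_compat; lra|].
    apply Rdiv_lt_0_compat; [apply Rmult_lt_0_compat; lra|lra].
  - apply Rle_lt_trans with (gap / (2 * (G x0 y0 + 1)) * (G x0 y0 + 1)).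
    + apply Rmult_le_compat; try lra. left; apply Rmin_pos; [apply Rdiv_lt_0_compat; lra|].
      apply Rdiv_lt_0_compat; [apply Rmult_lt_0_compat; lra|lra].
    + replace (gap / (2 * (G x0 y0 + 1)) * (G x0 y0 + 1)) with (gap / 2) by (field; lra). lra.
  - apply Rle_trans with (k * A * eps / 20 * (5 / eps)).
    + apply Rmult_le_compat_r; [apply Rdiv_le_0_compat; lra|assumption].
    + right; field; lra. }
destruct Heta as [eta [Heta [Heta1 Heta2]]].
set (f := fun b x y => Cmod (W x y) - M * B b x y - eta * G x y).
destruct (hf_bdd _ _ _ _ _ _ _ _ F) as [NB HNB].
destruct (sup_cluster (bool * R * R) (fun p => zone eps d H (fst (fst p)) (snd (fst p)) (snd p))
  (fun p => f (fst (fst p)) (snd (fst p)) (snd p))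
  (fun p => snd (fst p)) snd (fun _ => 0) (d + H + 1) NB (b0, x0, y0))
  as [m [x [y [z [Hm Hcl]]]]].
{ intros [[b x] y] Hz; simpl in *; rewrite Rabs_R0.
  assert (Hl := dom_low x y (zone_dom _ _ _ Hz)). destruct Hz as [Hx [Hy _]].
  split; [apply Rabs_le; lra|split; [apply Rabs_le; lra|lra]]. }
{ intros [[b x] y] Hz; simpl in *; unfold f.
  assert (Hb := bar_pos _ _ _ Hz). assert (Hg := HG0 _ _ _ Hz).
  assert (HN := HNB x y (zone_dom _ _ _ Hz) ltac:(apply Hz) ltac:(apply Hz)).
  assert (0 <= M * B b x y) by (apply Rmult_le_pos; lra).
  assert (0 <= eta * G x y) by (apply Rmult_le_pos; lra). lra. }
{ exact Hz0. }
assert (Hm0 : 0 < m).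
{ apply Rlt_le_trans with (f b0 x0 y0); [unfold f; lra|]. apply (Hm (b0, x0, y0)), Hz0. }
assert (Hcl' : forall e, 0 < e -> exists b u w, zone eps d H b u w /\ Rabs (u - x) < e
   /\ Rabs (w - y) < e /\ m - e < f b u w).
{ intros e He'; destruct (Hcl e He') as [[[b u] w] [C1 [C2 [C3 [_ C4]]]]].
  exists b, u, w; split; [|split; [|split]]; assumption. }
assert (Hm' : forall b u w, zone eps d H b u w -> f b u w <= m)
  by (intros b u w; apply (Hm (b, u, w))).
clear Hcl Hm Hz0 Hlt Heta1.
assert (Hx : - (d / 2) <= x <= d / 2).
{ apply cluster_between; intros e He'; destruct (Hcl' e He') as [b [u [w [Hz C]]]].
  exists u; split; [apply Hz|apply C]. }
assert (Hy : -1 <= y <= H).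
{ apply cluster_between; intros e He'; destruct (Hcl' e He') as [b [u [w [Hz C]]]].
  exists w; split; [|apply C].
  assert (Hl := dom_low u w (zone_dom _ _ _ Hz)). destruct Hz as [_ [Hz _]]; lra. }
assert (Hfpos : forall b u w, zone eps d H b u w -> f b u w <= Cmod (W u w) - eta * G u w
   /\ f b u w <= Cmod (W u w)).
{ intros b u w Hz; unfold f. assert (Hb := bar_pos _ _ _ Hz). assert (Hg := HG0 _ _ _ Hz).
  assert (0 <= M * B b u w) by (apply Rmult_le_pos; lra).
  assert (0 <= eta * G u w) by (apply Rmult_le_pos; lra). lra. }
(* Here [B = Z >= A >= |W|]. *)
destruct (Rle_lt_dec y (- 3 / 4)) as [Hylow|Hylow].
{ destruct (Hcl' (Rmin m (1 / 8))) as [b [u [w [Hz [C1 [C2 C3]]]]]]; [apply Rmin_pos; lra|].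
  assert (A1 := Rmin_l m (1 / 8)); assert (A2 := Rmin_r m (1 / 8)).
  apply Rabs_def2 in C2.
  destruct b; [|destruct Hz as [_ [_ Hz]]; simpl in Hz; lra].
  assert (Hg := HG0 _ _ _ Hz).
  destruct Hz as [_ [_ [[Hz1 Hz2]|Hz]]]; [|lra].
  assert (HZ := barZ_low N u w Hz1 ltac:(lra)).
  assert (HW := hf_slit _ _ _ _ _ _ _ _ F u w ltac:(split; lra)).
  unfold f, B in C3; simpl in C3.
  assert (0 <= eta * G u w) by (apply Rmult_le_pos; lra).
  assert (1 * A <= M * barZ eps d k A Q Lam u w) by (apply Rmult_le_compat; lra).
  lra. }
(* Near a corner [eta G] exceeds [|W|]. *)
destruct (Classical_Prop.classic ((x = 0 \/ x = eps) /\ y = 0)) as [[Hxc ->]|Hcorner].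
{ destruct (cornerG_corner N x ((Rabs NB) / eta) Hxc) as [del [Hdel Hn]].
  destruct (Hcl' (Rmin m del)) as [b [u [w [Hz [C1 [C2 C3]]]]]]; [apply Rmin_pos; lra|].
  assert (A1 := Rmin_l m del); assert (A2 := Rmin_r m del).
  assert (Hdm := zone_dom _ _ _ Hz).
  assert (Hbig := Hn u w ltac:(lra) ltac:(lra) Hdm ltac:(apply Hz)).
  assert (HN := HNB u w Hdm ltac:(apply Hz) ltac:(apply Hz)).
  assert (Hf := Hfpos b u w Hz).
  assert (Rabs NB <= eta * G u w).
  { replace (Rabs NB) with (eta * (Rabs NB / eta)) by (field; lra).
    apply Rmult_le_compat_l; [lra|exact Hbig]. }
  assert (Hab := Rle_abs NB). lra. }
(* Moving up by [r] would gain [g0 / 2 * r], since [B] decreases there with slope at least [g0]. *)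
destruct (Classical_Prop.classic (y = 0 /\ ~ 0 <= x <= eps)) as [[-> Hface]|Hnface].
{ set (g0 := Rmin (3 * A) (40 * A * eps * (a * sinh (a * eps) / (2 * (cosh (a * (H + eps)) + 1))))).
  assert (Hg0 : 0 < g0).
  { apply Rmin_pos; [lra|].
    apply Rmult_lt_0_compat; [apply Rmult_lt_0_compat; lra|].
    assert (Hae : 0 < a * eps) by (apply Rmult_lt_0_compat; lra).
    assert (S1 := sinh_pos _ Hae). assert (S2 := cosh_ge_1 (a * (H + eps))).
    apply Rdiv_lt_0_compat; [apply Rmult_lt_0_compat|]; lra. }
  destruct (hf_face _ _ _ _ _ _ _ _ F x (g0 / 2) Hx Hface) as [d1 [Hd1 Hn]]; [lra|].
  assert (Hout : exists d2, 0 < d2 /\ forall u, Rabs (u - x) < d2 -> ~ 0 < u < eps).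
  { destruct (Rlt_le_dec x 0).
    - exists (- x); split; [lra|]; intros u Hu; apply Rabs_def2 in Hu; lra.
    - exists (x - eps); split; [lra|]; intros u Hu; apply Rabs_def2 in Hu; lra. }
  destruct Hout as [d2 [Hd2 Hout]].
  set (r := Rmin (Rmin d1 d2) eps / 4).
  assert (Hr : 0 < r /\ 4 * r <= d1 /\ 4 * r <= d2 /\ 4 * r <= eps).
  { assert (A1 := Rmin_l (Rmin d1 d2) eps); assert (A2 := Rmin_r (Rmin d1 d2) eps).
    assert (A3 := Rmin_l d1 d2); assert (A4 := Rmin_r d1 d2).
    assert (0 < Rmin (Rmin d1 d2) eps) by (repeat apply Rmin_pos; lra). unfold r; lra. }
  clearbody r; destruct Hr as [Hr0 [Hr1 [Hr2 Hr3]]].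
  assert (Hgain : 0 < g0 / 2 * r) by (apply Rmult_lt_0_compat; lra).
  destruct (Hcl' (Rmin r (g0 / 2 * r))) as [b [u [w [Hz [C1 [C2 C3]]]]]]; [apply Rmin_pos; lra|].
  assert (A1 := Rmin_l r (g0 / 2 * r)); assert (A2 := Rmin_r r (g0 / 2 * r)).
  assert (Hu := Hout u ltac:(lra)).
  rewrite Rminus_0_r in C2; apply Rabs_def2 in C2.
  assert (Hw : 0 < w) by (destruct (zone_dom _ _ _ Hz) as [Hw|[Hw _]]; [exact Hw|contradiction]).
  destruct (pr_attains (W u w)) as [c [s [Hcs Hatt]]].
  assert (HLv := hf_lap _ _ _ _ _ _ _ _ F c s).
  set (B2 := fun x y => if b then - 3 * A - A / 2 * y else
     40 * A * eps * lg2 a (x - eps / 2) (y - - eps) + 40 * A * eps * (- 2 * k ^ 2 * Lam * y)).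
  assert (HLB : exists B1 LB, lap_on (fun _ y => 0 < y) (B b) B1 B2 LB).
  { destruct b; unfold B, B2, bar; eexists; eexists;
      [apply (lap_barZ N)|apply (lap_barP N)]. }
  destruct HLB as [B1 [LB HLB]].
  assert (HLG : lap_on (fun _ y => 0 < y) G _ _ _)
    by (apply lap_on_sub with (2 := lap_cornerG N); intros; now left).
  apply (lap_on_sub _ (fun _ y => 0 < y)) in HLv; [|intros; now left].
  destruct (lap_on_barrier _ M eta _ _ _ _ _ _ _ _ _ _ _ _ HLv HLB HLG) as [p11 [p22 Hp]].
  set (E := fun t => 1 * pr c s (W u t) + -1 * (M * B b u t + eta * G u t)) in *.
  assert (Hpush : E w + g0 / 2 * (w + r - w) <= E (w + r)).
  { apply (derive_lower_bound E (fun t => 1 * pr c s (W2 u t) + -1 * (M * B2 u t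
      + eta * (lg2 (2 * PI / d) (u - 0) (t - 0) + lg2 (2 * PI / d) (u - eps) (t - 0))))); [lra| |].
    - intros t Ht; apply (Hp u t); lra.
    - intros t Ht.
      assert (D1 : Rabs (pr c s (W2 u t)) <= g0 / 2).
      { apply Rle_trans with (1 := Rabs_pr_le c s _ Hcs).
        apply Hn; [lra| |lra]. rewrite Rminus_0_r; apply Rabs_def1; lra. }
      apply Rabs_le_between in D1.
      assert (D2 : B2 u t <= - g0).
      { unfold B2; destruct b.
        - assert (g0 <= 3 * A) by apply Rmin_l.
          assert (0 <= A * t) by (apply Rmult_le_pos; lra). lra.
        - assert (D3 := barP_slope N u t ltac:(lra)). fold a in D3.
          assert (D4 : g0 <= 40 * A * eps * (a * sinh (a * eps) / (2 * (cosh (a * (H + eps)) + 1))))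
            by apply Rmin_r.
          lra. }
      assert (D3 := lg2_neg N (u - 0) (t - 0) ltac:(lra)).
      assert (D4 := lg2_neg N (u - eps) (t - 0) ltac:(lra)).
      set (l1 := lg2 (2 * PI / d) (u - 0) (t - 0)) in *.
      set (l2 := lg2 (2 * PI / d) (u - eps) (t - 0)) in *.
      assert (0 <= eta * (- (l1 + l2))) by (apply Rmult_le_pos; lra).
      assert (M * B2 u t <= 1 * - g0) by nra.
      lra. }
  assert (Hz' : zone eps d H b u (w + r)).
  { destruct Hz as [Z1 [Z2 Z3]]; split; [assumption|split; [lra|]].
    destruct b; [|lra]. destruct Z3 as [Z3|[Z3 Z4]]; [lra|right; split; [assumption|lra]]. }
  assert (H3 := Hm' _ _ _ Hz').
  assert (H4 := pr_le_Cmod c s (W u (w + r)) Hcs).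
  unfold f in *; unfold E in Hpush; rewrite Hatt in Hpush.
  replace (w + r - w) with r in Hpush by ring. lra. }
(* Moving away from the wall would gain: the term [(x - eps/2)^2] of [Z] has slope [2 k A]
   there, and the normal derivative of [W] is about [k A] at most. *)
destruct (Classical_Prop.classic (y < 0 /\ (x = 0 \/ x = eps))) as [[Hy0 Hxw]|Hnwall].
{ destruct (hf_wall _ _ _ _ _ _ _ _ F x y (k * A / 4) Hxw ltac:(lra) ltac:(lra)) as [d1 [Hd1 Hn]].
  set (r := Rmin (Rmin d1 (eps / 8)) (Rmin (y + 1) (- y)) / 4).
  assert (Hr : 0 < r /\ 4 * r <= d1 /\ 32 * r <= eps /\ 4 * r <= y + 1 /\ 4 * r <= - y).
  { assert (A1 := Rmin_l (Rmin d1 (eps / 8)) (Rmin (y + 1) (- y))).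
    assert (A2 := Rmin_r (Rmin d1 (eps / 8)) (Rmin (y + 1) (- y))).
    assert (A3 := Rmin_l d1 (eps / 8)); assert (A4 := Rmin_r d1 (eps / 8)).
    assert (A5 := Rmin_l (y + 1) (- y)); assert (A6 := Rmin_r (y + 1) (- y)).
    assert (0 < Rmin (Rmin d1 (eps / 8)) (Rmin (y + 1) (- y))) by (repeat apply Rmin_pos; lra).
    unfold r; lra. }
  clearbody r; destruct Hr as [Hr0 [Hr1 [Hr2 [Hr3 Hr4]]]].
  assert (Hgain : 0 < k * A / 4 * r) by (apply Rmult_lt_0_compat; lra).
  destruct (Hcl' (Rmin r (k * A / 4 * r))) as [b [u [w [Hz [C1 [C2 C3]]]]]]; [apply Rmin_pos; lra|].
  assert (A1 := Rmin_l r (k * A / 4 * r)); assert (A2 := Rmin_r r (k * A / 4 * r)).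
  apply Rabs_def2 in C1; apply Rabs_def2 in C2.
  destruct b; [|destruct Hz as [_ [_ Hz]]; simpl in Hz; lra].
  assert (Hz0 := Hz); destruct Hz as [_ [_ [[Hz1 Hz2]|Hz]]]; [|lra].
  destruct (pr_attains (W u w)) as [c [s [Hcs Hatt]]].
  destruct (lap_on_barrier _ M eta _ _ _ _ _ _ _ _ _ _ _ _
    (hf_lap _ _ _ _ _ _ _ _ F c s) (lap_barZ N _) (lap_cornerG N)) as [p11 [p22 Hp]].
  set (E := fun t => 1 * pr c s (W t w) + -1 * (M * barZ eps d k A Q Lam t w
       + eta * cornerG eps d H t w)) in *.
  set (E1 := fun t => 1 * pr c s (W1 t w) + -1 * (M * (4 * k * A / eps * (t - eps / 2))
      + eta * (lg1 (2 * PI / d) (t - 0) (w - 0) + lg1 (2 * PI / d) (t - eps) (w - 0)))).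
  assert (Hstrict : forall u', 0 < u' < eps -> Rabs (u' - u) = r -> f true u' w <= m).
  { intros u' Hu' _; apply Hm'; split; [lra|split; [lra|left; lra]]. }
  assert (HE : forall t, 0 < t < eps -> is_derive E t (E1 t)).
  { intros t Ht; apply (Hp t w); right; lra. }
  assert (HW1 : forall t, 0 < t < eps -> Rabs (t - x) < d1 ->
     - (5 / 4 * (k * A)) <= pr c s (W1 t w) <= 5 / 4 * (k * A)).
  { intros t Ht Htx; apply Rabs_le_between.
    apply Rle_trans with (1 := Rabs_pr_le c s _ Hcs).
    apply Rle_trans with (k * A + k * A / 4); [|lra].
    apply Hn; [assumption|apply Rabs_def1; lra|split; lra]. }
  assert (Hslope : forall t, 0 <= t <= eps / 16 -> 7 / 4 * (k * A) <= 4 * k * A / eps * (eps / 2 - t)).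
  { intros t Ht.
    apply Rle_trans with (4 * k * A / eps * (7 / 16 * eps)).
    - right; field; lra.
    - apply Rmult_le_compat_l; [|lra]. apply Rdiv_le_0_compat; [|lra]. lra. }
  destruct Hxw as [-> | ->].
  - assert (Hpush : E u + k * A / 4 * (u + r - u) <= E (u + r)).
    { apply (derive_lower_bound E E1); [lra| |].
      - intros t Ht; apply HE; lra.
      - intros t Ht; unfold E1.
        destruct (HW1 t ltac:(lra) ltac:(apply Rabs_def1; lra)) as [D1 _].
        assert (D2 := Hslope t ltac:(lra)).
        assert (D3 := cornerG_wall_left N t w ltac:(lra) ltac:(lra)).
        set (l1 := lg1 (2 * PI / d) (t - 0) (w - 0)) in *.
        set (l2 := lg1 (2 * PI / d) (t - eps) (w - 0)) in *.
        assert (eta * (l1 + l2) <= eta * (5 / eps)) by (apply Rmult_le_compat_l; lra).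
        assert (1 * (7 / 4 * (k * A)) <= M * (4 * k * A / eps * (eps / 2 - t)))
          by (apply Rmult_le_compat; lra).
        lra. }
    assert (H3 := Hstrict (u + r) ltac:(lra) ltac:(replace (u + r - u) with r by ring;
       apply Rabs_pos_eq; lra)).
    assert (H4 := pr_le_Cmod c s (W (u + r) w) Hcs).
    unfold f, B, bar, G in *; unfold E in Hpush; rewrite Hatt in Hpush.
    replace (u + r - u) with r in Hpush by ring. lra.
  - assert (Hpush : - E (u - r) + k * A / 4 * (u - (u - r)) <= - E u).
    { apply (derive_lower_bound (fun t => - E t) (fun t => - E1 t)); [lra| |].
      - intros t Ht; apply @is_derive_opp with (f := E); apply HE; lra.
      - intros t Ht; unfold E1.
        destruct (HW1 t ltac:(lra) ltac:(apply Rabs_def1; lra)) as [_ D1].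
        assert (D2 := Hslope (eps - t) ltac:(lra)).
        replace (eps / 2 - (eps - t)) with (t - eps / 2) in D2 by field.
        assert (D3 := cornerG_wall_right N t w ltac:(lra) ltac:(lra)).
        set (l1 := lg1 (2 * PI / d) (t - 0) (w - 0)) in *.
        set (l2 := lg1 (2 * PI / d) (t - eps) (w - 0)) in *.
        assert (eta * - (5 / eps) <= eta * (l1 + l2)) by (apply Rmult_le_compat_l; lra).
        assert (1 * (7 / 4 * (k * A)) <= M * (4 * k * A / eps * (t - eps / 2)))
          by (apply Rmult_le_compat; lra).
        lra. }
    assert (H3 := Hstrict (u - r) ltac:(lra) ltac:(replace (u - r - u) with (- r) by ring;
       rewrite Rabs_Ropp; apply Rabs_pos_eq; lra)).
    assert (H4 := pr_le_Cmod c s (W (u - r) w) Hcs).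
    unfold f, B, bar, G in *; unfold E in Hpush; rewrite Hatt in Hpush.
    replace (u - (u - r)) with r in Hpush by ring. lra. }
assert (Hdom : dom eps x y).
{ destruct (Rlt_le_dec 0 y) as [Hy0|Hy0]; [now left|right].
  assert (Hxx : 0 <= x <= eps).
  { destruct (Rle_lt_or_eq_dec _ _ Hy0) as [Hy1| ->].
    - apply cluster_between; intros e He'.
      destruct (Hcl' (Rmin e (- y))) as [b [u [w [Hz [C1 [C2 _]]]]]]; [apply Rmin_pos; lra|].
      assert (A1 := Rmin_l e (- y)); assert (A2 := Rmin_r e (- y)).
      apply Rabs_def2 in C2.
      exists u; split; [|lra].
      destruct (zone_dom _ _ _ Hz) as [Hw|[Hw _]]; lra.
    - apply Classical_Prop.NNPP; intros Hn; apply Hnface; split; [reflexivity|assumption]. }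
  split; [|lra].
  destruct (Rle_lt_or_eq_dec _ _ Hy0) as [Hy1| ->].
  - split; apply Rnot_le_lt; intros Hc; apply Hnwall; (split; [assumption|]); [left|right]; lra.
  - split; apply Rnot_le_lt; intros Hc; apply Hcorner; (split; [|reflexivity]); [left|right]; lra. }
assert (HcW : forall e, 0 < e -> near2 (fun x' y' => Cmod (W x' y') <= Cmod (W x y) + e) x y).
{ intros e He'.
  assert (C1 := cont2_near _ _ _ (e / 2) (hf_cont _ _ _ _ _ _ _ _ F 1 0 x y Hdom) ltac:(lra)).
  assert (C2 := cont2_near _ _ _ (e / 2) (hf_cont _ _ _ _ _ _ _ _ F 0 1 x y Hdom) ltac:(lra)).
  apply near2_impl with (2 := near2_and _ _ _ _ C1 C2).
  intros x' y' [E1 E2].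
  destruct (pr_attains (W x' y')) as [c [s [Hcs <-]]].
  apply Rle_trans with (pr c s (W x y) + e);
    [|assert (E3 := pr_le_Cmod c s (W x y) Hcs); lra].
  unfold pr in *.
  assert (Hc1 : Rabs c <= 1) by (apply Rabs_le; nra).
  assert (Hs1 : Rabs s <= 1) by (apply Rabs_le; nra).
  assert (E3 : c * (fst (W x' y') - fst (W x y)) <= e / 2).
  { apply Rle_trans with (1 := Rle_abs _); rewrite Rabs_mult.
    assert (0 <= Rabs c) by apply Rabs_pos.
    assert (Rabs (fst (W x' y') - fst (W x y)) <= e / 2).
    { left; replace (fst (W x' y') - fst (W x y)) with
       (1 * fst (W x' y') + 0 * snd (W x' y') - (1 * fst (W x y) + 0 * snd (W x y))) by ring.
      exact E1. }
    assert (0 <= Rabs (fst (W x' y') - fst (W x y))) by apply Rabs_pos. nra. }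
  assert (E4 : s * (snd (W x' y') - snd (W x y)) <= e / 2).
  { apply Rle_trans with (1 := Rle_abs _); rewrite Rabs_mult.
    assert (0 <= Rabs s) by apply Rabs_pos.
    assert (Rabs (snd (W x' y') - snd (W x y)) <= e / 2).
    { left; replace (snd (W x' y') - snd (W x y)) with
       (0 * fst (W x' y') + 1 * snd (W x' y') - (0 * fst (W x y) + 1 * snd (W x y))) by ring.
      exact E2. }
    assert (0 <= Rabs (snd (W x' y') - snd (W x y))) by apply Rabs_pos. nra. }
  lra. }
(* Some branch recurs in every neighbourhood of [(x, y)] along the maximising points; by continuity
   its value there is at least [m], even when [(x, y)] is on the edge of its zone. *)
assert (Hbr : exists b : bool, (if b then y <= eps /\ (0 < y -> Rabs (x - eps / 2) <= eps) else 0 <= y) /\ m <= f b x y).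
{ assert (Hcase : exists b, forall e, 0 < e -> exists u w, zone eps d H b u w /\
     Rabs (u - x) < e /\ Rabs (w - y) < e /\ m - e < f b u w).
  { destruct (Classical_Prop.classic (forall e, 0 < e -> exists u w, zone eps d H true u w /\
     Rabs (u - x) < e /\ Rabs (w - y) < e /\ m - e < f true u w)) as [Ht|Ht]; [now exists true|].
    exists false; intros e He'.
    apply Classical_Prop.NNPP; intros Hn; apply Ht; intros e1 He1.
    destruct (Hcl' (Rmin e e1)) as [b [u [w [Hz [C1 [C2 C3]]]]]]; [now apply Rmin_pos|].
    assert (A1 := Rmin_l e e1); assert (A2 := Rmin_r e e1).
    destruct b.
    - exists u, w; split; [assumption|split; [|split]]; lra.
    - elim Hn; exists u, w; split; [assumption|split; [|split]]; lra. }
  destruct Hcase as [b Hcase]; exists b.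
  assert (Hreg : if b then y <= eps /\ (0 < y -> Rabs (x - eps / 2) <= eps) else 0 <= y).
  { destruct b.
    - split.
      + apply Rnot_lt_le; intros Hc.
        destruct (Hcase (y - eps)) as [u [w [[_ [_ Hz]] [_ [C2 _]]]]]; [lra|].
        apply Rabs_def2 in C2; destruct Hz as [Hz|Hz]; lra.
      + intros Hy0; apply Rnot_lt_le; intros Hc.
        destruct (Hcase (Rmin y (Rabs (x - eps / 2) - eps))) as [u [w [[_ [_ Hz]] [C1 [C2 _]]]]];
          [apply Rmin_pos; lra|].
        assert (A1 := Rmin_l y (Rabs (x - eps / 2) - eps)).
        assert (A2 := Rmin_r y (Rabs (x - eps / 2) - eps)).
        apply Rabs_def2 in C2; destruct Hz as [Hz|[Hz _]]; [lra|].
        assert (A3 := Rabs_triang_inv (x - eps / 2) (u - eps / 2)).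
        replace (x - eps / 2 - (u - eps / 2)) with (- (u - x)) in A3 by ring.
        rewrite Rabs_Ropp in A3. lra.
    - apply Rnot_lt_le; intros Hc.
      destruct (Hcase (- y)) as [u [w [[_ [_ Hz]] [_ [C2 _]]]]]; [lra|].
      apply Rabs_def2 in C2; lra. }
  split; [exact Hreg|].
  apply Rnot_lt_le; intros Hc.
  set (e := (m - f b x y) / 4). assert (He' : 0 < e) by (unfold e; lra).
  assert (HcB : continuity_2d_pt (fun x y => M * B b x y + eta * G x y) x y).
  { apply continuity_2d_pt_plus; (apply continuity_2d_pt_mult; [apply continuity_2d_pt_const|]).
    - unfold B, bar; destruct b; [apply continuity_barZ|apply (continuity_barP N), Hreg].
    - apply (continuity_cornerG N), Hdom. }
  destruct (near2_and _ _ _ _ (HcW e He') (cont2_near _ _ _ e HcB He')) as [del [Hdel Hn]].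
  destruct (Hcase (Rmin del e)) as [u [w [Hz [C1 [C2 C3]]]]]; [now apply Rmin_pos|].
  assert (A1 := Rmin_l del e); assert (A2 := Rmin_r del e).
  destruct (Hn u w ltac:(lra) ltac:(lra)) as [E1 E2].
  apply Rabs_def2 in E2. unfold e, f in *; lra. }
assert (NoZ : (y <= 0 \/ (Rabs (x - eps / 2) < eps /\ y < eps)) -> m <= f true x y -> False).
{ intros Hcase Hf.
  assert (Hzone : near2 (zone eps d H true) x y).
  { destruct (Rlt_le_dec 0 y) as [Hy0|Hy0]; [destruct Hcase as [Hc|[Hx1 Hy1]]; [lra|]|].
    - set (r := Rmin (Rmin y (eps - y)) (eps - Rabs (x - eps / 2))).
      assert (Hr : 0 < r /\ r <= y /\ r <= eps - y /\ r <= eps - Rabs (x - eps / 2)).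
      { assert (A1 := Rmin_l (Rmin y (eps - y)) (eps - Rabs (x - eps / 2))).
        assert (A2 := Rmin_r (Rmin y (eps - y)) (eps - Rabs (x - eps / 2))).
        assert (A3 := Rmin_l y (eps - y)). assert (A4 := Rmin_r y (eps - y)).
        assert (0 < r) by (repeat apply Rmin_pos; lra). unfold r in *; lra. }
      exists r; split; [apply Hr|]; intros u w Hu Hw.
      apply Rabs_def2 in Hw.
      assert (Hu2 : Rabs (u - eps / 2) <= eps).
      { replace (u - eps / 2) with ((u - x) + (x - eps / 2)) by ring.
        apply Rle_trans with (1 := Rabs_triang _ _). lra. }
      split; [apply Rabs_le_between in Hu2; lra|split; [lra|right; lra]].
    - destruct Hdom as [Hd0|[Hd0 Hd1]]; [lra|].
      set (r := Rmin (Rmin x (eps - x)) (Rmin (y + 1) eps)).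
      assert (Hr : 0 < r /\ r <= x /\ r <= eps - x /\ r <= y + 1 /\ r <= eps).
      { assert (A1 := Rmin_l (Rmin x (eps - x)) (Rmin (y + 1) eps)).
        assert (A2 := Rmin_r (Rmin x (eps - x)) (Rmin (y + 1) eps)).
        assert (A3 := Rmin_l x (eps - x)). assert (A4 := Rmin_r x (eps - x)).
        assert (A5 := Rmin_l (y + 1) eps). assert (A6 := Rmin_r (y + 1) eps).
        assert (0 < r) by (repeat apply Rmin_pos; lra). unfold r in *; lra. }
      exists r; split; [apply Hr|]; intros u w Hu Hw.
      apply Rabs_def2 in Hu; apply Rabs_def2 in Hw.
      split; [lra|split; [lra|]].
      destruct (Rlt_le_dec 0 w); [right|left; lra].
      split; [apply Rabs_le; lra|lra]. }
  assert (Hzp : zone eps d H true x y).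
  { destruct Hzone as [del [Hdel Hn]]; apply Hn; rewrite Rminus_diag, Rabs_R0; assumption. }
  assert (Hfm : f true x y = m) by (apply Rle_antisym; [now apply Hm'|assumption]).
  apply (no_interior_max M eta true x y _ _ _ HM (Rlt_le _ _ Heta) Hdom ltac:(apply Hy)
    (lap_barZ N _) I).
  - unfold f in Hfm. rewrite Hfm; exact Hm0.
  - now apply H2.
  - apply lap_barZ_neg; apply Hzp.
  - apply near2_impl with (2 := Hzone); intros u w Hz.
    unfold f in Hfm; rewrite Hfm; now apply Hm'. }
assert (NoP : 0 < y < H -> m <= f false x y -> False).
{ intros Hy0 Hf.
  assert (Hfm : f false x y = m).
  { apply Rle_antisym; [|assumption]. apply Hm'; split; [assumption|split; [lra|apply Hy0]]. }
  apply (no_interior_max M eta false x y _ _ _ HM (Rlt_le _ _ Heta) Hdom ltac:(apply Hy)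
    (lap_barP N) (proj1 Hy0)).
  - unfold f in Hfm. rewrite Hfm; exact Hm0.
  - apply H2; split; [assumption|split; [lra|apply Hy0]].
  - apply lap_barP_neg; lra.
  - set (r := Rmin (Rmin y (H - y)) (d / 2)).
    assert (Hr : 0 < r /\ r <= y /\ r <= H - y /\ r <= d / 2).
    { assert (A1 := Rmin_l (Rmin y (H - y)) (d / 2)).
      assert (A2 := Rmin_r (Rmin y (H - y)) (d / 2)).
      assert (A3 := Rmin_l y (H - y)). assert (A4 := Rmin_r y (H - y)).
      assert (0 < r) by (repeat apply Rmin_pos; lra). unfold r in *; lra. }
    exists r; split; [apply Hr|]; intros u w Hu Hw.
    apply Rabs_def2 in Hu; apply Rabs_def2 in Hw.
    unfold f in Hfm; rewrite Hfm.
    (* The sides [x = - d/2] and [x = d/2] are no boundary: neighbours beyond them are brought back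
       by one period. *)
    assert (Hper : forall u, 0 < w -> f false (u + d) w = f false u w).
    { intros u' Hw'; unfold f, B, bar, G.
      now rewrite (hf_per _ _ _ _ _ _ _ _ F), (barP_period N), (cornerG_period N). }
    change (f false u w <= m).
    destruct (Rle_lt_dec u (d / 2)) as [U1|U1]; [destruct (Rle_lt_dec (- (d / 2)) u) as [U2|U2]|].
    + apply Hm'; split; [lra|split; [lra|simpl; lra]].
    + rewrite <- Hper by lra. apply Hm'; split; [lra|split; [lra|simpl; lra]].
    + replace u with (u - d + d) by ring; rewrite Hper by lra.
      apply Hm'; split; [lra|split; [lra|simpl; lra]]. }
assert (HZP : forall b b', B b' x y <= B b x y -> m <= f b x y -> m <= f b' x y).
{ intros b b' Hle Hf; apply Rle_trans with (1 := Hf); unfold f.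
  assert (M * B b' x y <= M * B b x y) by (apply Rmult_le_compat_l; lra). lra. }
(* On the edge of its zone a branch is exchanged for the other one, which is smaller there. *)
destruct Hbr as [b [Hreg Hf]]; destruct b.
- destruct Hreg as [R1 R2].
  destruct (Rle_lt_dec y 0) as [Hy0|Hy0]; [now apply NoZ; [left|]|].
  specialize (R2 Hy0).
  destruct (Classical_Prop.classic (Rabs (x - eps / 2) = eps \/ y = eps)) as [Hedge|Hedge].
  + apply NoP; [lra|]. apply (HZP true false); [|assumption].
    apply (barP_le_barZ N); [assumption|lra|assumption].
  + apply NoZ; [|assumption]. right; split; apply Rnot_le_lt; intros Hc; apply Hedge; [left|right]; lra.
- destruct (Rle_lt_or_eq_dec _ _ Hreg) as [Hy0|Hy0].
  + destruct (Rle_lt_or_eq_dec _ _ (proj2 Hy)) as [HyH| ->]; [now apply NoP|].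
    assert (T1 := hf_top _ _ _ _ _ _ _ _ F x Hx).
    assert (T2 := barP_bounds N x H ltac:(lra)).
    assert (Hzz : zone eps d H false x H) by (split; [assumption|split; [lra|simpl; lra]]).
    assert (T3 := HG0 _ _ _ Hzz).
    unfold f, B, bar in Hf.
    assert (0 <= eta * G x H) by (apply Rmult_le_pos; lra).
    assert (1 * (10 * A * eps) <= M * barP eps d k A Q Lam x H).
    { apply Rmult_le_compat; try lra. apply Rmult_le_pos; lra. }
    lra.
  + subst y. apply NoZ; [left; lra|].
    apply (HZP false true); [|assumption].
    apply (barZ_le_barP N). destruct Hdom as [|[Hd0 _]]; lra.
Qed.

(** Boundedness of [W] and the lower bound [A eps] of the barrier give a first factor [2 ^ n];
    [bar_step] halves it [n] times. *)
Lemma zone_bound b x y : zone eps d H b x y -> Cmod (W x y) <= B b x y.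
Proof.
assert (Hpow : forall n M, M = 2 ^ n ->
  (forall b x y, zone eps d H b x y -> Cmod (W x y) <= M * B b x y) ->
  forall b x y, zone eps d H b x y -> Cmod (W x y) <= B b x y).
{ induction n as [|n IH]; intros M -> HM b1 x1 y1 Hz1.
  - specialize (HM b1 x1 y1 Hz1); simpl in HM; lra.
  - apply (IH (2 ^ n) eq_refl) with (2 := Hz1).
    apply bar_step; [apply pow_R1_Rle; lra|]. exact HM. }
intros Hz.
destruct (hf_bdd _ _ _ _ _ _ _ _ F) as [NB HNB].
assert (HAe : 0 < A * eps) by (destruct N; apply Rmult_lt_0_compat; lra).
assert (Hlow : exists bm, 0 < bm /\ forall b x y, zone eps d H b x y -> bm <= B b x y).
{ exists (A * eps); split; [assumption|].
  intros b' x' y' Hz'; destruct b'; unfold B, bar.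
  - apply (barZ_bounds N), Hz'.
  - assert (T := barP_bounds N x' y' ltac:(destruct Hz' as [_ [Hz' Hz'']]; simpl in Hz''; lra)). lra. }
destruct Hlow as [bm [Hbm Hlow]].
destruct (Pow_x_infinity 2 ltac:(rewrite Rabs_pos_eq; lra) (Rabs NB / bm)) as [n Hn].
apply (Hpow n (2 ^ n) eq_refl) with (2 := Hz).
intros b' x' y' Hz'.
assert (H1 := HNB x' y' (zone_dom _ _ _ Hz') ltac:(apply Hz') ltac:(apply Hz')).
specialize (Hn n (Nat.le_refl n)).
rewrite (Rabs_pos_eq (2 ^ n)) in Hn by (apply pow_le; lra).
apply Rle_trans with (1 := H1), Rle_trans with (1 := Rle_abs _).
replace (Rabs NB) with (Rabs NB / bm * bm) by (field; lra).
apply Rmult_le_compat; [apply Rdiv_le_0_compat; [apply Rabs_pos|lra]|lra|lra|now apply Hlow].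
Qed.

Lemma half_field_bound x y : - (d / 2) <= x <= d / 2 -> 0 < y <= H -> Cmod (W x y) <= P x y.
Proof. intros Hx Hy; apply (zone_bound false); split; [assumption|split; simpl; lra]. Qed.

Lemma half_field_aperture x : 0 < x < eps -> Cmod (W x 0) <= P 0 0.
Proof.
intros Hx; apply Rle_trans with (2 := barZ_aperture_le_P0 N x Hx).
assert (Hd60 := sn_eps_d N). assert (HH := sn_H _ _ _ _ _ _ _ N).
apply (zone_bound true); split; [lra|split; [lra|left; lra]].
Qed.
End Barrier.

(** * Fourier coefficients of Rayleigh series *)

Definition expi (t : R) : C := (cos t, sin t).

Lemma cexp_Ci (t : R) : cexp (Ci * RtoC t)%C = expi t.
Proof.
unfold cexp, expi; simpl.
replace (0 * t - 1 * 0) with 0 by ring; replace (0 * 0 + 1 * t) with t by ring.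
now rewrite exp_0, !Rmult_1_l.
Qed.

Lemma cexp_plus (z w : C) : cexp (z + w)%C = (cexp z * cexp w)%C.
Proof.
unfold cexp, Re, Im; simpl; rewrite exp_plus, cos_plus, sin_plus.
unfold Cmult; simpl; f_equal; ring.
Qed.

Lemma Cmod_expi (t : R) : Cmod (expi t) = 1.
Proof.
unfold Cmod, expi; simpl.
replace (cos t * (cos t * 1) + sin t * (sin t * 1)) with 1; [apply sqrt_1|].
assert (H := sin2_cos2 t); unfold Rsqr in H; lra.
Qed.

Lemma is_series_eps (a : nat -> C) (l : C) :
  is_series a l -> forall e, 0 < e -> exists N, forall n, (N <= n)%nat -> Cmod (sum_n a n - l)%C < e.
Proof.
intros H e He.
destruct (proj1 (@filterlim_locally_ball_norm C_AbsRing nat C_NormedModule eventually _ (sum_n a) l) H (mkposreal e He)) as [N HN].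
exists N; intros n Hn; exact (HN n Hn).
Qed.

Lemma sum_n_SC (a : nat -> C) n : sum_n a (S n) = (sum_n a n + a (S n))%C.
Proof. exact (sum_Sn (a : nat -> C_AbelianGroup) n). Qed.

Lemma sum_n_SR (f : nat -> R) n : sum_n f (S n) = sum_n f n + f (S n).
Proof. exact (sum_Sn (f : nat -> R_AbelianGroup) n). Qed.

Lemma geometric_tail (a : nat -> C) (l : C) (b rho : R) (N : nat) :
  0 <= rho < 1 -> (forall m, (N < m)%nat -> Cmod (a m) <= b * rho ^ m) -> is_series a l ->
  Cmod (l - sum_n a N)%C <= b * rho ^ S N / (1 - rho).
Proof.
intros Hrho Ha Hl.
assert (Hp : forall p, Cmod (sum_n a (N + p) - sum_n a N)%C <= b * rho ^ S N * (1 - rho ^ p) / (1 - rho)).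
{ induction p as [|p IH].
  - rewrite Nat.add_0_r. replace (sum_n a N - sum_n a N)%C with (RtoC 0) by ring.
    rewrite Cmod_0; simpl; right; field; lra.
  - rewrite Nat.add_succ_r, sum_n_SC.
    replace (sum_n a (N + p) + a (S (N + p)) - sum_n a N)%C
      with ((sum_n a (N + p) - sum_n a N) + a (S (N + p)))%C by ring.
    apply Rle_trans with (1 := Cmod_triangle _ _).
    specialize (Ha (S (N + p)) ltac:(lia)).
    apply Rle_trans with (1 := Rplus_le_compat _ _ _ _ IH Ha).
    right; replace (S (N + p)) with (S N + p)%nat by lia.
    rewrite pow_add; simpl; field; lra. }
assert (Hb : 0 <= b * rho ^ S N).
{ apply Rle_trans with (2 := Ha (S N) ltac:(lia)); apply Cmod_ge_0. }
apply Rnot_lt_le; intros Hlt.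
set (T := b * rho ^ S N / (1 - rho)) in *.
destruct (is_series_eps a l Hl (Cmod (l - sum_n a N) - T)) as [N1 HN1]; [lra|].
specialize (HN1 (N + N1)%nat ltac:(lia)); specialize (Hp N1).
assert (H1 : Cmod (l - sum_n a N)%C <= Cmod (sum_n a (N + N1) - l)%C + Cmod (sum_n a (N + N1) - sum_n a N)%C).
{ rewrite <- (Cmod_opp (sum_n a (N + N1) - l)).
  replace (l - sum_n a N)%C with (- (sum_n a (N + N1) - l) + (sum_n a (N + N1) - sum_n a N))%C by ring.
  apply Cmod_triangle. }
assert (H2 : b * rho ^ S N * (1 - rho ^ N1) / (1 - rho) <= T).
{ unfold T, Rdiv; apply Rmult_le_compat_r; [left; apply Rinv_0_lt_compat; lra|].
  rewrite <- (Rmult_1_r (b * rho ^ S N)) at 2.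
  apply Rmult_le_compat_l; [assumption|].
  assert (0 <= rho ^ N1) by (apply pow_le; lra). lra. }
lra.
Qed.

Lemma is_series_bounded (a : nat -> C) (l : C) :
  is_series a l -> exists b, forall m, Cmod (a m) <= b.
Proof.
intros Hl; destruct (is_series_eps a l Hl 1 Rlt_0_1) as [N HN].
assert (Hfin : forall n, exists b, forall m, (m <= n)%nat -> Cmod (a m) <= b).
{ induction n as [|n [b IH]].
  - exists (Cmod (a 0%nat)); intros m Hm; replace m with 0%nat by lia; lra.
  - exists (Rmax b (Cmod (a (S n)))); intros m Hm.
    destruct (Nat.eq_dec m (S n)) as [->|Hne]; [apply Rmax_r|].
    apply Rle_trans with b; [apply IH; lia|apply Rmax_l]. }
destruct (Hfin N) as [b Hb]; exists (Rmax b 2); intros m.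
destruct (Compare_dec.le_lt_dec m N) as [Hm|Hm].
- apply Rle_trans with b; [now apply Hb|apply Rmax_l].
- apply Rle_trans with 2; [|apply Rmax_r].
  destruct m as [|m]; [lia|].
  assert (A1 := HN m ltac:(lia)); assert (A2 := HN (S m) ltac:(lia)).
  rewrite sum_n_SC in A2.
  replace (a (S m)) with ((sum_n a m + a (S m) - l) + - (sum_n a m - l))%C by ring.
  apply Rle_trans with (1 := Cmod_triangle _ _). rewrite Cmod_opp; lra.
Qed.

Lemma Zseries_bounded (a : Z -> C) (l : C) :
  is_Zseries a l -> exists b, forall n, Cmod (a n) <= b.
Proof.
intros [l1 [l2 [H1 [H2 _]]]].
destruct (is_series_bounded _ _ H1) as [b1 Hb1]; destruct (is_series_bounded _ _ H2) as [b2 Hb2].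
exists (Rmax b1 b2); intros n; destruct (Z_le_dec 0 n) as [Hn|Hn].
- rewrite <- (Z2Nat.id n Hn); apply Rle_trans with (1 := Hb1 _), Rmax_l.
- replace n with (- Z.of_nat (S (Z.to_nat (- n - 1))))%Z by lia.
  apply Rle_trans with (1 := Hb2 _), Rmax_r.
Qed.

Definition kap (k0 d : R) (n : Z) : R := k0 + 2 * PI * IZR n / d.

Lemma pr_rotate (c s t : R) (z : C) :
  pr (c * cos t - s * sin t) (c * sin t + s * cos t) z = pr c s (z * expi (- t))%C.
Proof. unfold pr, expi, Cmult; simpl; rewrite cos_neg, sin_neg; ring. Qed.

Lemma rotate_unit (c s t : R) : c ^ 2 + s ^ 2 = 1 ->
  (c * cos t - s * sin t) ^ 2 + (c * sin t + s * cos t) ^ 2 = 1.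
Proof. intros H; assert (H1 := sin2_cos2 t); unfold Rsqr in H1; nra. Qed.

Lemma expi_plus (t u : R) : expi (t + u) = (expi t * expi u)%C.
Proof. unfold expi, Cmult; simpl; rewrite cos_plus, sin_plus; f_equal; ring. Qed.

Lemma sin_cos_nPI (n : Z) : sin (IZR n * PI) = 0.
Proof. apply sin_eq_0_1; now exists n. Qed.

(** Orthogonality of the modes over a period, expressed by antiderivatives: the increment of [T]
    plays the part of an integral. *)
Lemma mode_primitive (k0 d c s : R) (n0 n : Z) (z : C) : 0 < d ->
  exists T : R -> R,
    (forall x, is_derive T x (pr c s (z * expi (kap k0 d n * x) * expi (- (kap k0 d n0 * x)))%C)) /\
    T (d / 2) - T (- (d / 2)) = if Z.eq_dec n n0 then d * pr c s z else 0.
Proof.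
intros Hd.
set (w := 2 * PI * IZR (n - n0) / d).
assert (Hw : forall x, pr c s (z * expi (kap k0 d n * x) * expi (- (kap k0 d n0 * x)))%C =
   pr c s z * cos (w * x) - pr c s (- snd z, fst z) * - sin (w * x)).
{ intros x; rewrite <- Cmult_assoc, <- expi_plus.
  replace (kap k0 d n * x + - (kap k0 d n0 * x)) with (w * x)
    by (unfold kap, w; rewrite minus_IZR; field; lra).
  unfold pr, expi, Cmult; simpl; ring. }
destruct (Z.eq_dec n n0) as [->|Hne].
- exists (fun x => pr c s z * x); split; [|field].
  intros x; rewrite Hw; unfold w; rewrite Z.sub_diag.
  replace (2 * PI * 0 / d * x) with 0 by (field; lra); rewrite cos_0, sin_0.
  auto_derive; [exact I|ring].
- assert (Hw0 : w <> 0).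
  { unfold w, Rdiv; assert (HPI := PI_RGT_0); apply Rmult_integral_contrapositive_currified.
    - apply Rmult_integral_contrapositive_currified; [lra|].
      apply not_0_IZR; lia.
    - apply Rinv_neq_0_compat; lra. }
  exists (fun x => (pr c s z * sin (w * x) - pr c s (- snd z, fst z) * cos (w * x)) / w); split.
  + intros x; rewrite Hw; auto_derive; [exact I|field; assumption].
  + replace (w * - (d / 2)) with (- (w * (d / 2))) by ring.
    rewrite sin_neg, cos_neg.
    (* [w d / 2] is a multiple of [PI]: the sines vanish at both ends, and the cosines cancel by
       parity. *)
    replace (w * (d / 2)) with (IZR (n - n0) * PI) by (unfold w; field; lra).
    rewrite sin_cos_nPI; field; assumption.
Qed.

Lemma sum_primitive (k0 d c s : R) (n0 : Z) (idx : nat -> Z) (cf : Z -> C) (N : nat) : 0 < d ->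
  exists T : R -> R,
    (forall x, is_derive T x (pr c s
       (sum_n (fun m => cf (idx m) * expi (kap k0 d (idx m) * x))%C N * expi (- (kap k0 d n0 * x)))%C)) /\
    T (d / 2) - T (- (d / 2))
      = sum_n (fun m => if Z.eq_dec (idx m) n0 then d * pr c s (cf (idx m)) else 0) N.
Proof.
intros Hd; induction N as [|N [T [IH1 IH2]]].
- destruct (mode_primitive k0 d c s n0 (idx 0%nat) (cf (idx 0%nat)) Hd) as [T [H1 H2]].
  exists T; split; [intros x; rewrite sum_O; apply H1|rewrite sum_O; exact H2].
- destruct (mode_primitive k0 d c s n0 (idx (S N)) (cf (idx (S N))) Hd) as [T' [H1 H2]].
  exists (fun x => T x + T' x); split.
  + intros x; rewrite sum_n_SC, Cmult_plus_distr_r.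
    replace (pr c s (sum_n (fun m => cf (idx m) * expi (kap k0 d (idx m) * x))%C N * expi (- (kap k0 d n0 * x)) +
        cf (idx (S N)) * expi (kap k0 d (idx (S N)) * x) * expi (- (kap k0 d n0 * x)))%C)
     with (plus (pr c s (sum_n (fun m => cf (idx m) * expi (kap k0 d (idx m) * x))%C N * expi (- (kap k0 d n0 * x)))%C)
        (pr c s (cf (idx (S N)) * expi (kap k0 d (idx (S N)) * x) * expi (- (kap k0 d n0 * x)))%C))
     by (unfold pr, plus; simpl; ring).
    apply @is_derive_plus; [apply IH1|apply H1].
  + rewrite sum_n_SR, <- IH2; destruct (Z.eq_dec (idx (S N)) n0); simpl; lra.
Qed.

Lemma sum_indicator_none (f : nat -> R) (N : nat) : (forall m, f m = 0) -> sum_n f N = 0.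
Proof.
intros Hf; induction N as [|N IH]; [now rewrite sum_O|].
rewrite sum_n_SR, IH, Hf; exact (Rplus_0_l 0).
Qed.

Lemma sum_indicator_one (f : nat -> R) (m0 N : nat) : (m0 <= N)%nat ->
  (forall m, m <> m0 -> f m = 0) -> sum_n f N = f m0.
Proof.
intros Hm Hf; induction N as [|N IH].
- replace m0 with 0%nat by lia; now rewrite sum_O.
- rewrite sum_n_SR; destruct (Nat.eq_dec m0 (S N)) as [->|Hne].
  + rewrite (sum_n_ext_loc f (fun _ => 0)), sum_indicator_none by (trivial; intros; apply Hf; lia).
    exact (Rplus_0_l _).
  + rewrite IH, (Hf (S N)) by lia; exact (Rplus_0_r _).
Qed.

(** The coefficient is a mean value over a period. Geometric decay makes the tails small uniformly
    in [x], so only finite sums are averaged, and the error disappears as their length grows. *)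
Lemma fourier_coef_bound (cf : Z -> C) (F : R -> C) (k0 d b rho M : R) (n0 : Z) (be : C) :
  0 < d -> 0 <= rho < 1 ->
  (forall n, Cmod (cf n) <= b * rho ^ Z.abs_nat n) ->
  (forall x, is_Zseries (fun n => cf n * expi (kap k0 d n * x))%C (F x)) ->
  (forall x, - (d / 2) <= x <= d / 2 -> Cmod (F x - be * expi (kap k0 d n0 * x))%C <= M) ->
  Cmod (cf n0 - be)%C <= M.
Proof.
intros Hd Hrho Hcf HF HM.
destruct (pr_attains (cf n0 - be)%C) as [c [s [Hcs Hatt]]].
assert (Hb : 0 <= b).
{ specialize (Hcf 0%Z); simpl in Hcf; assert (H := Cmod_ge_0 (cf 0%Z)); lra. }
assert (Htail : forall N, (Z.abs_nat n0 <= N)%nat ->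
  Cmod (cf n0 - be)%C <= M + 2 * (b * rho ^ S N / (1 - rho))).
{ intros N HN.
  destruct (sum_primitive k0 d c s n0 Z.of_nat cf N Hd) as [T1 [HT1 HT1']].
  destruct (sum_primitive k0 d c s n0 (fun m => (- Z.of_nat (S m))%Z) cf N Hd) as [T2 [HT2 HT2']].
  assert (Hval : T1 (d / 2) - T1 (- (d / 2)) + (T2 (d / 2) - T2 (- (d / 2))) = d * pr c s (cf n0)).
  { rewrite HT1', HT2'; destruct (Z_le_dec 0 n0) as [Hn|Hn].
    - rewrite (sum_indicator_one _ (Z.to_nat n0)), sum_indicator_none.
      + rewrite Z2Nat.id by assumption; destruct (Z.eq_dec n0 n0); [ring|contradiction].
      + intros m; destruct (Z.eq_dec (- Z.of_nat (S m)) n0); [lia|reflexivity].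
      + lia.
      + intros m Hm; destruct (Z.eq_dec (Z.of_nat m) n0); [lia|reflexivity].
    - rewrite sum_indicator_none, (sum_indicator_one _ (Z.to_nat (- n0 - 1))).
      + replace (- Z.of_nat (S (Z.to_nat (- n0 - 1))))%Z with n0 by lia.
        destruct (Z.eq_dec n0 n0); [ring|contradiction].
      + lia.
      + intros m Hm; destruct (Z.eq_dec (- Z.of_nat (S m)) n0); [lia|reflexivity].
      + intros m; destruct (Z.eq_dec (Z.of_nat m) n0); [lia|reflexivity]. }
  set (K := M + 2 * (b * rho ^ S N / (1 - rho))).
  (* Inequality between averages: the derivative of this function is at least [- K], and its
     increment over the period is [- d] times the projection of [cf n0 - be]. *)
  assert (Hpush := derive_lower_bound (fun x => pr c s be * x - (T1 x + T2 x))
    (fun x => pr c s be - (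
       pr c s (sum_n (fun m => cf (Z.of_nat m) * expi (kap k0 d (Z.of_nat m) * x))%C N * expi (- (kap k0 d n0 * x)))%C +
       pr c s (sum_n (fun m => cf (- Z.of_nat (S m))%Z * expi (kap k0 d (- Z.of_nat (S m))%Z * x))%C N * expi (- (kap k0 d n0 * x)))%C))
    (- (d / 2)) (d / 2) (- K) ltac:(lra)).
  cbv beta in Hpush.
  assert (Hineq : pr c s be * - (d / 2) - (T1 (- (d / 2)) + T2 (- (d / 2))) + - K * (d / 2 - - (d / 2))
     <= pr c s be * (d / 2) - (T1 (d / 2) + T2 (d / 2))).
  { apply Hpush.
    - intros x _; apply is_derive_sub with (3 := eq_refl).
      + auto_derive; [exact I|ring].
      + apply (@is_derive_plus R_AbsRing R_NormedModule T1 T2); [apply HT1|apply HT2].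
    - intros x Hx.
      destruct (HF x) as [l1 [l2 [H1 [H2 Hl]]]].
      assert (B1 : forall m, Cmod (cf (Z.of_nat m) * expi (kap k0 d (Z.of_nat m) * x))%C <= b * rho ^ m).
      { intros m; rewrite Cmod_mult, Cmod_expi, Rmult_1_r; specialize (Hcf (Z.of_nat m)).
        rewrite Zabs2Nat.id in Hcf; exact Hcf. }
      assert (B2 : forall m, Cmod (cf (- Z.of_nat (S m))%Z * expi (kap k0 d (- Z.of_nat (S m)) * x))%C
        <= b * rho ^ m).
      { intros m; rewrite Cmod_mult, Cmod_expi, Rmult_1_r; apply Rle_trans with (1 := Hcf _).
        replace (Z.abs_nat (- Z.of_nat (S m))) with (S m) by lia.
        apply Rmult_le_compat_l; [exact Hb|].
        simpl; rewrite <- (Rmult_1_l (rho ^ m)) at 2.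
        apply Rmult_le_compat_r; [apply pow_le; lra|lra]. }
      assert (G1 := geometric_tail _ _ b rho N Hrho (fun m _ => B1 m) H1).
      assert (G2 := geometric_tail _ _ b rho N Hrho (fun m _ => B2 m) H2).
      set (S1 := sum_n (fun m => cf (Z.of_nat m) * expi (kap k0 d (Z.of_nat m) * x))%C N) in *.
      set (S2 := sum_n (fun m => cf (- Z.of_nat (S m))%Z * expi (kap k0 d (- Z.of_nat (S m))%Z * x))%C N) in *.
      specialize (HM x Hx).
      set (t := kap k0 d n0 * x) in *.
      (* Multiplication by [expi (- t)] is a rotation and is absorbed in the direction of
         projection. *)
      assert (E : pr c s (S1 * expi (- t))%C + pr c s (S2 * expi (- t))%C - pr c s be =
        pr (c * cos t - s * sin t) (c * sin t + s * cos t) (S1 + S2 - be * expi t)%C).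
      { rewrite pr_rotate.
        replace ((S1 + S2 - be * expi t) * expi (- t))%C with (S1 * expi (- t) + S2 * expi (- t) - be)%C.
        - unfold pr; simpl; ring.
        - assert (Ht : (expi t * expi (- t))%C = RtoC 1).
          { rewrite <- expi_plus, Rplus_opp_r; unfold expi; now rewrite cos_0, sin_0. }
          replace ((S1 + S2 - be * expi t) * expi (- t))%C with
            (S1 * expi (- t) + S2 * expi (- t) - be * (expi t * expi (- t)))%C by ring.
          rewrite Ht; ring. }
      assert (E2 := pr_le_Cmod _ _ (S1 + S2 - be * expi t)%C (rotate_unit c s t Hcs)).
      assert (E3 : Cmod (S1 + S2 - be * expi t)%C <= K).
      { replace (S1 + S2 - be * expi t)%C with ((F x - be * expi t) + (- (l1 - S1) + - (l2 - S2)))%C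
          by (rewrite Hl; ring).
        apply Rle_trans with (1 := Cmod_triangle _ _).
        assert (E4 := Cmod_triangle (- (l1 - S1)) (- (l2 - S2))).
        rewrite !Cmod_opp in E4. unfold K; lra. }
      lra. }
  assert (E : d * Cmod (cf n0 - be)%C <= d * K).
  { rewrite <- Hatt.
    replace (pr c s (cf n0 - be)%C) with (pr c s (cf n0) - pr c s be) by (unfold pr; simpl; ring).
    lra. }
  apply Rmult_le_reg_l with (2 := E); assumption. }
apply Rnot_lt_le; intros Hlt.
set (g := (Cmod (cf n0 - be)%C - M) * (1 - rho) / (4 * (b + 1))).
assert (Hg : 0 < g).
{ apply Rdiv_lt_0_compat; [apply Rmult_lt_0_compat; lra|lra]. }
destruct (pow_lt_1_zero rho ltac:(rewrite Rabs_pos_eq; lra) g Hg) as [N HN].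
set (n := (N + Z.abs_nat n0)%nat).
assert (H1 := Htail n ltac:(unfold n; lia)).
assert (H2 := HN (S n) ltac:(unfold n; lia)).
rewrite Rabs_pos_eq in H2 by (apply pow_le; lra).
assert (H3 : b * rho ^ S n / (1 - rho) <= (Cmod (cf n0 - be)%C - M) / 4).
{ apply Rle_trans with ((b + 1) * g / (1 - rho)).
  - unfold Rdiv; apply Rmult_le_compat_r; [left; apply Rinv_0_lt_compat; lra|].
    assert (0 <= rho ^ S n) by (apply pow_le; lra).
    apply Rmult_le_compat; lra.
  - right; unfold g; field; lra. }
lra.
Qed.

(** The zero mode opens the first series; what remains of both series is geometric with ratio
    [q]. *)
Lemma fourier_zero_mode (cf : Z -> C) (Fx : C) (k0 d b q x : R) :
  0 <= q < 1 -> 0 <= b ->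
  (forall n, n <> 0%Z -> Cmod (cf n) <= b * q ^ Z.abs_nat n) ->
  is_Zseries (fun n => cf n * expi (kap k0 d n * x))%C Fx ->
  Cmod (Fx - cf 0%Z * expi (k0 * x))%C <= 2 * (b * q / (1 - q)).
Proof.
intros Hq Hb Hcf [l1 [l2 [H1 [H2 ->]]]].
assert (H1' : forall m, (0 < m)%nat ->
  Cmod (cf (Z.of_nat m) * expi (kap k0 d (Z.of_nat m) * x))%C <= b * q ^ m).
{ intros m Hm; rewrite Cmod_mult, Cmod_expi, Rmult_1_r.
  specialize (Hcf (Z.of_nat m) ltac:(lia)); rewrite Zabs2Nat.id in Hcf; exact Hcf. }
assert (G1 := geometric_tail _ _ b q 0 Hq H1' H1).
rewrite sum_O in G1; simpl Z.of_nat in G1.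
replace (kap k0 d 0 * x) with (k0 * x) in G1 by (unfold kap, Rdiv; ring).
rewrite pow_1 in G1.
assert (H2' : forall m, Cmod (cf (- Z.of_nat (S m))%Z * expi (kap k0 d (- Z.of_nat (S m)) * x))%C
   <= b * q * q ^ m).
{ intros m; rewrite Cmod_mult, Cmod_expi, Rmult_1_r.
  apply Rle_trans with (1 := Hcf (- Z.of_nat (S m))%Z ltac:(lia)).
  replace (Z.abs_nat (- Z.of_nat (S m))) with (S m) by lia. simpl; lra. }
assert (G2 := geometric_tail _ _ (b * q) q 0 Hq (fun m _ => H2' m) H2).
rewrite sum_O, pow_1 in G2.
assert (H20 := H2' 0%nat). rewrite pow_O in H20.
set (a1 := (cf 0%Z * expi (k0 * x))%C) in *.
set (a2 := (cf (- Z.of_nat 1)%Z * expi (kap k0 d (- Z.of_nat 1) * x))%C) in *.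
replace (l1 + l2 - a1)%C with ((l1 - a1) + ((l2 - a2) + a2))%C by ring.
apply Rle_trans with (1 := Cmod_triangle _ _).
assert (G3 := Cmod_triangle (l2 - a2) a2).
assert (b * q * q / (1 - q) + b * q * 1 = b * q / (1 - q)) by (field; lra).
lra.
Qed.

(** * Quasi-periodic half-plane fields and standing waves *)

Record base_field (eps d k kappa0 A : R) (W W1 W2 : R -> R -> C) : Prop := {
  bf_lap : forall c s, lap_on (dom eps) (fun x y => pr c s (W x y))
    (fun x y => pr c s (W1 x y)) (fun x y => pr c s (W2 x y))
    (fun x y => - k ^ 2 * pr c s (W x y));
  bf_cont : forall c s x y, dom eps x y -> continuity_2d_pt (fun x y => pr c s (W x y)) x y;
  bf_per : forall x y, 0 < y -> W (x + d) y = (expi (kappa0 * d) * W x y)%C;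
  bf_wall : forall x y e, x = 0 \/ x = eps -> -1 < y < 0 -> 0 < e ->
    near2 (fun x' y' => rect eps (-1) 0 x' y' -> Cmod (W1 x' y') <= k * A + e) x y;
  bf_face : forall x e, - (d / 2) <= x <= d / 2 -> ~ 0 <= x <= eps -> 0 < e ->
    near2 (fun x' y' => 0 < y' -> Cmod (W2 x' y') <= e) x 0;
  bf_bdd : forall H, exists B, forall x y, dom eps x y -> - (d / 2) <= x <= d / 2 -> y <= H ->
    Cmod (W x y) <= B }.

(** The standing wave [al e^{i kappa x} cos (zeta y)] satisfies the Neumann condition at [y = 0]. *)
Definition sw (al : C) (ka ze x y : R) : C := (RtoC (cos (ze * y)) * (al * expi (ka * x)))%C.
Definition sw1 (al : C) (ka ze x y : R) : C :=
  (RtoC (ka * cos (ze * y)) * (al * Ci * expi (ka * x)))%C.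
Definition sw2 (al : C) (ka ze x y : R) : C :=
  (RtoC (- ze * sin (ze * y)) * (al * expi (ka * x)))%C.

Lemma pr_scal c s t z : pr c s (RtoC t * z)%C = t * pr c s z.
Proof. unfold pr; simpl; ring. Qed.

Lemma pr_minus c s z w : pr c s (z - w)%C = 1 * pr c s z + -1 * pr c s w.
Proof. unfold pr; simpl; ring. Qed.

Lemma pr_mul_expi c s al t :
  pr c s (al * expi t)%C = pr c s al * cos t + pr c s (al * Ci)%C * sin t.
Proof. unfold pr, expi; simpl; ring. Qed.

Lemma pr_Ci2 c s al : pr c s (al * Ci * Ci)%C = - pr c s al.
Proof. unfold pr; simpl; ring. Qed.

Lemma lap_sw (O : R -> R -> Prop) c s al ka ze k : ka ^ 2 + ze ^ 2 = k ^ 2 ->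
  lap_on O (fun x y => pr c s (sw al ka ze x y)) (fun x y => pr c s (sw1 al ka ze x y))
    (fun x y => pr c s (sw2 al ka ze x y)) (fun x y => - k ^ 2 * pr c s (sw al ka ze x y)).
Proof.
intros Hk.
exists (fun x y => - ka ^ 2 * pr c s (sw al ka ze x y)), (fun x y => - ze ^ 2 * pr c s (sw al ka ze x y)).
intros x y _; unfold sw, sw1, sw2.
split; [|split; [|split; [|split]]].
- apply is_derive_ext with (fun x => cos (ze * y) * (pr c s al * cos (ka * x) + pr c s (al * Ci)%C * sin (ka * x))).
  { intros t; now rewrite pr_scal, pr_mul_expi. }
  rewrite pr_scal, pr_mul_expi, pr_Ci2; auto_derive; [exact I|ring].
- apply is_derive_ext with (fun y => cos (ze * y) * pr c s (al * expi (ka * x))%C).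
  { intros t; now rewrite pr_scal. }
  rewrite pr_scal; auto_derive; [exact I|ring].
- apply is_derive_ext with (fun x => ka * cos (ze * y) *
    (pr c s (al * Ci)%C * cos (ka * x) + pr c s (al * Ci * Ci)%C * sin (ka * x))).
  { intros t; now rewrite pr_scal, pr_mul_expi. }
  rewrite pr_scal, pr_mul_expi, pr_Ci2; auto_derive; [exact I|ring].
- apply is_derive_ext with (fun y => - ze * sin (ze * y) * pr c s (al * expi (ka * x))%C).
  { intros t; now rewrite pr_scal. }
  rewrite pr_scal; auto_derive; [exact I|ring].
- rewrite pr_scal; rewrite <- Hk; ring.
Qed.

Lemma Cmod_sw al ka ze x y : Cmod (sw al ka ze x y) = Rabs (cos (ze * y)) * Cmod al.
Proof. unfold sw; now rewrite !Cmod_mult, Cmod_R, Cmod_expi, Rmult_1_r. Qed.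

Lemma Cmod_sw_le al ka ze x y : Cmod (sw al ka ze x y) <= Cmod al.
Proof.
rewrite Cmod_sw; rewrite <- (Rmult_1_l (Cmod al)) at 2.
apply Rmult_le_compat_r; [apply Cmod_ge_0|apply Rabs_le, COS_bound].
Qed.

Lemma Cmod_sw1_le al ka ze k x y : Rabs ka <= k -> Cmod (sw1 al ka ze x y) <= k * Cmod al.
Proof.
intros Hk; unfold sw1; rewrite !Cmod_mult, Cmod_R, Cmod_expi, Rmult_1_r.
replace (Cmod Ci) with 1.
2:{ unfold Cmod; simpl; replace (0 * (0 * 1) + 1 * (1 * 1)) with 1 by ring; now rewrite sqrt_1. }
rewrite Rmult_1_r, Rabs_mult.
apply Rmult_le_compat_r; [apply Cmod_ge_0|].
rewrite <- (Rmult_1_r k); apply Rmult_le_compat; try apply Rabs_pos; [assumption|].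
apply Rabs_le, COS_bound.
Qed.

Lemma Cmod_sw2_le al ka ze x y : 0 <= ze -> Cmod (sw2 al ka ze x y) <= ze ^ 2 * Rabs y * Cmod al.
Proof.
intros Hz; unfold sw2; rewrite !Cmod_mult, Cmod_R, Cmod_expi, Rmult_1_r.
apply Rmult_le_compat_r; [apply Cmod_ge_0|].
rewrite Rabs_mult, Rabs_Ropp, (Rabs_pos_eq ze) by assumption.
replace (ze ^ 2 * Rabs y) with (ze * (ze * Rabs y)) by ring.
apply Rmult_le_compat_l; [assumption|].
replace (ze * Rabs y) with (Rabs (ze * y)) by (rewrite Rabs_mult, (Rabs_pos_eq ze); trivial).
apply Rsqr_le_abs_0; rewrite !Rsqr_pow2; apply sin_sqr_le.
Qed.

Lemma continuity_pr_sw c s al ka ze x y :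
  continuity_2d_pt (fun x y => pr c s (sw al ka ze x y)) x y.
Proof.
apply continuity_2d_pt_ext with (fun x y => cos (ze * y) *
   (pr c s al * cos (ka * x) + pr c s (al * Ci)%C * sin (ka * x))).
{ intros u v; unfold sw; now rewrite pr_scal, pr_mul_expi. }
apply continuity_2d_pt_mult.
- apply (continuity_1d_2d_pt_comp (fun y => cos (ze * y)) (fun _ y => y)); [|apply continuity_2d_pt_id2].
  apply derivable_continuous_pt; reg.
- apply (continuity_1d_2d_pt_comp (fun x => pr c s al * cos (ka * x) + pr c s (al * Ci)%C * sin (ka * x))
    (fun x _ => x)); [|apply continuity_2d_pt_id1].
  apply derivable_continuous_pt; reg.
Qed.

Lemma sw_period al ka ze d x y : sw al ka ze (x + d) y = (expi (ka * d) * sw al ka ze x y)%C.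
Proof. unfold sw; rewrite Rmult_plus_distr_l, expi_plus; ring. Qed.

(** The standing wave respects the faces but not the walls, where its derivative is at most
    [k * Cmod al]; this accounts for the new constant [A + Cmod al]. *)
Lemma base_field_sw eps d k ka ze A al W W1 W2 :
  0 <= ze -> ka ^ 2 + ze ^ 2 = k ^ 2 -> 0 <= k ->
  base_field eps d k ka A W W1 W2 ->
  base_field eps d k ka (A + Cmod al) (fun x y => (W x y - sw al ka ze x y)%C)
    (fun x y => (W1 x y - sw1 al ka ze x y)%C) (fun x y => (W2 x y - sw2 al ka ze x y)%C).
Proof.
intros Hz Hk Hk0 [Hlap Hcont Hper Hwall Hface Hbdd].
assert (Hka : Rabs ka <= k).
{ assert (0 <= ze ^ 2) by apply pow2_ge_0.
  apply Rsqr_incr_0_var; [|assumption]. rewrite <- Rsqr_abs, !Rsqr_pow2; lra. }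
assert (Ha := Cmod_ge_0 al).
split.
- intros c s.
  destruct (lap_on_lin _ 1 (-1) _ _ _ _ _ _ _ _ (Hlap c s) (lap_sw (dom eps) c s al ka ze k Hk))
    as [p11 [p22 Hp]].
  exists p11, p22; intros x y Hd; destruct (Hp x y Hd) as [P1 [P2 [P3 [P4 P5]]]].
  rewrite !pr_minus; split; [|split; [|split; [|split]]].
  + apply is_derive_ext with (2 := P1); intros t; now rewrite pr_minus.
  + apply is_derive_ext with (2 := P2); intros t; now rewrite pr_minus.
  + apply is_derive_ext with (2 := P3); intros t; now rewrite pr_minus.
  + apply is_derive_ext with (2 := P4); intros t; now rewrite pr_minus.
  + rewrite P5; ring.
- intros c s x y Hd.
  apply continuity_2d_pt_ext with (fun x y => pr c s (W x y) - pr c s (sw al ka ze x y)).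
  { intros u v; rewrite pr_minus; ring. }
  apply continuity_2d_pt_minus; [now apply Hcont|apply continuity_pr_sw].
- intros x y Hy; rewrite Hper, sw_period by assumption; ring.
- intros x y e Hx Hy He; apply near2_impl with (2 := Hwall x y e Hx Hy He).
  intros x' y' H Hr; specialize (H Hr).
  apply Rle_trans with (Cmod (W1 x' y') + Cmod (sw1 al ka ze x' y')).
  + unfold Cminus; rewrite <- (Cmod_opp (sw1 al ka ze x' y')); apply Cmod_triangle.
  + assert (H1 := Cmod_sw1_le al ka ze k x' y' Hka). lra.
- intros x e Hx Hout He.
  destruct (Hface x (e / 2) Hx Hout ltac:(lra)) as [del [Hdel Hn]].
  set (K := ze ^ 2 * Cmod al).
  assert (HK : 0 <= K) by (apply Rmult_le_pos; [apply pow2_ge_0|assumption]).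
  exists (Rmin del (e / (2 * (K + 1)))); split.
  { apply Rmin_pos; [assumption|apply Rdiv_lt_0_compat; lra]. }
  intros x' y' Hx' Hy' Hpos.
  assert (A1 := Rmin_l del (e / (2 * (K + 1)))); assert (A2 := Rmin_r del (e / (2 * (K + 1)))).
  specialize (Hn x' y' ltac:(lra) ltac:(lra) Hpos).
  rewrite Rminus_0_r in Hy'.
  apply Rle_trans with (Cmod (W2 x' y') + Cmod (sw2 al ka ze x' y')).
  + unfold Cminus; rewrite <- (Cmod_opp (sw2 al ka ze x' y')); apply Cmod_triangle.
  + assert (H1 := Cmod_sw2_le al ka ze x' y' Hz).
    assert (H2 : ze ^ 2 * Rabs y' * Cmod al <= (K + 1) * (e / (2 * (K + 1)))).
    { replace (ze ^ 2 * Rabs y' * Cmod al) with (K * Rabs y') by (unfold K; ring).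
      assert (H3 := Rabs_pos y'). apply Rmult_le_compat; lra. }
    assert ((K + 1) * (e / (2 * (K + 1))) = e / 2) by (field; lra).
    lra.
- intros H; destruct (Hbdd H) as [B HB]; exists (B + Cmod al).
  intros x y Hd Hx Hy; specialize (HB x y Hd Hx Hy).
  apply Rle_trans with (Cmod (W x y) + Cmod (sw al ka ze x y)).
  + unfold Cminus; rewrite <- (Cmod_opp (sw al ka ze x y)); apply Cmod_triangle.
  + assert (H1 := Cmod_sw_le al ka ze x y). lra.
Qed.

(** * The asymptotic regime and the constants of the barrier *)

Lemma exp_m2_le : exp (-2) <= 1 / 4.
Proof.
replace (-2) with (-1 + -1) by ring; rewrite exp_plus.
replace (-1) with (- (1)) by ring; rewrite exp_Ropp.
assert (H := exp_ineq1_le 1).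
assert (H1 : / exp 1 <= / 2) by (apply Rinv_le_contravar; lra).
assert (0 < / exp 1) by (apply Rinv_0_lt_compat, exp_pos).
nra.
Qed.

Lemma ln_2_le_1 : ln 2 <= 1.
Proof. assert (H := ln_lt_2). rewrite <- (ln_exp 1); apply ln_monotone; assert (H1 := exp_ineq1_le 1); lra. Qed.

Lemma PI_bounds : 3 < PI <= 4.
Proof. assert (H1 := PI2_3_2); assert (H2 := PI_4); lra. Qed.

(** The asymptotic regime: [L] stands for [ln (1 / eps)] and [d (1 + L)] is the height at
    which the half-plane is truncated. *)
Record regime (eps d k L m : R) : Prop := {
  rg_eps : 0 < eps <= 1 / 100;
  rg_d : 0 < d;
  rg_a : 2 * PI / d * eps <= 1 / 10;
  rg_k : 0 < k;
  rg_k32 : 32 * k <= eps;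
  rg_L : 1 <= L;
  rg_kH : k * (d * (1 + L)) <= 1 / 4;
  rg_m : ln (d / eps) <= m * L;
  rg_Lam : 40 * eps * ((2 * m + 22) * L) <= 1 }.

(** The periodic logarithm falls like [PI y / d]; [Lam0_of] compensates this up to [y = d (1 + L)].
    [Lam_of] is about twice the resulting maximum, which leaves room for the term in [k^2], and
    [Q_of] keeps that term nonnegative on the same range. *)
Definition Lam0_of (eps d L : R) : R := PI * (1 + L) + PI * eps / d + 1.
Definition Lam_of (eps d L : R) : R := 2 * (ln (d / eps) + Lam0_of eps d L + 1).
Definition Q_of (eps d k L : R) : R :=
  Lam0_of eps d L + k ^ 2 * Lam_of eps d L * (d * (1 + L)) ^ 2.

Ltac open_regime RG :=
  pose proof (rg_eps _ _ _ _ _ RG) as Heps; pose proof (rg_d _ _ _ _ _ RG) as Hd;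
  pose proof (rg_a _ _ _ _ _ RG) as Ha; pose proof (rg_k _ _ _ _ _ RG) as Hk;
  pose proof (rg_k32 _ _ _ _ _ RG) as Hk32; pose proof (rg_L _ _ _ _ _ RG) as HL;
  pose proof (rg_kH _ _ _ _ _ RG) as HkH; pose proof (rg_m _ _ _ _ _ RG) as Hm;
  pose proof (rg_Lam _ _ _ _ _ RG) as HLam.

Section Constants.
Context {eps d k L m : R} (RG : regime eps d k L m).
Let H := d * (1 + L).
Let Lam0 := Lam0_of eps d L.
Let Lam := Lam_of eps d L.
Let Q := Q_of eps d k L.

Lemma eps_lt_d : 60 * eps <= d.
Proof.
open_regime RG.
assert (HPI := PI_bounds).
assert (H1 : 2 * PI * eps <= d / 10).
{ replace (2 * PI * eps) with (2 * PI / d * eps * d) by (field; lra).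
  replace (d / 10) with (1 / 10 * d) by field.
  apply Rmult_le_compat_r; lra. }
nra.
Qed.

Lemma ln_d_eps_pos : 0 <= ln (d / eps).
Proof.
open_regime RG.
assert (H0 := eps_lt_d).
rewrite <- ln_1; apply ln_monotone; split; [lra|].
apply Rmult_le_reg_r with eps; [lra|]. unfold Rdiv; rewrite Rmult_assoc, Rinv_l; lra.
Qed.

Lemma Lam_bounds : 2 <= Lam <= (2 * m + 22) * L /\ 0 <= PI * eps / d <= 1 / 20.
Proof.
open_regime RG.
assert (HPI := PI_bounds). assert (H1 := ln_d_eps_pos).
assert (H2 : 0 <= PI * eps / d <= 1 / 20).
{ split; [apply Rdiv_le_0_compat; nra|].
  replace (PI * eps / d) with (2 * PI / d * eps / 2) by (field; lra). lra. }
split; [|assumption]. unfold Lam, Lam_of, Lam0_of.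
assert (0 <= PI * (1 + L) <= 4 * (1 + L)) by (split; nra).
split; [lra|]. lra.
Qed.

Lemma kH_sqr : k ^ 2 * H ^ 2 <= 1 / 16.
Proof.
open_regime RG.
assert (0 <= k * H) by (unfold H; apply Rmult_le_pos; [lra|apply Rmult_le_pos; lra]).
replace (k ^ 2 * H ^ 2) with ((k * H) ^ 2) by ring.
replace (1 / 16) with ((1 / 4) ^ 2) by field. apply pow_incr; split; [assumption|exact HkH].
Qed.

Lemma lg_upper x y : 0 <= y -> lg (2 * PI / d) x (y - - eps) <= ln (d / eps).
Proof.
open_regime RG.
intros Hy; assert (HPI := PI_bounds); assert (H60 := eps_lt_d).
set (a := 2 * PI / d) in *.
assert (Hapos : 0 < a) by (apply Rdiv_lt_0_compat; lra).
assert (Hae : 0 < a * eps) by (apply Rmult_lt_0_compat; lra).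
assert (Hay : 0 <= a * y) by (apply Rmult_le_pos; lra).
unfold lg; replace (a * (y - - eps)) with (a * y + a * eps) by ring.
assert (H1 := cosh_ge_quad (a * y + a * eps)). assert (H2 := COS_bound (a * x)).
set (D := cosh (a * y + a * eps) - cos (a * x)).
assert (H3 : (eps / d) ^ 2 <= D).
{ assert (Hsq : (a * eps) ^ 2 <= (a * y + a * eps) ^ 2) by (apply pow_incr; lra).
  apply Rle_trans with ((a * eps) ^ 2 / 2); [|unfold D; lra].
  replace (a * eps) with (2 * PI * (eps / d)) by (unfold a; field; lra).
  assert (H6 : 0 <= (eps / d) ^ 2) by apply pow2_ge_0.
  assert (H7 : 1 <= 2 * PI ^ 2) by nra.
  replace ((2 * PI * (eps / d)) ^ 2 / 2) with (2 * PI ^ 2 * (eps / d) ^ 2) by (field; lra).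
  assert (1 * (eps / d) ^ 2 <= 2 * PI ^ 2 * (eps / d) ^ 2) by (apply Rmult_le_compat_r; lra).
  lra. }
assert (H4 : 0 < eps / d) by (apply Rdiv_lt_0_compat; lra).
assert (H5 := ln_monotone ((eps / d) ^ 2) D (conj (pow_lt _ 2 H4) H3)).
rewrite ln_pow in H5 by assumption.
replace (d / eps) with (/ (eps / d)) by (field; lra).
rewrite ln_Rinv by assumption. simpl INR in H5. lra.
Qed.

Lemma lg_lower_at x y : 0 <= y ->
  - 1 / 2 - PI * (y + eps) / d <= lg (2 * PI / d) x (y - - eps).
Proof.
open_regime RG.
intros Hy; assert (HPI := PI_bounds).
set (a := 2 * PI / d) in *.
assert (Hapos : 0 < a) by (apply Rdiv_lt_0_compat; lra).
assert (Ht : 0 < a * (y - - eps)) by (apply Rmult_lt_0_compat; lra).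
set (t := a * (y - - eps)) in *.
unfold lg; fold t.
assert (H1 := cosh_gt_cos t (a * x) ltac:(lra)). assert (H2 := COS_bound (a * x)).
assert (H3 := cosh_le_exp t ltac:(lra)). assert (H4 := exp_ineq1_le t).
assert (H5 := ln_monotone (cosh t - cos (a * x)) (2 * exp t) ltac:(lra)).
rewrite ln_mult, ln_exp in H5 by (try apply exp_pos; lra).
assert (H6 := ln_2_le_1).
replace (PI * (y + eps) / d) with (t / 2) by (unfold t, a; field; lra). lra.
Qed.

(** At height [d] the argument of the hyperbolic cosine is at least [6], so the oscillating cosine
    is negligible and only the linear decay remains. *)
Lemma lg_upper_far x : lg (2 * PI / d) x (d - - eps) <= 1 - PI * (d + eps) / d.
Proof.
open_regime RG.
assert (HPI := PI_bounds).
set (a := 2 * PI / d) in *.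
assert (Hapos : 0 < a) by (apply Rdiv_lt_0_compat; lra).
assert (Ht : 6 <= a * (d - - eps)).
{ replace (a * (d - - eps)) with (2 * PI + a * eps) by (unfold a; field; lra).
  assert (0 < a * eps) by (apply Rmult_lt_0_compat; lra). lra. }
set (t := a * (d - - eps)) in *.
unfold lg; fold t.
assert (H2 := COS_bound (a * x)). assert (H4 := exp_ineq1_le t).
assert (H3 : exp (t - 2) <= cosh t - cos (a * x)).
{ replace (t - 2) with (t + -2) by ring; rewrite exp_plus. unfold cosh.
  assert (H5 := exp_m2_le). assert (H6 := exp_pos (- t)).
  assert (exp t * exp (-2) <= exp t * (1 / 4)) by (apply Rmult_le_compat_l; lra).
  lra. }
assert (H5 := ln_monotone (exp (t - 2)) _ (conj (exp_pos _) H3)).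
rewrite ln_exp in H5.
replace (PI * (d + eps) / d) with (t / 2) by (unfold t, a; field; lra). lra.
Qed.

Lemma bracket_expand x y : bracket eps d k Q Lam x y
  = lg (2 * PI / d) (x - eps / 2) (y - - eps) + Lam0 + k ^ 2 * Lam * (H ^ 2 - y ^ 2).
Proof. unfold bracket, Q, Q_of; fold Lam0 Lam H; ring. Qed.

Lemma k2_term y : 0 <= y <= H -> 0 <= k ^ 2 * Lam * (H ^ 2 - y ^ 2) <= Lam / 16.
Proof.
open_regime RG.
intros Hy; assert (H1 := kH_sqr); assert (H2 := Lam_bounds).
assert (0 <= k ^ 2) by apply pow2_ge_0.
assert (0 <= k ^ 2 * Lam) by (apply Rmult_le_pos; lra).
assert (0 <= H ^ 2 - y ^ 2 <= H ^ 2) by (split; nra).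
split; [apply Rmult_le_pos; lra|].
apply Rle_trans with (k ^ 2 * Lam * H ^ 2); [apply Rmult_le_compat_l; lra|].
replace (k ^ 2 * Lam * H ^ 2) with (Lam * (k ^ 2 * H ^ 2)) by ring.
replace (Lam / 16) with (Lam * (1 / 16)) by field.
apply Rmult_le_compat_l; lra.
Qed.

Lemma slot_numbers_intro A : 0 < A -> slot_numbers eps d k H A Q Lam.
Proof.
open_regime RG; intros HA.
assert (HPI := PI_bounds). assert (H60 := eps_lt_d).
destruct Lam_bounds as [H2 H3].
split; try assumption.
- unfold H; nra.
- apply Rle_trans with (2 := HLam).
  apply Rmult_le_compat_l; [lra|apply H2].
- intros x y Hy; rewrite bracket_expand.
  assert (K := k2_term y Hy).
  assert (L1 := lg_lower_at (x - eps / 2) y ltac:(lra)).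
  assert (U1 := lg_upper (x - eps / 2) y ltac:(lra)).
  assert (HyH : PI * (y + eps) / d <= PI * (1 + L) + PI * eps / d).
  { replace (PI * (1 + L) + PI * eps / d) with (PI * (H + eps) / d) by (unfold H; field; lra).
    unfold Rdiv; apply Rmult_le_compat_r; [left; apply Rinv_0_lt_compat; lra|].
    apply Rmult_le_compat_l; lra. }
  split; [unfold Lam0, Lam0_of; lra|].
  assert (E : ln (d / eps) + Lam0 = Lam / 2 - 1) by (unfold Lam, Lam_of, Lam0; field). lra.
Qed.

(** At height [d] the compensation needed for the top exceeds the decay by about [PI L], and the
    term in [k^2] adds at most a sixteenth of [Lam]: the bound is linear in [L], and
    [zero_mode_bound] divides this [L] out. *)
Lemma barP_at_d A x : 0 < A -> barP eps d k A Q Lam x d <= 40 * A * eps * ((m + 8) * L).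
Proof.
open_regime RG; intros HA.
unfold barP; apply Rmult_le_compat_l; [apply Rmult_le_pos; lra|].
rewrite bracket_expand.
assert (HPI := PI_bounds).
assert (K := k2_term d ltac:(unfold H; nra)). assert (U := lg_upper_far (x - eps / 2)).
destruct Lam_bounds as [H2 H3].
unfold Lam0, Lam0_of.
replace (PI * (d + eps) / d) with (PI + PI * eps / d) in U by (field; lra).
assert (Lam / 16 <= (2 * m + 22) * L / 16) by lra.
assert (0 <= m * L) by (assert (T := ln_d_eps_pos); lra).
assert (PI * L <= 4 * L) by (apply Rmult_le_compat_r; lra).
lra.
Qed.

Lemma barP_upper A x y : 0 < A -> 0 <= y <= H ->
  barP eps d k A Q Lam x y <= 40 * A * eps * ((2 * m + 22) * L).
Proof.
open_regime RG.
intros HA Hy; unfold barP; apply Rmult_le_compat_l; [apply Rmult_le_pos; lra|].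
apply Rle_trans with Lam; [|apply Lam_bounds].
left; apply (sn_br _ _ _ _ _ _ _ (slot_numbers_intro A HA)); assumption.
Qed.
End Constants.

(** * Vertical decay of the Rayleigh modes *)

Lemma exp_mult_INR (t : R) (n : nat) : exp (t * INR n) = exp t ^ n.
Proof.
induction n as [|n IH]; [simpl; now rewrite Rmult_0_r, exp_0|].
rewrite S_INR, Rmult_plus_distr_l, Rmult_1_r, exp_plus, IH; simpl; ring.
Qed.

Definition vert (k theta d : R) (n : Z) (y : R) : C :=
  cexp (Ci * zeta_n k theta d n * RtoC y)%C.

Lemma vert_plus k theta d n y y' :
  vert k theta d n (y + y') = (vert k theta d n y * vert k theta d n y')%C.
Proof. unfold vert; rewrite <- cexp_plus; f_equal; rewrite RtoC_plus; ring. Qed.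

Lemma vert_0 k theta d y : 0 < k -> 0 < cos theta ->
  vert k theta d 0 y = expi (zeta k theta * y).
Proof.
intros Hk Hc.
assert (Hs := sin2_cos2 theta); unfold Rsqr in Hs.
assert (Hkap : kappa_n k theta d 0 = k * sin theta) by (unfold kappa_n, kappa, Rdiv; ring).
unfold vert, zeta_n; rewrite Hkap.
destruct (Rlt_dec (Rabs (k * sin theta)) k) as [H|H].
- replace (k ^ 2 - (k * sin theta) ^ 2) with ((k * cos theta) ^ 2) by nra.
  rewrite sqrt_pow2 by (apply Rmult_le_pos; lra).
  rewrite <- Cmult_assoc, <- RtoC_mult, cexp_Ci; reflexivity.
- exfalso; apply H.
  rewrite Rabs_mult, (Rabs_pos_eq k) by lra.
  assert (Rabs (sin theta) < 1) by (apply Rabs_def1; nra). nra.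
Qed.

(** The period is small against the wavelength: [|kappa_n| >= 2 PI |n| / d - k >= 5 |n| / d], while
    [k <= |n| / (4 d)]; hence the rate [4 |n| / d]. *)
Lemma vert_evanescent k theta d n : 0 < k -> 0 < d -> k * d <= 1 / 4 -> n <> 0%Z ->
  exists s, 4 / d * INR (Z.abs_nat n) <= s /\ forall y, vert k theta d n y = RtoC (exp (- (s * y))).
Proof.
intros Hk Hd Hkd Hn.
assert (HPI := PI_bounds).
set (N := INR (Z.abs_nat n)).
assert (HN : 1 <= N).
{ unfold N; replace 1 with (INR 1) by reflexivity; apply le_INR; lia. }
assert (HNn : Rabs (IZR n) = N).
{ unfold N; rewrite INR_IZR_INZ, Zabs2Nat.id_abs, abs_IZR; reflexivity. }
assert (Hka : 5 * N / d <= Rabs (kappa_n k theta d n)).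
{ unfold kappa_n.
  assert (T := Rabs_triang_inv (2 * PI * IZR n / d) (- kappa k theta)).
  replace (2 * PI * IZR n / d - - kappa k theta) with (kappa k theta + 2 * PI * IZR n / d) in T by ring.
  apply Rle_trans with (2 := T).
  assert (T1 : Rabs (- kappa k theta) <= k).
  { rewrite Rabs_Ropp; unfold kappa; rewrite Rabs_mult, (Rabs_pos_eq k) by lra.
    assert (Rabs (sin theta) <= 1) by apply Rabs_le, SIN_bound. nra. }
  assert (T2 : Rabs (2 * PI * IZR n / d) = 2 * PI * N / d).
  { unfold Rdiv; rewrite !Rabs_mult, HNn, (Rabs_pos_eq 2), (Rabs_pos_eq PI), Rabs_pos_eq; try lra.
    left; now apply Rinv_0_lt_compat. }
  rewrite T2.
  assert (k <= N / d).
  { apply Rmult_le_reg_r with d; [assumption|]. unfold Rdiv; rewrite Rmult_assoc, Rinv_l; lra. }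
  assert (6 * N / d <= 2 * PI * N / d).
  { unfold Rdiv; apply Rmult_le_compat_r; [left; now apply Rinv_0_lt_compat|]. nra. }
  unfold Rdiv in *; lra. }
assert (HNd : 0 < N / d) by (apply Rdiv_lt_0_compat; lra).
assert (HkN : k <= 1 / 4 * (N / d)).
{ apply Rmult_le_reg_r with d; [assumption|].
  replace (1 / 4 * (N / d) * d) with (N / 4) by (field; lra). lra. }
assert (Hsq : (4 * (N / d)) ^ 2 <= kappa_n k theta d n ^ 2 - k ^ 2).
{ replace (5 * N / d) with (5 * (N / d)) in Hka by (field; lra).
  assert ((5 * (N / d)) ^ 2 <= kappa_n k theta d n ^ 2).
  { rewrite <- (pow2_abs (kappa_n k theta d n)). apply pow_incr; lra. }
  nra. }
exists (sqrt (kappa_n k theta d n ^ 2 - k ^ 2)); split.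
- replace (4 / d * N) with (4 * (N / d)) by (field; lra).
  rewrite <- (sqrt_pow2 (4 * (N / d))) by lra.
  apply sqrt_le_1_alt; exact Hsq.
- intros y; unfold vert, zeta_n.
  destruct (Rlt_dec (Rabs (kappa_n k theta d n)) k) as [H|H].
  + exfalso. replace (5 * N / d) with (5 * (N / d)) in Hka by (field; lra). lra.
  + set (s := sqrt _).
    replace (Ci * (Ci * RtoC s) * RtoC y)%C with (RtoC (- (s * y))).
    * unfold cexp, RtoC; simpl; now rewrite cos_0, sin_0, Rmult_1_r, Rmult_0_r.
    * unfold Ci, RtoC, Cmult; simpl; f_equal; ring.
Qed.

(** Convergence at height [y / 2] only bounds the terms; the evanescent decay from [y / 2] to [y]
    turns this into a geometric bound. *)
Lemma coef_geometric (cf : Z -> C) k theta d y l : 0 < k -> 0 < cos theta -> 0 < d ->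
  k * d <= 1 / 4 -> 0 < y ->
  is_Zseries (fun n => cf n * expi (kap (kappa k theta) d n * 0) * vert k theta d n (y / 2))%C l ->
  exists b rho, 0 <= rho < 1 /\
    forall n, Cmod (cf n * vert k theta d n y)%C <= b * rho ^ Z.abs_nat n.
Proof.
intros Hk Hc Hd Hkd Hy Hser; destruct (Zseries_bounded _ _ Hser) as [b Hb].
exists b, (exp (- (2 * y / d))); split.
{ split; [left; apply exp_pos|].
  rewrite <- exp_0; apply exp_increasing.
  assert (0 < 2 * y / d) by (apply Rdiv_lt_0_compat; lra). lra. }
intros n; specialize (Hb n).
rewrite !Cmod_mult, Cmod_expi, Rmult_1_r in Hb.
replace y with (y / 2 + y / 2) at 1 by field.
rewrite vert_plus, !Cmod_mult, <- Rmult_assoc.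
assert (Hb0 : 0 <= Cmod (cf n) * Cmod (vert k theta d n (y / 2)))
  by (apply Rmult_le_pos; apply Cmod_ge_0).
apply Rmult_le_compat; [assumption|apply Cmod_ge_0|assumption|].
destruct (Z.eq_dec n 0) as [->|Hn].
- rewrite vert_0, Cmod_expi by assumption; simpl; lra.
- destruct (vert_evanescent k theta d n Hk Hd Hkd Hn) as [s [Hs Hv]].
  rewrite Hv, Cmod_R, Rabs_pos_eq, <- exp_mult_INR by (left; apply exp_pos).
  assert (- (s * (y / 2)) <= - (2 * y / d) * INR (Z.abs_nat n)).
  { replace (- (2 * y / d) * INR (Z.abs_nat n)) with (- (4 / d * INR (Z.abs_nat n) * (y / 2)))
      by (field; lra).
    apply Ropp_le_contravar, Rmult_le_compat_r; lra. }
  destruct (Rle_lt_or_eq_dec _ _ H) as [Hlt|Heq]; [left; now apply exp_increasing|rewrite Heq; lra].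
Qed.

Lemma exp_le (x y : R) : x <= y -> exp x <= exp y.
Proof.
intros H; destruct (Rle_lt_or_eq_dec _ _ H) as [Hlt| ->]; [left; now apply exp_increasing|lra].
Qed.

(** * The field radiated by an aperture into its half-plane *)

Record outgoing_field (eps d k theta L m A1 : R) (W W1 W2 : R -> R -> C) (cf : Z -> C) : Prop := {
  of_regime : regime eps d k L m;
  of_exp : exp (- L) = eps;
  of_cos : 0 < cos theta;
  of_small : 320 * (m + 8) * (eps / (zeta k theta * d)) + 40 * eps * ((2 * m + 22) * L) <= 1 / 2;
  of_A1 : 0 < A1;
  of_base : base_field eps d k (kappa k theta) A1 W W1 W2;
  of_slit : forall x y, rect eps (-1) 0 x y -> Cmod (W x y) <= A1;
  of_out : forall x y, 0 < y ->
     is_Zseries (fun n => cf n * expi (kap (kappa k theta) d n * x) * vert k theta d n y)%C (W x y) }.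

Section Aperture.
Context {eps d k theta L m A1 : R} {W W1 W2 : R -> R -> C} {cf : Z -> C}.
Local Notation ze := (zeta k theta).
Local Notation ka := (kappa k theta).
Local Notation Htop := (d * (1 + L)).
Local Notation Esm := (eps / (zeta k theta * d)).
Context (OF : outgoing_field eps d k theta L m A1 W W1 W2 cf).

Ltac open_field OF :=
  let RG := fresh "RG" in
  pose proof (of_regime _ _ _ _ _ _ _ _ _ _ _ OF) as RG; open_regime RG;
  pose proof (of_exp _ _ _ _ _ _ _ _ _ _ _ OF) as HexpL;
  pose proof (of_cos _ _ _ _ _ _ _ _ _ _ _ OF) as Hcos;
  pose proof (of_small _ _ _ _ _ _ _ _ _ _ _ OF) as Hsmall;
  pose proof (of_A1 _ _ _ _ _ _ _ _ _ _ _ OF) as HA1;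
  pose proof (of_base _ _ _ _ _ _ _ _ _ _ _ OF) as HW;
  pose proof (of_slit _ _ _ _ _ _ _ _ _ _ _ OF) as Hslit;
  pose proof (of_out _ _ _ _ _ _ _ _ _ _ _ OF) as Hout.

Lemma ze_pos : 0 < ze.
Proof. open_field OF; unfold zeta; apply Rmult_lt_0_compat; lra. Qed.

Lemma m_pos : 0 <= m.
Proof.
open_field OF.
assert (H0 := ln_d_eps_pos RG). apply Rnot_lt_le; intros Hlt. nra.
Qed.

Lemma E_pos : 0 < Esm.
Proof. open_field OF; apply Rdiv_lt_0_compat; [lra|apply Rmult_lt_0_compat; [apply ze_pos|lra]]. Qed.

Lemma ze_le_k : ze <= k.
Proof. open_field OF; unfold zeta; assert (H0 := COS_bound theta); nra. Qed.

Lemma kd_small : k * d <= 1 / 4.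
Proof.
open_field OF.
apply Rle_trans with (2 := HkH); apply Rmult_le_compat_l; [lra|]. nra.
Qed.

Lemma ka_ze : ka ^ 2 + ze ^ 2 = k ^ 2.
Proof.
open_field OF.
unfold kappa, zeta; assert (H0 := sin2_cos2 theta); unfold Rsqr in H0.
replace ((k * sin theta) ^ 2 + (k * cos theta) ^ 2)
  with (k ^ 2 * (sin theta * sin theta + cos theta * cos theta)) by ring.
rewrite H0; ring.
Qed.

Lemma series_at (y : R) : 0 < y -> forall x,
  is_Zseries (fun n => (cf n * vert k theta d n y) * expi (kap ka d n * x))%C (W x y).
Proof.
open_field OF.
intros Hy x; destruct (Hout x y Hy) as [l1 [l2 [H1 [H2 H3]]]].
exists l1, l2; split; [|split; [|exact H3]].
- apply is_series_ext with (2 := H1); intros n; cbv beta.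
  match goal with |- @eq _ ?a ?b => change (@eq C a b) end; ring.
- apply is_series_ext with (2 := H2); intros n; cbv beta.
  match goal with |- @eq _ ?a ?b => change (@eq C a b) end; ring.
Qed.

Lemma geometric_at (y : R) : 0 < y -> exists b rho, 0 <= rho < 1 /\
  forall n, Cmod (cf n * vert k theta d n y)%C <= b * rho ^ Z.abs_nat n.
Proof.
open_field OF.
intros Hy; apply (coef_geometric cf k theta d y (W 0 (y / 2))); try assumption.
- apply kd_small.
- apply Hout; lra.
Qed.

(** The coefficients at height [d] are bounded by [S], and from there to [Htop] the mode [n <> 0]
    loses at least [exp (- 4 L |n|) = eps^(4 |n|)]. What is left besides the propagating mode is far
    below [10 S eps]. *)
Lemma top_error (S x : R) : 0 <= S ->
  (forall x, - (d / 2) <= x <= d / 2 -> Cmod (W x d) <= S) ->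
  Cmod (W x Htop - cf 0%Z * expi (ze * Htop) * expi (ka * x))%C <= 10 * S * eps.
Proof.
open_field OF.
intros HS HSd.
assert (HHpos : 0 < Htop) by (apply Rmult_lt_0_compat; lra).
destruct (geometric_at d Hd) as [b [rho [Hrho Hgeo]]].
assert (Hcd : forall n, Cmod (cf n * vert k theta d n d)%C <= S).
{ intros n.
  assert (F := fourier_coef_bound _ _ ka d b rho S n (RtoC 0) Hd Hrho Hgeo (series_at d Hd)).
  cbv beta in F; replace (cf n * vert k theta d n d - RtoC 0)%C with (cf n * vert k theta d n d)%C in F by ring.
  apply F; intros x' Hx'; replace (W x' d - RtoC 0 * expi (kap ka d n * x'))%C with (W x' d) by ring.
  now apply HSd. }
set (q := eps ^ 4).
assert (Hq : 0 <= q <= eps / 100 /\ q <= 1 / 100).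
{ unfold q; assert (0 < eps ^ 2) by (apply pow_lt; lra).
  assert (eps ^ 2 <= eps / 100) by nra.
  split; [split; nra|nra]. }
assert (HcH : forall n, n <> 0%Z -> Cmod (cf n * vert k theta d n Htop)%C <= S * q ^ Z.abs_nat n).
{ intros n Hn.
  replace Htop with (d + d * L) by ring.
  rewrite vert_plus, Cmult_assoc, Cmod_mult.
  destruct (vert_evanescent k theta d n Hk Hd kd_small Hn) as [s [Hs Hv]].
  apply Rmult_le_compat; [apply Cmod_ge_0|apply Cmod_ge_0|apply Hcd|].
  rewrite Hv, Cmod_R, Rabs_pos_eq by (left; apply exp_pos).
  unfold q; rewrite <- HexpL.
  replace (exp (- L) ^ 4) with (exp (- L * INR 4)) by now rewrite exp_mult_INR.
  rewrite <- exp_mult_INR.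
  apply exp_le.
  replace (- L * INR 4 * INR (Z.abs_nat n)) with (- (4 / d * INR (Z.abs_nat n) * (d * L)))
    by (simpl; field; lra).
  apply Ropp_le_contravar, Rmult_le_compat_r; [apply Rmult_le_pos; lra|assumption]. }
assert (F := fourier_zero_mode (fun n => cf n * vert k theta d n Htop)%C (W x Htop) ka d S q x
  ltac:(lra) HS HcH (series_at Htop HHpos x)).
cbv beta in F; rewrite (vert_0 k theta d Htop Hk Hcos) in F.
apply Rle_trans with (1 := F).
apply Rle_trans with (2 * (S * (eps / 100) / (1 / 2))); [|nra].
apply Rmult_le_compat_l; [lra|].
unfold Rdiv at 1 3; apply Rmult_le_compat.
- apply Rmult_le_pos; lra.
- left; apply Rinv_0_lt_compat; lra.
- apply Rmult_le_compat_l; lra.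
- apply Rinv_le_contravar; lra.
Qed.

Lemma zeta_H_small : 0 < ze * Htop <= 1 / 4.
Proof.
open_field OF.
assert (H0 := ze_pos); assert (H1 := ze_le_k).
assert (HHpos : 0 < Htop) by (apply Rmult_lt_0_compat; lra).
split; [now apply Rmult_lt_0_compat|].
apply Rle_trans with (2 := HkH); apply Rmult_le_compat_r; lra.
Qed.

(** The amplitude for which the standing wave equals the propagating mode at [Htop]; the cosine is
    at least [1/2] because [zeta Htop <= 1/4]. *)
Let al := (cf 0%Z * expi (ze * Htop) * RtoC (/ cos (ze * Htop)))%C.

Lemma cos_zH : 1 / 2 <= cos (ze * Htop) <= 1.
Proof.
open_field OF.
assert (H0 := zeta_H_small). split; [apply cos_ge_half; lra|apply COS_bound].
Qed.

Lemma Cmod_al : Cmod al <= 2 * Cmod (cf 0%Z).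
Proof.
open_field OF.
assert (H0 := cos_zH).
unfold al; rewrite !Cmod_mult, Cmod_expi, Rmult_1_r, Cmod_R, Rabs_pos_eq
  by (left; apply Rinv_0_lt_compat; lra).
rewrite Rmult_comm; apply Rmult_le_compat_r; [apply Cmod_ge_0|].
replace 2 with (/ (1 / 2)) by field. apply Rinv_le_contravar; lra.
Qed.

Lemma sw_top x : sw al ka ze x Htop = (cf 0%Z * expi (ze * Htop) * expi (ka * x))%C.
Proof.
open_field OF.
assert (H0 := cos_zH). unfold sw, al.
assert (E1 : (RtoC (cos (ze * Htop)) * RtoC (/ cos (ze * Htop)))%C = RtoC 1).
{ rewrite <- RtoC_mult; f_equal; field; lra. }
replace (RtoC (cos (ze * Htop)) * (cf 0%Z * expi (ze * Htop) * RtoC (/ cos (ze * Htop)) * expi (ka * x)))%C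
  with ((RtoC (cos (ze * Htop)) * RtoC (/ cos (ze * Htop))) * (cf 0%Z * expi (ze * Htop) * expi (ka * x)))%C by ring.
rewrite E1; ring.
Qed.

Section Sup.
Context {S : R} (HS0 : 0 <= S)
  (HS : forall x y, - (d / 2) <= x <= d / 2 -> 0 < y <= Htop -> Cmod (W x y) <= S).
(** Covers at once the field in the slit, the standing wave and the field in the strip below [Htop].
    The last two are unknown and get absorbed in [aperture_bound]. *)
Let A := A1 + 2 * Cmod (cf 0%Z) + S.

Lemma half_field_al : half_field eps d k Htop A (fun x y => (W x y - sw al ka ze x y)%C)
  (fun x y => (W1 x y - sw1 al ka ze x y)%C) (fun x y => (W2 x y - sw2 al ka ze x y)%C).
Proof.
open_field OF.
assert (Hal := Cmod_al). assert (Hc0 := Cmod_ge_0 (cf 0%Z)).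
assert (HHd : d <= Htop) by nra.
destruct (base_field_sw eps d k ka ze A1 al W W1 W2 (Rlt_le _ _ ze_pos) ka_ze (Rlt_le _ _ Hk) HW)
  as [Blap Bcont Bper Bwall Bface Bbdd].
split; try assumption.
- intros x y Hy; rewrite Bper, Cmod_mult, Cmod_expi by assumption; ring.
- intros x y e Hx Hy He; apply near2_impl with (2 := Bwall x y e Hx Hy He).
  intros x' y' Hn Hr; apply Rle_trans with (1 := Hn Hr).
  apply Rplus_le_compat_r, Rmult_le_compat_l; unfold A; lra.
- apply Bbdd.
- intros x y Hr; unfold Cminus.
  apply Rle_trans with (1 := Cmod_triangle _ _); rewrite Cmod_opp.
  assert (T1 := Hslit x y Hr); assert (T2 := Cmod_sw_le al ka ze x y). unfold A; lra.
- intros x Hx; rewrite sw_top.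
  assert (HSA : S <= A) by (unfold A; lra).
  apply Rle_trans with (10 * S * eps).
  + apply top_error; [assumption|]. intros x' Hx'; apply HS; [assumption|lra].
  + apply Rmult_le_compat_r; lra.
Qed.

Lemma A_pos : 0 < A.
Proof. open_field OF; assert (Hc0 := Cmod_ge_0 (cf 0%Z)); unfold A; lra. Qed.

(** The bound of the barrier at height [d] bounds the Fourier coefficient of the propagating mode there. *)
Lemma zero_mode_bound : Cmod (cf 0%Z) <= 80 * (m + 8) * Esm * A.
Proof.
open_field OF.
assert (Hnum := slot_numbers_intro RG A A_pos).
assert (HHd : d <= Htop) by nra.
assert (Hzp := ze_pos). assert (HzH := zeta_H_small). assert (Hcz := cos_zH).
destruct (geometric_at d Hd) as [b [rho [Hrho Hgeo]]].
set (be := (al * RtoC (cos (ze * d)))%C).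
assert (F : Cmod (cf 0%Z * vert k theta d 0 d - be)%C <= 40 * A * eps * ((m + 8) * L)).
{ apply (fourier_coef_bound (fun n => cf n * vert k theta d n d)%C (fun x => W x d) ka d b rho _ 0 be Hd Hrho Hgeo (series_at d Hd)).
  intros x Hx.
  apply Rle_trans with (2 := barP_at_d RG A x A_pos).
  replace (W x d - be * expi (kap ka d 0 * x))%C with (W x d - sw al ka ze x d)%C.
  - apply (half_field_bound Hnum half_field_al); [assumption|lra].
  - unfold sw, be; replace (kap ka d 0 * x) with (ka * x) by (unfold kap, Rdiv; ring); ring. }
rewrite (vert_0 k theta d d Hk Hcos) in F.
(* The mode and the standing wave agree at [Htop]; at height [d] they differ by a sine of
   [zeta (Htop - d) = zeta d L], which makes the coefficient readable there. *)
assert (E1 : (cf 0%Z * expi (ze * d) - be)%C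
   = (cf 0%Z * (RtoC (/ cos (ze * Htop)) * (Ci * RtoC (sin (ze * d - ze * Htop)))))%C).
{ unfold be, al.
  replace (cf 0%Z * expi (ze * d))%C
    with (cf 0%Z * (RtoC (/ cos (ze * Htop)) * (RtoC (cos (ze * Htop)) * expi (ze * d))))%C.
  - replace (cf 0%Z * (RtoC (/ cos (ze * Htop)) * (RtoC (cos (ze * Htop)) * expi (ze * d))) -
       cf 0%Z * expi (ze * Htop) * RtoC (/ cos (ze * Htop)) * RtoC (cos (ze * d)))%C
    with (cf 0%Z * (RtoC (/ cos (ze * Htop)) *
       (RtoC (cos (ze * Htop)) * expi (ze * d) - expi (ze * Htop) * RtoC (cos (ze * d)))))%C by ring.
    do 2 f_equal. unfold expi, RtoC, Ci, Cmult, Cminus, Cplus, Copp; simpl.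
    rewrite sin_minus; f_equal; ring.
  - assert (E2 : (RtoC (/ cos (ze * Htop)) * RtoC (cos (ze * Htop)))%C = RtoC 1).
    { rewrite <- RtoC_mult; f_equal; field; lra. }
    replace (cf 0%Z * (RtoC (/ cos (ze * Htop)) * (RtoC (cos (ze * Htop)) * expi (ze * d))))%C
      with (cf 0%Z * ((RtoC (/ cos (ze * Htop)) * RtoC (cos (ze * Htop))) * expi (ze * d)))%C by ring.
    rewrite E2; ring. }
rewrite E1, !Cmod_mult, !Cmod_R in F.
assert (HCi : Cmod Ci = 1).
{ unfold Cmod; simpl; replace (0 * (0 * 1) + 1 * (1 * 1)) with 1 by ring; now rewrite sqrt_1. }
rewrite HCi, Rmult_1_l in F.
set (t := ze * d * L).
assert (Ht : 0 < t <= 1 / 4).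
{ unfold t; split; [repeat apply Rmult_lt_0_compat; lra|].
  apply Rle_trans with (2 := proj2 HzH).   replace (ze * (d * (1 + L))) with (ze * d * L + ze * d) by ring.
  assert (0 < ze * d) by (apply Rmult_lt_0_compat; lra). lra. }
assert (Hsin : t / 2 <= Rabs (sin (ze * d - ze * Htop))).
{ replace (ze * d - ze * Htop) with (- t) by (unfold t; ring).
  rewrite sin_neg, Rabs_Ropp.
  apply Rle_trans with (2 := Rle_abs _).
  apply Rle_trans with (2 := sin_ge_mult t ltac:(lra)). nra. }
assert (Hinv : 1 <= Rabs (/ cos (ze * Htop))).
{ rewrite Rabs_pos_eq by (left; apply Rinv_0_lt_compat; lra).
  apply Rle_trans with (/ 1); [right; field|apply Rinv_le_contravar; lra]. }
assert (Hc0 := Cmod_ge_0 (cf 0%Z)).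
assert (F2 : Cmod (cf 0%Z) * (1 * (t / 2)) <= 40 * A * eps * ((m + 8) * L)).
{ apply Rle_trans with (2 := F). apply Rmult_le_compat_l; [assumption|].
  apply Rmult_le_compat; lra. }
(* The [L] of the barrier cancels against the [L] in [t], so the bound carries no logarithm. *)
apply Rmult_le_reg_r with (t / 2); [lra|].
replace (80 * (m + 8) * Esm * A * (t / 2)) with (40 * A * eps * ((m + 8) * L)); [lra|].
unfold t; field; split; lra.
Qed.

Lemma upper_bound x y : - (d / 2) <= x <= d / 2 -> 0 < y <= Htop ->
  Cmod (W x y) <= A * (160 * (m + 8) * Esm + 40 * eps * ((2 * m + 22) * L)).
Proof.
open_field OF.
intros Hx Hy.
assert (Hnum := slot_numbers_intro RG A A_pos).
assert (T1 := half_field_bound Hnum half_field_al x y Hx Hy).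
assert (T2 := barP_upper RG A x y A_pos ltac:(lra)).
assert (T3 := zero_mode_bound). assert (T4 := Cmod_al). assert (T5 := Cmod_sw_le al ka ze x y).
replace (W x y) with ((W x y - sw al ka ze x y) + sw al ka ze x y)%C by ring.
apply Rle_trans with (1 := Cmod_triangle _ _). lra.
Qed.

Lemma aperture_bound_aux x : 0 < x < eps ->
  Cmod (W x 0) <= A * (160 * (m + 8) * Esm + 40 * eps * ((2 * m + 22) * L)).
Proof.
open_field OF.
intros Hx.
assert (Hnum := slot_numbers_intro RG A A_pos).
assert (T1 := half_field_aperture Hnum half_field_al x Hx).
assert (HHpos : 0 < Htop) by (apply Rmult_lt_0_compat; lra).
assert (T2 := barP_upper RG A 0 0 A_pos (conj (Rle_refl 0) (Rlt_le _ _ HHpos))).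
assert (T3 := zero_mode_bound). assert (T4 := Cmod_al). assert (T5 := Cmod_sw_le al ka ze x 0).
replace (W x 0) with ((W x 0 - sw al ka ze x 0) + sw al ka ze x 0)%C by ring.
apply Rle_trans with (1 := Cmod_triangle _ _). lra.
Qed.
End Sup.

(** With [S] the least bound in the strip, [cf 0] and [S] are small multiples of [A]; [of_small]
    turns this into [A <= A1 + A / 2], hence [A <= 2 * A1]. *)
Lemma aperture_bound x : 0 < x < eps ->
  Cmod (W x 0) <= 2 * A1 * (160 * (m + 8) * Esm + 40 * eps * ((2 * m + 22) * L)).
Proof.
open_field OF.
intros Hx.
assert (HHpos : 0 < Htop) by (apply Rmult_lt_0_compat; lra).
assert (Hth : 0 <= 40 * eps * ((2 * m + 22) * L)).
{ assert (T := m_pos). apply Rmult_le_pos; [lra|apply Rmult_le_pos; lra]. }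
assert (HmE : 0 <= (m + 8) * Esm).
{ assert (T1 := m_pos); assert (T2 := E_pos). apply Rmult_le_pos; lra. }
destruct (bf_bdd _ _ _ _ _ _ _ _ HW Htop) as [B HB].
destruct (completeness (fun t => exists x y, - (d / 2) <= x <= d / 2 /\ 0 < y <= Htop /\ t = Cmod (W x y)))
  as [S [Sub Slub]].
{ exists B; intros t [x' [y' [Hx' [Hy' ->]]]]; apply HB; [left|assumption|]; lra. }
{ exists (Cmod (W 0 Htop)), 0, Htop; split; [lra|split; [lra|reflexivity]]. }
assert (HS : forall x y, - (d / 2) <= x <= d / 2 -> 0 < y <= Htop -> Cmod (W x y) <= S).
{ intros x' y' Hx' Hy'; apply Sub; exists x', y'; split; [assumption|split; [assumption|reflexivity]]. }
assert (HS0 : 0 <= S).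
{ apply Rle_trans with (2 := HS 0 Htop ltac:(lra) ltac:(lra)); apply Cmod_ge_0. }
set (th := 160 * (m + 8) * Esm + 40 * eps * ((2 * m + 22) * L)).
set (A := A1 + 2 * Cmod (cf 0%Z) + S).
assert (HA0 : 0 < A) by (assert (T := Cmod_ge_0 (cf 0%Z)); unfold A; lra).
assert (HSle : S <= A * th).
{ apply Slub; intros t [x' [y' [Hx' [Hy' ->]]]]; exact (upper_bound HS0 HS x' y' Hx' Hy'). }
assert (Hc := zero_mode_bound HS0 HS). fold A in Hc.
assert (HA2 : A <= 2 * A1).
{ assert (A <= A1 + A * (320 * (m + 8) * Esm + 40 * eps * ((2 * m + 22) * L))).
  { unfold A at 1; unfold th in HSle. lra. }
  assert (A * (320 * (m + 8) * Esm + 40 * eps * ((2 * m + 22) * L)) <= A * (1 / 2))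
    by (apply Rmult_le_compat_l; lra).
  lra. }
apply Rle_trans with (1 := aperture_bound_aux HS0 HS x Hx).
fold A; fold th. apply Rmult_le_compat_r; [unfold th; lra|assumption].
Qed.
End Aperture.

(** * From the scattering problem to half-plane fields *)

Lemma is_derive_fst (f : R -> C) (t : R) (l : C) :
  is_derive f t l -> is_derive (fun s => fst (f s)) t (fst l).
Proof.
intros Hf.
apply (filterdiff_comp' f (fun z : C => fst z) t (fun y => scal y l) (fun z : C => fst z)) in Hf.
- apply filterdiff_ext_lin with (1 := Hf); intros y; reflexivity.
- apply filterdiff_linear, is_linear_fst.
Qed.

Lemma is_derive_snd (f : R -> C) (t : R) (l : C) :
  is_derive f t l -> is_derive (fun s => snd (f s)) t (snd l).
Proof.
intros Hf.
apply (filterdiff_comp' f (fun z : C => snd z) t (fun y => scal y l) (fun z : C => snd z)) in Hf.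
- apply filterdiff_ext_lin with (1 := Hf); intros y; reflexivity.
- apply filterdiff_linear, is_linear_snd.
Qed.

Lemma is_derive_pr (c s t : R) (f : R -> C) :
  ex_derive f t -> is_derive (fun x => pr c s (f x)) t (pr c s (CDerive f t)).
Proof.
intros [l Hl].
apply is_derive_lin.
- apply Derive_correct; exists (fst l); now apply is_derive_fst.
- apply Derive_correct; exists (snd l); now apply is_derive_snd.
Qed.

Lemma Cmod_le_abs (z : C) : Cmod z <= Rabs (fst z) + Rabs (snd z).
Proof.
apply Cmod_le_of_pr; intros c s Hcs.
assert (Hc : Rabs c <= 1) by (apply Rabs_le; nra).
assert (Hs : Rabs s <= 1) by (apply Rabs_le; nra).
apply Rle_trans with (1 := Rle_abs _); unfold pr.
apply Rle_trans with (1 := Rabs_triang _ _); rewrite !Rabs_mult.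
assert (H1 := Rabs_pos (fst z)); assert (H2 := Rabs_pos (snd z)). nra.
Qed.

Lemma filterlim_within_near2 (D : R * R -> Prop) (f : R * R -> C) (p : R * R) (l : C) :
  filterlim f (within D (locally p)) (locally l) ->
  forall e, 0 < e -> near2 (fun x y => D (x, y) -> Cmod (f (x, y) - l)%C <= e) (fst p) (snd p).
Proof.
intros Hf e He.
assert (He2 : 0 < e / 2) by lra.
destruct (Hf _ (locally_ball l (mkposreal _ He2))) as [del Hdel].
exists del; split; [apply cond_pos|]; intros x y Hx Hy HD.
destruct (Hdel (x, y)) as [H1 H2]; [split; assumption|assumption|].
apply Rle_trans with (1 := Cmod_le_abs _).
change (Rabs (fst (f (x, y)) - fst l) < e / 2) in H1.
change (Rabs (snd (f (x, y)) - snd l) < e / 2) in H2.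
simpl. unfold Rminus in *. lra.
Qed.

Section Solution.
Context {eps d k theta : R} {u : R * R -> C}.
Context (Heps : 0 < eps) (Hepsd : 2 * eps < d) (Sol : scattering_solution eps d k theta u).

Lemma Omega_slit x y : 0 < x < eps -> 0 <= y <= 1 -> Omega eps d (x, y).
Proof. intros Hx Hy; right; right; exists 0%Z; simpl; lra. Qed.

Lemma sol_near (p : R * R) (e : R) : 0 < e ->
  near2 (fun x y => Omega eps d (x, y) -> Cmod (u (x, y) - u p)%C <= e) (fst p) (snd p).
Proof. intros He; apply filterlim_within_near2; [apply (sol_cont _ _ _ _ _ Sol)|assumption]. Qed.

(** With [sg = 1], [y0 = 1] this is the field above the middle of the slab, and with
    [sg = - 1], [y0 = 0] the field below, seen upside down. *)
Definition folded (f : R * R -> C) (y0 sg x y : R) : C := f (x, y0 + sg * y).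

Lemma dom_Omega y0 sg x y : (y0 = 1 /\ sg = 1) \/ (y0 = 0 /\ sg = -1) ->
  dom eps x y -> Omega eps d (x, y0 + sg * y).
Proof.
intros [[-> ->]|[-> ->]] [Hy|[Hx Hy]].
- left; simpl; lra.
- apply Omega_slit; [assumption|lra].
- right; left; simpl; lra.
- apply Omega_slit; [assumption|lra].
Qed.

Lemma sg_sqr y0 sg : (y0 = 1 /\ sg = 1) \/ (y0 = 0 /\ sg = -1) -> sg * sg = 1 /\ Rabs sg = 1.
Proof.
intros [[_ ->]|[_ ->]]; (split; [ring|]); [apply Rabs_pos_eq; lra|].
rewrite Rabs_left; lra.
Qed.

Lemma lap_sol c s : exists v11 v22 : R -> R -> R, forall x y, Omega eps d (x, y) ->
    is_derive (fun t => pr c s (u (t, y))) x (pr c s (Defs.d1 u (x, y))) /\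
    is_derive (fun t => pr c s (u (x, t))) y (pr c s (Defs.d2 u (x, y))) /\
    is_derive (fun t => pr c s (Defs.d1 u (t, y))) x (v11 x y) /\
    is_derive (fun t => pr c s (Defs.d2 u (x, t))) y (v22 x y) /\
    v11 x y + v22 x y = - k ^ 2 * pr c s (u (x, y)).
Proof.
exists (fun x y => pr c s (Defs.d1 (Defs.d1 u) (x, y))), (fun x y => pr c s (Defs.d2 (Defs.d2 u) (x, y))).
intros x y Hxy.
destruct (sol_C2 _ _ _ _ _ Sol) as [C0 [C1 C2]].
destruct (C0 (x, y) Hxy) as [A1 [A2 _]]; destruct (C1 (x, y) Hxy) as [A3 _].
destruct (C2 (x, y) Hxy) as [_ [A4 _]]; simpl in *.
split; [|split; [|split; [|split]]].
- exact (is_derive_pr c s x (fun t => u (t, y)) A1).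
- exact (is_derive_pr c s y (fun t => u (x, t)) A2).
- exact (is_derive_pr c s x (fun t => Defs.d1 u (t, y)) A3).
- exact (is_derive_pr c s y (fun t => Defs.d2 u (x, t)) A4).
- assert (H := sol_helmholtz _ _ _ _ _ Sol (x, y) Hxy).
  assert (H' : pr c s (Defs.d1 (Defs.d1 u) (x, y) + Defs.d2 (Defs.d2 u) (x, y) + RtoC (k ^ 2) * u (x, y))%C = 0)
    by (rewrite H; unfold pr; simpl; ring).
  unfold pr in *; simpl in *; lra.
Qed.

(** The wall constant is [0]: before any subtraction the solution itself satisfies the Neumann
    condition. *)
Lemma base_field_folded y0 sg : (y0 = 1 /\ sg = 1) \/ (y0 = 0 /\ sg = -1) ->
  base_field eps d k (kappa k theta) 0 (folded u y0 sg) (folded (Defs.d1 u) y0 sg)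
    (fun x y => (RtoC sg * folded (Defs.d2 u) y0 sg x y)%C).
Proof.
intros Hsg; destruct (sg_sqr y0 sg Hsg) as [Hs1 Hs2].
assert (HO := fun x y => dom_Omega y0 sg x y Hsg).
assert (Hfold : forall y y', y0 + sg * y' - (y0 + sg * y) = sg * (y' - y)) by (intros; ring).
assert (Hnear : forall P x y, near2 P x (y0 + sg * y) -> near2 (fun x' y' => P x' (y0 + sg * y')) x y).
{ intros P x y [del [Hdel HP]]; exists del; split; [assumption|]; intros x' y' Hx' Hy'.
  apply HP; [assumption|]. rewrite Hfold, Rabs_mult, Hs2; lra. }
split.
- intros c s; destruct (lap_sol c s) as [v11 [v22 Hv]].
  exists (fun x y => v11 x (y0 + sg * y)), (fun x y => v22 x (y0 + sg * y)).
  intros x y Hd; destruct (Hv x (y0 + sg * y) (HO x y Hd)) as [A1 [A2 [A3 [A4 A5]]]].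
  split; [exact A1|split; [|split; [exact A3|split; [|exact A5]]]].
  + rewrite pr_scal.
    apply (is_derive_comp (fun t => pr c s (u (x, t))) (fun t => y0 + sg * t)); [exact A2|].
    auto_derive; [exact I|ring].
  + apply is_derive_ext with (fun t => sg * pr c s (Defs.d2 u (x, y0 + sg * t))).
    { intros t; now rewrite pr_scal. }
    replace (v22 x (y0 + sg * y)) with (sg * (sg * v22 x (y0 + sg * y)))
      by (rewrite <- Rmult_assoc, Hs1; ring).
    apply is_derive_scal.
    apply (is_derive_comp (fun t => pr c s (Defs.d2 u (x, t))) (fun t => y0 + sg * t)); [exact A4|].
    auto_derive; [exact I|ring].
- intros c s x y Hd e.
  set (B := Rabs c + Rabs s + 1).
  assert (HB : 0 < B) by (unfold B; assert (H1 := Rabs_pos c); assert (H2 := Rabs_pos s); lra).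
  destruct (near2_and _ _ _ _ (dom_open x y Hd)
    (Hnear _ _ _ (sol_near (x, y0 + sg * y) (e / (2 * B)) ltac:(apply Rdiv_lt_0_compat; [apply cond_pos|lra]))))
    as [del [Hdel Hn]].
  exists (mkposreal del Hdel); intros x' y' Hx' Hy'.
  destruct (Hn x' y' Hx' Hy') as [Hd' Hn']. specialize (Hn' (HO _ _ Hd')).
  unfold folded.
  set (z := (u (x', (y0 + sg * y')%R) - u (x, (y0 + sg * y)%R))%C) in *.
  replace (pr c s (u (x', y0 + sg * y')) - pr c s (u (x, y0 + sg * y))) with (pr c s z)
    by (unfold z, pr; simpl; ring).
  apply Rle_lt_trans with (B * (e / (2 * B))).
  + assert (F1 := pr_le_Cmod 1 0 z ltac:(ring)); assert (F2 := pr_le_Cmod (-1) 0 z ltac:(ring)).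
    assert (F3 := pr_le_Cmod 0 1 z ltac:(ring)); assert (F4 := pr_le_Cmod 0 (-1) z ltac:(ring)).
    assert (G1 : Rabs (fst z) <= Cmod z) by (apply Rabs_le; unfold pr in *; lra).
    assert (G2 : Rabs (snd z) <= Cmod z) by (apply Rabs_le; unfold pr in *; lra).
    unfold pr at 1; apply Rle_trans with (1 := Rabs_triang _ _); rewrite !Rabs_mult.
    apply Rle_trans with ((Rabs c + Rabs s) * Cmod z).
    * assert (H1 := Rabs_pos c); assert (H2 := Rabs_pos s). nra.
    * assert (H1 := Rabs_pos c); assert (H2 := Rabs_pos s).
      apply Rmult_le_compat; [lra|apply Cmod_ge_0|unfold B; lra|exact Hn'].
  + assert (He := cond_pos e).
    replace (B * (e / (2 * B))) with (e / 2) by (field; lra). lra.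
- intros x y Hy; unfold folded.
  rewrite <- cexp_Ci.
  apply (sol_quasiperiodic _ _ _ _ _ Sol (x, y0 + sg * y)), HO; now left.
- intros x y e Hx Hy He.
  assert (Hw : slit_wall eps d (x, y0 + sg * y)).
  { split; [simpl; destruct Hsg as [[-> ->]|[-> ->]]; lra|].
    exists 0%Z; simpl; lra. }
  assert (Hn := filterlim_within_near2 _ _ _ _ (sol_neumann_wall _ _ _ _ _ Sol _ Hw) e He).
  simpl fst in Hn; simpl snd in Hn.
  apply near2_impl with (2 := Hnear _ _ _ Hn); intros x' y' H [Hx' Hy'].
  unfold folded; rewrite Rmult_0_r, Rplus_0_l.
  replace (Defs.d1 u (x', (y0 + sg * y')%R)) with (Defs.d1 u (x', (y0 + sg * y')%R) - RtoC 0)%C by ring.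
  apply H, HO; right; lra.
- intros x e Hx Hout He.
  assert (Hf : slab_face eps d (x, y0)).
  { split; [simpl; destruct Hsg as [[-> _]|[-> _]]; lra|].
    (* For [|x| <= d / 2] and [2 eps < d] the slits other than the one at the origin are out of
       reach. *)
    simpl; intros n Hn.
    destruct (Z.eq_dec n 0) as [->|Hn0]; [apply Hout; lra|].
    destruct (Z_le_dec 1 n) as [H1|H1].
    - apply IZR_le in H1. nra.
    - assert (H2 : (n <= -1)%Z) by lia. apply IZR_le in H2. nra. }
  assert (Hn := filterlim_within_near2 _ _ _ _ (sol_neumann_face _ _ _ _ _ Sol _ Hf) e He).
  simpl fst in Hn; simpl snd in Hn.
  replace y0 with (y0 + sg * 0) in Hn at 1 by ring.
  apply near2_impl with (2 := Hnear _ _ _ Hn); intros x' y' H Hy'.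
  unfold folded; rewrite Cmod_mult, Cmod_R, Hs2, Rmult_1_l.
  replace (Defs.d2 u (x', (y0 + sg * y')%R)) with (Defs.d2 u (x', (y0 + sg * y')%R) - RtoC 0)%C by ring.
  apply H, HO; now left.
- intros H.
  destruct (locally_bounded_bounded
    (fun x y => dom eps x y /\ - (d / 2) <= x <= d / 2 /\ y <= H)
    (fun x y => Cmod (folded u y0 sg x y)) (d + Rabs H + 1)) as [B HB].
  + intros x y [Hd [Hx Hy]]; assert (Hl := dom_low x y Hd); assert (H1 := Rle_abs H).
    assert (H2 := Rabs_pos H).
    split; apply Rabs_le; lra.
  + intros x y; destruct (Hnear _ _ _ (sol_near (x, y0 + sg * y) 1 Rlt_0_1)) as [del [Hdel Hn]].
    exists del, (Cmod (u (x, y0 + sg * y)) + 1); split; [assumption|].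
    intros x' y' [Hd _] Hx' Hy'.
    specialize (Hn x' y' Hx' Hy' (HO _ _ Hd)); unfold folded.
    replace (u (x', y0 + sg * y'))
      with (u (x, (y0 + sg * y)%R) + (u (x', (y0 + sg * y')%R) - u (x, (y0 + sg * y)%R)))%C by ring.
    apply Rle_trans with (1 := Cmod_triangle _ _). lra.
  + exists B; intros x y Hd Hx Hy; apply (HB x y); split; [assumption|split; assumption].
Qed.

(** The zero mode is the first term of the series over nonnegative indices, so only that series
    changes. *)
Lemma Zseries_shift_zero (a t : Z -> C) (l : C) :
  is_Zseries (fun n => a n * t n)%C l ->
  is_Zseries (fun n => (if Z.eq_dec n 0 then a n - RtoC 1 else a n) * t n)%C (l - t 0%Z)%C.
Proof.
intros [l1 [l2 [H1 [H2 ->]]]]; exists (l1 - t 0%Z)%C, l2; split; [|split; [|ring]].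
- apply is_series_decr_1; apply is_series_ext with (fun m => (a (Z.of_nat (S m)) * t (Z.of_nat (S m)))%C).
  { intros m; destruct (Z.eq_dec (Z.of_nat (S m)) 0); [lia|reflexivity]. }
  simpl Z.of_nat at 3; simpl Z.of_nat at 3.
  apply (is_series_incr_1 (fun m => (a (Z.of_nat m) * t (Z.of_nat m))%C)).
  match goal with |- is_series _ ?x => replace x with l1; [exact H1|] end.
  destruct (Z.eq_dec (Z.of_nat 0) 0); [|lia]. unfold plus, opp; simpl. ring.
- apply is_series_ext with (2 := H2).
  intros m; destruct (Z.eq_dec (- Z.of_nat (S m)) 0); [lia|reflexivity].
Qed.

Lemma Zseries_ext (a b : Z -> C) (l : C) : (forall n, a n = b n) -> is_Zseries a l -> is_Zseries b l.
Proof.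
intros Hab [l1 [l2 [H1 [H2 H3]]]]; exists l1, l2; split; [|split; [|exact H3]].
- apply is_series_ext with (2 := H1); intros m; apply Hab.
- apply is_series_ext with (2 := H2); intros m; apply Hab.
Qed.

Lemma rayleigh_split s n x y y' : s * y' = y ->
  rayleigh_mode s k theta d n (x, y') = (expi (kap (kappa k theta) d n * x) * vert k theta d n y)%C.
Proof.
intros <-; unfold rayleigh_mode, vert; simpl fst; simpl snd.
rewrite cexp_plus, cexp_Ci; do 2 f_equal.
rewrite RtoC_mult; ring.
Qed.

(** The reflected plane wave has been moved to the left-hand side. *)
Lemma top_outgoing : 0 < k -> 0 < cos theta -> exists cf : Z -> C, forall x y, 0 < y ->
  is_Zseries (fun n => cf n * expi (kap (kappa k theta) d n * x) * vert k theta d n y)%C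
    (folded u 1 1 x y - sw (RtoC 2) (kappa k theta) (zeta k theta) x y)%C.
Proof.
intros Hk Hc; destruct (sol_outgoing_up _ _ _ _ _ Sol) as [a Ha].
exists (fun n => if Z.eq_dec n 0 then (a n * vert k theta d n 1 - RtoC 1)%C
        else (a n * vert k theta d n 1)%C).
intros x y Hy.
assert (H := Ha (x, 1 + 1 * y) ltac:(simpl; lra)).
apply (Zseries_ext _ (fun n => a n * vert k theta d n 1 *
   (expi (kap (kappa k theta) d n * x) * vert k theta d n y))%C) in H.
- apply Zseries_shift_zero in H.
  match goal with H : is_Zseries _ ?b |- is_Zseries _ ?c => replace c with b end.
  + apply Zseries_ext with (2 := H); intros n; destruct (Z.eq_dec n 0); ring.
  + rewrite (vert_0 k theta d y Hk Hc).
    replace (kap (kappa k theta) d 0 * x) with (kappa k theta * x) by (unfold kap, Rdiv; ring).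
    unfold incident, folded, sw; rewrite cexp_Ci; simpl fst; simpl snd.
    replace (kappa k theta * x - zeta k theta * (1 + 1 * y - 1))
      with (kappa k theta * x + - (zeta k theta * y)) by ring.
    rewrite expi_plus.
    replace (RtoC (cos (zeta k theta * y)) * (RtoC 2 * expi (kappa k theta * x)))%C
      with (expi (kappa k theta * x) * (expi (- (zeta k theta * y)) + expi (zeta k theta * y)))%C.
    * ring.
    * unfold expi at 2 3; rewrite cos_neg, sin_neg; unfold Cplus, Cmult, RtoC; simpl; f_equal; ring.
- intros n; rewrite (rayleigh_split 1 n x (1 + y) (1 + 1 * y)) by ring.
  rewrite vert_plus; ring.
Qed.

Lemma bottom_outgoing : exists cf : Z -> C, forall x y, 0 < y ->
  is_Zseries (fun n => cf n * expi (kap (kappa k theta) d n * x) * vert k theta d n y)%C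
    (folded u 0 (-1) x y).
Proof.
destruct (sol_outgoing_down _ _ _ _ _ Sol) as [a Ha]; exists a; intros x y Hy.
apply Zseries_ext with (2 := Ha (x, 0 + -1 * y) ltac:(simpl; lra)).
intros n; rewrite (rayleigh_split (-1) n x y (0 + -1 * y)) by ring. ring.
Qed.
End Solution.

(** * Estimates in the slit *)

Lemma base_field_mono eps d k ka A A' W W1 W2 : 0 <= k -> A <= A' ->
  base_field eps d k ka A W W1 W2 -> base_field eps d k ka A' W W1 W2.
Proof.
intros Hk HA [H1 H2 H3 H4 H5 H6]; split; try assumption.
intros x y e Hx Hy He; apply near2_impl with (2 := H4 x y e Hx Hy He).
intros x' y' H Hr; apply Rle_trans with (1 := H Hr).
apply Rplus_le_compat_r, Rmult_le_compat_l; assumption.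
Qed.

Lemma Cmod_expi_minus_1 (t : R) : Cmod (expi t - RtoC 1)%C <= Rabs t.
Proof.
assert (H := Cmod_sqr (expi t - RtoC 1)%C); simpl in H.
assert (H1 := cos_ge_quad t); assert (H2 := sin2_cos2 t); unfold Rsqr in H2.
apply Rsqr_incr_0_var; [|apply Rabs_pos].
rewrite <- Rsqr_abs, !Rsqr_pow2. simpl. nra.
Qed.

Section Estimate.
Context {eps d k theta L m : R} {u : R * R -> C}.
(** Up to a factor two, the size of the radiated field at an aperture relative to a bound in the
    slit: the first term comes from the propagating mode, the second from the barrier. *)
Let th := 160 * (m + 8) * (eps / (zeta k theta * d)) + 40 * eps * ((2 * m + 22) * L).
Context (RG : regime eps d k L m) (HexpL : exp (- L) = eps) (Hcos : 0 < cos theta)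
  (Hth : th <= 1 / 8) (Sol : scattering_solution eps d k theta u).

Lemma eps_pos : 0 < eps.
Proof. apply (rg_eps _ _ _ _ _ RG). Qed.

Lemma two_eps_lt_d : 2 * eps < d.
Proof. assert (H := eps_lt_d RG); assert (H0 := eps_pos); lra. Qed.

Lemma m_nonneg : 0 <= m.
Proof.
assert (H0 := ln_d_eps_pos RG); assert (H1 := rg_L _ _ _ _ _ RG); assert (H2 := rg_m _ _ _ _ _ RG).
apply Rnot_lt_le; intros Hlt. nra.
Qed.

Lemma th_parts : 0 <= (m + 8) * (eps / (zeta k theta * d)) /\ 0 <= eps * ((2 * m + 22) * L).
Proof.
assert (H0 := m_nonneg). assert (H1 := eps_pos). open_regime RG.
assert (0 < zeta k theta) by (unfold zeta; apply Rmult_lt_0_compat; lra).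
split.
- apply Rmult_le_pos; [lra|]. left; apply Rdiv_lt_0_compat; [lra|apply Rmult_lt_0_compat; lra].
- apply Rmult_le_pos; [lra|apply Rmult_le_pos; lra].
Qed.

Lemma small_of_th : 320 * (m + 8) * (eps / (zeta k theta * d)) + 40 * eps * ((2 * m + 22) * L) <= 1 / 2.
Proof. assert (H := th_parts); unfold th in Hth; lra. Qed.

Section Bounded.
Context {S : R} (HS0 : 0 <= S) (HS : forall x y, rect eps 0 1 x y -> Cmod (u (x, y)) <= S).

(** The standing wave formed by the incident and reflected waves has amplitude [2]; [S + 2] thus
    bounds the difference in the slit, and [k (S + 2)] its slope at the walls. *)
Lemma top_aperture x : 0 < x < eps ->
  Cmod (u (x, 1) - RtoC 2 * expi (kappa k theta * x))%C <= 2 * (S + 2) * th.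
Proof.
intros Hx; assert (Hk := rg_k _ _ _ _ _ RG).
destruct (top_outgoing Sol Hk Hcos) as [cf Hcf].
assert (Hb := base_field_folded eps_pos two_eps_lt_d Sol 1 1 (or_introl (conj eq_refl eq_refl))).
assert (Hz : 0 < zeta k theta) by (unfold zeta; apply Rmult_lt_0_compat; lra).
apply (base_field_sw eps d k (kappa k theta) (zeta k theta) 0 (RtoC 2)) in Hb; try lra.
2:{ unfold kappa, zeta; assert (H0 := sin2_cos2 theta); unfold Rsqr in H0.
    replace ((k * sin theta) ^ 2 + (k * cos theta) ^ 2)
      with (k ^ 2 * (sin theta * sin theta + cos theta * cos theta)) by ring.
    rewrite H0; ring. }
assert (H2 : Cmod (RtoC 2) = 2) by (rewrite Cmod_R; apply Rabs_pos_eq; lra).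
rewrite H2 in Hb.
apply base_field_mono with (A' := S + 2) in Hb; try lra.
assert (HS2 : 0 < S + 2) by lra.
assert (Hsl : forall x y, rect eps (-1) 0 x y ->
  Cmod (folded u 1 1 x y - sw (RtoC 2) (kappa k theta) (zeta k theta) x y)%C <= S + 2).
{ intros x' y' [Hx' Hy']; unfold Cminus.
  apply Rle_trans with (1 := Cmod_triangle _ _); rewrite Cmod_opp.
  apply Rplus_le_compat.
  - unfold folded; apply HS; split; lra.
  - apply Rle_trans with (1 := Cmod_sw_le _ _ _ _ _); lra. }
assert (OF := Build_outgoing_field eps d k theta L m (S + 2) _ _ _ cf RG HexpL Hcos small_of_th
  HS2 Hb Hsl Hcf).
assert (H := aperture_bound OF x Hx); cbv beta in H.
unfold folded, sw in H.
rewrite !Rmult_0_r, Rplus_0_r, cos_0 in H.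
replace (u (x, 1) - RtoC 2 * expi (kappa k theta * x))%C
  with (u (x, 1) - RtoC 1 * (RtoC 2 * expi (kappa k theta * x)))%C by ring.
exact H.
Qed.

Lemma bottom_aperture x : 0 < x < eps -> Cmod (u (x, 0)) <= 2 * (S + 2) * th.
Proof.
intros Hx; assert (Hk := rg_k _ _ _ _ _ RG).
destruct (bottom_outgoing Sol) as [cf Hcf].
assert (Hb := base_field_folded eps_pos two_eps_lt_d Sol 0 (-1) (or_intror (conj eq_refl eq_refl))).
apply base_field_mono with (A' := S + 2) in Hb; try lra.
assert (HS2 : 0 < S + 2) by lra.
assert (Hsl : forall x y, rect eps (-1) 0 x y -> Cmod (folded u 0 (-1) x y) <= S + 2).
{ intros x' y' [Hx' Hy']; apply Rle_trans with S; [|lra].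
  unfold folded; apply HS; split; lra. }
assert (OF := Build_outgoing_field eps d k theta L m (S + 2) _ _ _ cf RG HexpL Hcos small_of_th
  HS2 Hb Hsl Hcf).
assert (H := aperture_bound OF x Hx); cbv beta in H.
unfold folded in H. rewrite Rmult_0_r, Rplus_0_r in H. exact H.
Qed.

(** The term [2 * k * eps] is the price of replacing the phase [expi (kappa x)] by [1] over the
    width of the aperture. *)
Let B := 2 * (S + 2) * th + 2 * k * eps.

(** Carries a bound on an open aperture to its corners by continuity, as the comparison in the slit
    needs it on closed ends. *)
Lemma aperture_closed (y0 : R) (z : C) (b : R) : 0 <= y0 <= 1 ->
  (forall x, 0 < x < eps -> Cmod (u (x, y0) - z)%C <= b) ->
  forall x, 0 <= x <= eps -> Cmod (u (x, y0) - z)%C <= b.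
Proof.
intros Hy0 Hb x Hx; assert (He := eps_pos).
apply Rnot_lt_le; intros Hlt.
set (e := (Cmod (u (x, y0) - z)%C - b) / 2). assert (He' : 0 < e) by (unfold e; lra).
destruct (sol_near Sol (x, y0) e He') as [del [Hdel Hn]]; simpl fst in Hn; simpl snd in Hn.
assert (Hx' : exists x', 0 < x' < eps /\ Rabs (x' - x) < del).
{ set (r := Rmin del eps / 4).
  assert (Hr : 0 < r /\ 4 * r <= del /\ 4 * r <= eps).
  { assert (A1 := Rmin_l del eps); assert (A2 := Rmin_r del eps).
    assert (0 < Rmin del eps) by (apply Rmin_pos; lra). unfold r; lra. }
  destruct (Rle_lt_dec x (eps / 2)).
  - exists (x + r); split; [lra|apply Rabs_def1; lra].
  - exists (x - r); split; [lra|apply Rabs_def1; lra]. }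
destruct Hx' as [x' [Hx' Hd']].
specialize (Hn x' y0 Hd' ltac:(rewrite Rminus_diag, Rabs_R0; lra) (Omega_slit x' y0 Hx' Hy0)).
specialize (Hb x' Hx').
assert (H : Cmod (u (x, y0) - z)%C <= Cmod (u (x', y0) - z)%C + Cmod (u (x', y0) - u (x, y0))%C).
{ rewrite <- (Cmod_opp (u (x', y0) - u (x, y0))).
  replace (u (x, y0) - z)%C with ((u (x', y0) - z) + - (u (x', y0) - u (x, y0)))%C by ring.
  apply Cmod_triangle. }
unfold e in *; lra.
Qed.

Lemma ends_bound x y : 0 <= x <= eps -> y = 0 \/ y = 1 ->
  Cmod (u (x, y) - RtoC (2 * y))%C <= B.
Proof.
intros Hx Hy; assert (He := eps_pos); assert (Hk := rg_k _ _ _ _ _ RG).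
assert (Hke : 0 <= k * eps) by (apply Rmult_le_pos; lra).
apply aperture_closed; [lra| |assumption].
clear x Hx; intros x Hx; destruct Hy as [-> | ->].
- replace (u (x, 0) - RtoC (2 * 0))%C with (u (x, 0)) by (rewrite Rmult_0_r; ring).
  apply Rle_trans with (1 := bottom_aperture x Hx); unfold B; lra.
- replace (u (x, 1) - RtoC (2 * 1))%C with
    ((u (x, 1) - RtoC 2 * expi (kappa k theta * x)) + RtoC 2 * (expi (kappa k theta * x) - RtoC 1))%C
    by (rewrite Rmult_1_r; ring).
  apply Rle_trans with (1 := Cmod_triangle _ _).
  rewrite Cmod_mult, Cmod_R, (Rabs_pos_eq 2) by lra.
  assert (H1 := top_aperture x Hx). assert (H2 := Cmod_expi_minus_1 (kappa k theta * x)).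
  assert (H3 : Rabs (kappa k theta * x) <= k * eps).
  { unfold kappa; rewrite !Rabs_mult, (Rabs_pos_eq k), (Rabs_pos_eq x) by lra.
    assert (H4 : Rabs (sin theta) <= 1) by apply Rabs_le, SIN_bound.
    assert (H5 := Rabs_pos (sin theta)).
    apply Rmult_le_compat; [apply Rmult_le_pos; lra|lra| |lra]. nra. }
  unfold B; lra.
Qed.

(** The slit part of the folded field is the slit moved down by one; [S + 1] keeps the bound on the
    source positive even for [S = 0]. *)
Lemma slit_neumann_field c s : c ^ 2 + s ^ 2 = 1 ->
  neumann_field eps 0 1 (k ^ 2 * (S + 1)) (fun x y => pr c s (u (x, y)))
    (fun x y => pr c s (Defs.d1 u (x, y))) (fun x y => pr c s (Defs.d2 u (x, y))).
Proof.
intros Hcs; assert (He := eps_pos); assert (Hk := rg_k _ _ _ _ _ RG).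
assert (Hb := base_field_folded eps_pos two_eps_lt_d Sol 1 1 (or_introl (conj eq_refl eq_refl))).
assert (HO : forall x y, rect eps 0 1 x y -> Omega eps d (x, y))
  by (intros x y [H1 H2]; apply Omega_slit; lra).
assert (Hone : forall y, 1 + 1 * (y - 1) = y) by (intros; ring).
split.
- exists (fun x y => - k ^ 2 * pr c s (u (x, y))); split.
  + destruct (lap_sol Sol c s) as [v11 [v22 Hv]]; exists v11, v22; intros x y Hr; apply Hv, HO, Hr.
  + intros x y Hr.
    replace (- k ^ 2 * pr c s (u (x, y))) with (- (k ^ 2 * pr c s (u (x, y)))) by ring.
    rewrite Rabs_Ropp, Rabs_mult, (Rabs_pos_eq (k ^ 2)) by apply pow2_ge_0.
    apply Rmult_le_compat_l; [apply pow2_ge_0|].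
    apply Rle_trans with (1 := Rabs_pr_le c s _ Hcs). specialize (HS x y Hr); lra.
- intros x y [Hx Hy] e.
  destruct (bf_cont _ _ _ _ _ _ _ _ Hb c s x (y - 1) ltac:(right; lra) e) as [del Hdel].
  exists del; intros x' y' Hx' Hy'.
  specialize (Hdel x' (y' - 1) Hx').
  unfold folded in Hdel; rewrite !Hone in Hdel; apply Hdel.
  replace (y' - 1 - (y - 1)) with (y' - y) by ring; exact Hy'.
- intros x y e Hx Hy He'.
  destruct (bf_wall _ _ _ _ _ _ _ _ Hb x (y - 1) e Hx ltac:(lra) He') as [del [Hdel Hn]].
  exists del; split; [assumption|]; intros x' y' Hx' Hy' [Hr1 Hr2].
  specialize (Hn x' (y' - 1) Hx').
  unfold folded in Hn; rewrite !Hone in Hn.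
  apply Rle_trans with (1 := Rabs_pr_le c s _ Hcs).
  rewrite Rmult_0_r, Rplus_0_l in Hn; apply Hn; [|split; lra].
  replace (y' - 1 - (y - 1)) with (y' - y) by ring; exact Hy'.
- intros x y e Hx Hy He'; exists (pr c s (u (x, y))).
  apply near2_impl with (2 := sol_near Sol (x, y) e He').
  intros x' y' H Hr; specialize (H (HO x' y' Hr)).
  replace (pr c s (u (x', y')) - pr c s (u (x, y))) with (pr c s (u (x', y') - u (x, y))%C)
    by (unfold pr; simpl; ring).
  apply Rle_trans with (1 := Rabs_pr_le c s _ Hcs); exact H.
Qed.

(** [2 y] is harmonic and fits both ends up to [B]; the source is paid for by the parabola
    [g y (1 - y)], which vanishes at the ends. *)
Lemma slit_value x y : rect eps 0 1 x y ->
  Cmod (u (x, y) - RtoC (2 * y))%C <= B + k ^ 2 * (S + 1).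
Proof.
intros Hr; apply Cmod_le_of_pr; intros c s Hcs.
assert (Hk2 : 0 < k ^ 2 * (S + 1)).
{ assert (Hk := rg_k _ _ _ _ _ RG). apply Rmult_lt_0_compat; [apply pow_lt; lra|lra]. }
set (g := k ^ 2 * (S + 1)) in *.
assert (Hnf := neumann_field_affine _ _ _ _ _ _ _ 0 (2 * c) (slit_neumann_field c s Hcs)).
assert (Hpr : forall x y, pr c s (u (x, y) - RtoC (2 * y))%C = pr c s (u (x, y)) - (0 + 2 * c * y))
  by (intros; unfold pr; simpl; ring).
rewrite Hpr.
apply Rle_trans with (B + g * y - g * y ^ 2).
- apply (neumann_field_max eps 0 1 g B g g _ _ _ Hnf ltac:(lra)); [| |exact Hr].
  + exists (S + 2); intros x' y' Hr'; rewrite <- Hpr.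
    apply Rle_trans with (1 := pr_le_Cmod c s _ Hcs); unfold Cminus.
    apply Rle_trans with (1 := Cmod_triangle _ _); rewrite Cmod_opp.
    apply Rplus_le_compat; [now apply HS|].
    destruct Hr' as [_ Hy']; rewrite Cmod_R, Rabs_pos_eq; lra.
  + intros x' y' e Hx' Hy' He'.
    assert (Hend := ends_bound x' y' Hx' Hy').
    destruct (sol_near Sol (x', y') (e / 2) ltac:(lra)) as [del [Hdel Hn]].
    simpl fst in Hn; simpl snd in Hn.
    exists (Rmin del (e / 4)); split; [apply Rmin_pos; lra|].
    intros x2 y2 Hx2 Hy2 Hr2.
    assert (A1 := Rmin_l del (e / 4)); assert (A2 := Rmin_r del (e / 4)).
    specialize (Hn x2 y2 ltac:(lra) ltac:(lra)
      (Omega_slit x2 y2 (proj1 Hr2) ltac:(destruct Hr2; lra))).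
    rewrite <- Hpr; apply Rle_trans with (1 := pr_le_Cmod c s _ Hcs).
    replace (u (x2, y2) - RtoC (2 * y2))%C with
      ((u (x', y') - RtoC (2 * y')) + ((u (x2, y2) - u (x', y')) + RtoC (2 * (y' - y2))))%C.
    2:{ rewrite !RtoC_mult, RtoC_minus; ring. }
    apply Rle_trans with (1 := Cmod_triangle _ _).
    assert (T := Cmod_triangle (u (x2, y2) - u (x', y')) (RtoC (2 * (y' - y2)))).
    assert (T2 : Cmod (RtoC (2 * (y' - y2))) <= e / 2).
    { rewrite Cmod_R, Rabs_mult, (Rabs_pos_eq 2) by lra. rewrite Rabs_minus_sym; lra. }
    assert (0 <= g * y2 - g * y2 ^ 2).
    { destruct Hr2 as [_ Hr2]; replace (g * y2 - g * y2 ^ 2) with (g * (y2 * (1 - y2))) by ring.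
      apply Rmult_le_pos; [lra|apply Rmult_le_pos; lra]. }
    lra.
- destruct Hr as [_ Hy].
  assert (g * (y - y ^ 2) <= g * 1) by (apply Rmult_le_compat_l; nra). lra.
Qed.
End Bounded.

(** The supremum [S], finite by continuity up to the boundary, obeys an inequality in which
    [th <= 1/8] and the smallness of [k] let it be absorbed. *)
Lemma slit_bounded x y : rect eps 0 1 x y -> Cmod (u (x, y)) <= 4.
Proof.
assert (He := eps_pos); open_regime RG.
destruct (locally_bounded_bounded (rect eps 0 1) (fun x y => Cmod (u (x, y))) (eps + 1)) as [N HN].
{ intros x' y' [Hx' Hy']; split; apply Rabs_le; lra. }
{ intros x' y'; destruct (sol_near Sol (x', y') 1 Rlt_0_1) as [del [Hdel Hn]].
  simpl fst in Hn; simpl snd in Hn.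
  exists del, (Cmod (u (x', y')) + 1); split; [assumption|].
  intros x2 y2 [Hr1 Hr2] Hx2 Hy2.
  specialize (Hn x2 y2 Hx2 Hy2 (Omega_slit x2 y2 Hr1 ltac:(lra))).
  replace (u (x2, y2)) with (u (x', y') + (u (x2, y2) - u (x', y')))%C by ring.
  apply Rle_trans with (1 := Cmod_triangle _ _). lra. }
destruct (completeness (fun t => exists x y, rect eps 0 1 x y /\ t = Cmod (u (x, y)))) as [S [Sub Slub]].
{ exists N; intros t [x' [y' [Hr ->]]]; now apply HN. }
{ exists (Cmod (u (eps / 2, 1 / 2))), (eps / 2), (1 / 2); split; [split; lra|reflexivity]. }
assert (HS : forall x y, rect eps 0 1 x y -> Cmod (u (x, y)) <= S).
{ intros x' y' Hr; apply Sub; exists x', y'; split; [assumption|reflexivity]. }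
assert (HS0 : 0 <= S).
{ apply Rle_trans with (2 := HS (eps / 2) (1 / 2) ltac:(split; lra)); apply Cmod_ge_0. }
assert (HS4 : S <= 2 + (2 * (S + 2) * th + 2 * k * eps + k ^ 2 * (S + 1))).
{ apply Slub; intros t [x' [y' [Hr ->]]].
  assert (H := slit_value HS0 HS x' y' Hr).
  replace (u (x', y')) with (RtoC (2 * y') + (u (x', y') - RtoC (2 * y')))%C by ring.
  apply Rle_trans with (1 := Cmod_triangle _ _).
  destruct Hr as [_ Hy']; rewrite Cmod_R, Rabs_pos_eq by lra. lra. }
assert (H1 : 2 * (S + 2) * th <= 2 * (S + 2) * (1 / 8)) by (apply Rmult_le_compat_l; lra).
assert (H2 : k ^ 2 <= 1 / 100) by nra.
assert (H3 : k ^ 2 * (S + 1) <= 1 / 100 * (S + 1)) by (apply Rmult_le_compat_r; lra).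
assert (H4 : k * eps <= 1 / 100) by nra.
intros Hr; apply Rle_trans with (1 := HS x y Hr). lra.
Qed.

Let T := 12 * th + 2 * k * eps + 5 * k ^ 2.

Lemma slit_value_estimate x y : rect eps 0 1 x y -> Cmod (u (x, y) - RtoC (2 * y))%C <= T.
Proof.
intros Hr.
assert (H4 : 0 <= 4) by lra.
assert (H := slit_value H4 slit_bounded x y Hr). unfold T; lra.
Qed.

Lemma slit_derivative_estimate x y : 0 < x < eps -> 4 * (eps * L) <= y <= 1 - 4 * (eps * L) ->
  Cmod (Defs.d2 u (x, y) - RtoC 2)%C <= 4 * T + k.
Proof.
intros Hx Hy; apply Cmod_le_of_pr; intros c s Hcs.
assert (Hm0 := m_nonneg). open_regime RG.
assert (HT : 0 <= T).
{ apply Rle_trans with (1 := Cmod_ge_0 _) (2 := slit_value_estimate (eps / 2) (1 / 2) ltac:(split; lra)). }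
assert (H4 : 0 <= 4) by lra.
assert (HeL : 0 < eps * L) by (apply Rmult_lt_0_compat; lra).
assert (HeL2 : eps * L <= 1 / 880).
{ assert (0 <= m * (eps * L)) by (apply Rmult_le_pos; lra).
  replace (40 * eps * ((2 * m + 22) * L)) with (80 * (m * (eps * L)) + 880 * (eps * L)) in HLam by ring.
  lra. }
assert (Hnf := neumann_field_affine _ _ _ _ _ _ _ 0 (2 * c) (slit_neumann_field slit_bounded c s Hcs)).
assert (Hc0 : 0 < k ^ 2 * (4 + 1)) by (apply Rmult_lt_0_compat; [apply pow_lt; lra|lra]).
assert (HB : forall x y, rect eps 0 1 x y -> Rabs (pr c s (u (x, y)) - (0 + 2 * c * y)) <= T).
{ intros x' y' Hr'.
  replace (pr c s (u (x', y')) - (0 + 2 * c * y')) with (pr c s (u (x', y') - RtoC (2 * y'))%C)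
    by (unfold pr; simpl; ring).
  apply Rle_trans with (1 := Rabs_pr_le c s _ Hcs). now apply slit_value_estimate. }
(* With [la = 2 eps L] the factor [exp (- la / eps)] is [eps^2], which outweighs the division by
   [la]; the range of [y] starts at [2 la]. The source, of order [k^2], stays below [k] after this
   division because [32 k <= eps]. *)
assert (H := slit_gradient eps _ T (2 * (eps * L)) _ _ _ (proj1 Heps) Hc0
  ltac:(lra) Hnf HB x y Hx ltac:(lra)).
replace (pr c s (Defs.d2 u (x, y) - RtoC 2)%C) with (pr c s (Defs.d2 u (x, y)) - 2 * c) by (unfold pr; simpl; ring).
apply Rle_trans with (1 := Rle_abs _), Rle_trans with (1 := H).
replace (exp (- (2 * (eps * L) / eps))) with (eps ^ 2).
2:{ replace (- (2 * (eps * L) / eps)) with (- L * INR 2) by (simpl; field; lra).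
    now rewrite exp_mult_INR, HexpL. }
set (g := k ^ 2 * (4 + 1)) in *.
assert (Hinv : / (2 * (eps * L)) <= / (2 * eps)).
{ apply Rinv_le_contravar; nra. }
assert (Hnum : 0 <= 16 * T * eps ^ 2 + 4 * g * eps ^ 2 + g).
{ assert (0 <= eps ^ 2) by apply pow2_ge_0.
  assert (0 <= T * eps ^ 2) by (apply Rmult_le_pos; lra).
  assert (0 <= g * eps ^ 2) by (apply Rmult_le_pos; lra). lra. }
assert (E1 : (16 * T * eps ^ 2 + 4 * g * eps ^ 2 + g) / (2 * (eps * L))
   <= 8 * T * eps + 2 * g * eps + g / (2 * eps)).
{ apply Rle_trans with ((16 * T * eps ^ 2 + 4 * g * eps ^ 2 + g) * / (2 * eps)).
  - apply Rmult_le_compat_l; assumption.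
  - right; field; lra. }
assert (E2 : g / (2 * eps) <= k / 8).
{ apply Rmult_le_reg_r with (2 * eps); [lra|].
  replace (g / (2 * eps) * (2 * eps)) with g by (field; lra).
  unfold g; nra. }
assert (E3 : g <= k / 100) by (unfold g; nra).
assert (E4 : g * (2 * (eps * L)) <= g * 1) by (apply Rmult_le_compat_l; lra).
assert (E5 : 8 * T * eps <= T) by nra.
assert (E6 : 2 * g * eps <= g) by nra.
lra.
Qed.

Lemma quasiperiodic_shift (n : Z) (x y : R) : Omega eps d (x, y) ->
  u (x + IZR n * d, y) = (expi (kappa k theta * (IZR n * d)) * u (x, y))%C.
Proof.
assert (Hinv : forall x y (n : Z), Omega eps d (x, y) -> Omega eps d (x + IZR n * d, y)).
{ intros x' y' n' [H|[H|[j [H1 H2]]]]; [now left|right; now left|right; right].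
  exists (j + n')%Z; simpl in *; rewrite plus_IZR; split; [lra|assumption]. }
assert (Hnat : forall (j : nat) x y, Omega eps d (x, y) ->
  u (x + INR j * d, y) = (expi (kappa k theta * (INR j * d)) * u (x, y))%C).
{ induction j as [|j IH]; intros x' y' HO.
  - simpl; rewrite Rmult_0_l, Rmult_0_r, Rplus_0_r.
    replace (expi 0) with (RtoC 1) by (unfold expi; now rewrite cos_0, sin_0). ring.
  - rewrite S_INR.
    replace (x' + (INR j + 1) * d) with ((x' + INR j * d) + d) by ring.
    assert (HO' : Omega eps d (x' + INR j * d, y')) by (rewrite INR_IZR_INZ; now apply Hinv).
    assert (Hq := sol_quasiperiodic _ _ _ _ _ Sol (x' + INR j * d, y') HO').
    simpl fst in Hq; simpl snd in Hq; rewrite Hq, cexp_Ci, IH by assumption.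
    replace (kappa k theta * ((INR j + 1) * d))
      with (kappa k theta * d + kappa k theta * (INR j * d)) by ring.
    rewrite expi_plus; ring. }
intros HO; destruct (Z_le_dec 0 n) as [Hn|Hn].
- rewrite <- (Z2Nat.id n Hn), <- INR_IZR_INZ; now apply Hnat.
- assert (HO' := Hinv x y n HO).
  assert (H := Hnat (Z.to_nat (- n)) _ _ HO').
  rewrite INR_IZR_INZ, Z2Nat.id, opp_IZR in H by lia.
  replace (x + IZR n * d + - IZR n * d) with x in H by ring.
  rewrite H, Cmult_assoc, <- expi_plus.
  replace (kappa k theta * (IZR n * d) + kappa k theta * (- IZR n * d)) with 0 by ring.
  replace (expi 0) with (RtoC 1) by (unfold expi; now rewrite cos_0, sin_0). ring.
Qed.

Lemma CDerive_mult (z : C) (f : R -> C) (t : R) : ex_derive f t ->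
  CDerive (fun s => z * f s)%C t = (z * CDerive f t)%C.
Proof.
intros Hf.
assert (H1 := is_derive_pr (fst z) (- snd z) t f Hf).
assert (H2 := is_derive_pr (snd z) (fst z) t f Hf).
unfold CDerive at 1; apply injective_projections; simpl.
- transitivity (pr (fst z) (- snd z) (CDerive f t)); [|unfold pr, CDerive, Re, Im; simpl; ring].
  apply is_derive_unique; apply is_derive_ext with (2 := H1).
  intros s; unfold pr, Re; simpl; ring.
- transitivity (pr (snd z) (fst z) (CDerive f t)); [|unfold pr, CDerive, Re, Im; simpl; ring].
  apply is_derive_unique; apply is_derive_ext with (2 := H2).
  intros s; unfold pr, Im; simpl; ring.
Qed.

Lemma d2_shift (n : Z) (x y : R) : 0 < x < eps -> 0 < y < 1 ->
  Defs.d2 u (x + IZR n * d, y) = (expi (kappa k theta * (IZR n * d)) * Defs.d2 u (x, y))%C.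
Proof.
intros Hx Hy.
destruct (sol_C2 _ _ _ _ _ Sol) as [C0 _].
destruct (C0 (x, y) (Omega_slit x y Hx ltac:(lra))) as [_ [A2 _]]; simpl in A2.
unfold Defs.d2; simpl fst; simpl snd.
rewrite <- CDerive_mult by exact A2.
unfold CDerive; f_equal; apply Derive_ext_loc.
- exists (mkposreal (Rmin y (1 - y)) ltac:(apply Rmin_pos; lra)); intros t Ht.
  rewrite quasiperiodic_shift; [reflexivity|apply Omega_slit; [assumption|]].
  assert (A3 := Rmin_l y (1 - y)); assert (A4 := Rmin_r y (1 - y)).
  apply Rabs_def2 in Ht; simpl in Ht; unfold minus, plus, opp in Ht; simpl in Ht; lra.
- exists (mkposreal (Rmin y (1 - y)) ltac:(apply Rmin_pos; lra)); intros t Ht.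
  rewrite quasiperiodic_shift; [reflexivity|apply Omega_slit; [assumption|]].
  assert (A3 := Rmin_l y (1 - y)); assert (A4 := Rmin_r y (1 - y)).
  apply Rabs_def2 in Ht; simpl in Ht; unfold minus, plus, opp in Ht; simpl in Ht; lra.
Qed.
End Estimate.

(** * Orders of magnitude as [eps] tends to zero *)

(** For [eps = exp (- L)]: a positive power of [eps] absorbs one logarithm, with an explicit
    constant. *)
Lemma exp_neg_mult_le (a L : R) : 0 < a -> 0 <= L -> exp (- (a * L)) * L <= / a.
Proof.
intros Ha HL.
assert (H1 := exp_ineq1_le (a * L)); assert (H2 := exp_pos (a * L)).
rewrite exp_Ropp.
apply Rmult_le_reg_l with (a * exp (a * L)); [now apply Rmult_lt_0_compat|].
replace (a * exp (a * L) * (/ exp (a * L) * L)) with (a * L) by (field; lra).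
replace (a * exp (a * L) * / a) with (exp (a * L)) by (field; lra). lra.
Qed.

Lemma Rpower_exp_L (eps a : R) : 0 < eps -> Rpower eps a = exp (- (a * ln (/ eps))).
Proof. intros He; unfold Rpower; rewrite ln_Rinv by assumption; f_equal; ring. Qed.

Lemma Rpower_small (a c : R) : 0 < a -> 0 <= c ->
  exists e0, 0 < e0 /\ forall eps, 0 < eps < e0 -> c * Rpower eps a <= 1.
Proof.
intros Ha Hc; exists (Rpower (/ (c + 1)) (/ a)); split; [apply exp_pos|].
intros eps [H0 H1].
assert (Hinv : 0 < / (c + 1)) by (apply Rinv_0_lt_compat; lra).
assert (H2 : Rpower eps a <= / (c + 1)).
{ replace (/ (c + 1)) with (Rpower (Rpower (/ (c + 1)) (/ a)) a)
    by (rewrite Rpower_mult, Rinv_l, Rpower_1 by lra; reflexivity).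
  left; apply Rlt_Rpower_l; [assumption|split; assumption]. }
assert (H3 := exp_pos (a * ln eps)); fold (Rpower eps a) in H3.
apply Rle_trans with ((c + 1) * / (c + 1)); [|right; field; lra].
apply Rmult_le_compat; lra.
Qed.

Section Asymptotics.
Context {sigma delta theta0 c1 c2 : R} (Hsigma : 1 < sigma) (Hdelta : 0 < delta < 1)
  (Htheta0 : 0 < theta0 < PI / 2) (Hc1 : 0 < c1) (Hc2 : 0 < c2).
(** From [d / eps <= c2 eps^(- sigma - delta)] one gets [ln (d / eps) <= ln c2 + (sigma + delta) L
    <= m L] once [L >= 1]. *)
Let m := Rabs (ln c2) + sigma + delta.
Let Cth := 160 * (m + 8) / (c1 * cos theta0) + 40 * (2 * m + 22) / (1 - delta).

Lemma cos_theta0_pos : 0 < cos theta0.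
Proof. apply cos_gt_0; lra. Qed.

Lemma m_ge_0 : 0 <= m.
Proof. assert (H := Rabs_pos (ln c2)); unfold m; lra. Qed.

Lemma Cth_pos : 0 <= Cth.
Proof.
assert (H := m_ge_0); assert (H1 := cos_theta0_pos).
unfold Cth; apply Rplus_le_le_0_compat; apply Rdiv_le_0_compat; try lra.
now apply Rmult_lt_0_compat.
Qed.

(** The decisive ratios are [k / eps = eps^(sigma - 1)], [k d L] of order [eps^(1 - delta) L], and
    [th] of order [eps^delta]; all tend to zero, uniformly in [d] and [theta]. *)
Lemma regime_eventually : exists eps0, 0 < eps0 < 1 /\ forall eps d k theta,
  0 < eps < eps0 ->
  c1 * Rpower eps (1 - sigma - delta) <= d <= c2 * Rpower eps (1 - sigma - delta) ->
  k = Rpower eps sigma -> Rabs theta < theta0 ->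
  let L := ln (/ eps) in
  let th := 160 * (m + 8) * (eps / (zeta k theta * d)) + 40 * eps * ((2 * m + 22) * L) in
  regime eps d k L m /\ exp (- L) = eps /\ 0 < cos theta /\ th <= 1 / 8 /\
  th <= Cth * Rpower eps delta /\ k <= eps /\ eps <= Rpower eps delta.
Proof.
assert (Hm0 := m_ge_0); assert (Hcos0 := cos_theta0_pos); assert (HCth := Cth_pos).
destruct (Rpower_small (sigma - 1) 32) as [e1 [He1 E1]]; [lra|lra|].
assert (Hq : 0 <= 16 * c2 / (1 - delta)) by (apply Rdiv_le_0_compat; lra).
destruct (Rpower_small ((1 - delta) / 2) (16 * c2 / (1 - delta))) as [e2 [He2 E2]];
  [lra|assumption|].
destruct (Rpower_small delta (8 * Cth)) as [e3 [He3 E3]]; [lra|lra|].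
(* The threshold [c1 / 80] gives [eps / d <= 1/80], hence [2 PI eps / d <= 1/10]. *)
set (e0 := Rmin (Rmin (1 / 100) (c1 / 80)) (Rmin e1 (Rmin e2 e3))).
assert (Hle : 0 < e0 /\ e0 <= 1 / 100 /\ e0 <= c1 / 80 /\ e0 <= e1 /\ e0 <= e2 /\ e0 <= e3).
{ assert (A1 := Rmin_l (Rmin (1 / 100) (c1 / 80)) (Rmin e1 (Rmin e2 e3))).
  assert (A2 := Rmin_r (Rmin (1 / 100) (c1 / 80)) (Rmin e1 (Rmin e2 e3))).
  assert (A3 := Rmin_l (1 / 100) (c1 / 80)); assert (A4 := Rmin_r (1 / 100) (c1 / 80)).
  assert (A5 := Rmin_l e1 (Rmin e2 e3)); assert (A6 := Rmin_r e1 (Rmin e2 e3)).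
  assert (A7 := Rmin_l e2 e3); assert (A8 := Rmin_r e2 e3).
  assert (0 < e0) by (repeat apply Rmin_pos; lra). unfold e0 in *; lra. }
clearbody e0; exists e0; split; [lra|].
intros eps d k theta Heps Hd Hk Htheta L th.
specialize (E1 eps ltac:(lra)); specialize (E2 eps ltac:(lra)); specialize (E3 eps ltac:(lra)).
assert (HexpL : exp (- L) = eps).
{ unfold L; rewrite ln_Rinv, Ropp_involutive, exp_ln by lra; reflexivity. }
assert (HL : 1 <= L).
{ apply Rnot_lt_le; intros Hlt.
  assert (H1 : exp (- (1)) < exp (- L)) by (apply exp_increasing; lra).
  rewrite HexpL, exp_Ropp in H1. assert (H2 := exp_le_3).
  assert (/ 3 <= / exp 1) by (apply Rinv_le_contravar; [apply exp_pos|assumption]). lra. }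
assert (HP : forall a, Rpower eps a = exp (- (a * L))) by (intros; apply Rpower_exp_L; lra).
assert (Hmul : forall a b, Rpower eps a * Rpower eps b = Rpower eps (a + b))
  by (intros; symmetry; apply Rpower_plus).
assert (H1p : Rpower eps 1 = eps) by (apply Rpower_1; lra).
assert (Hpos : forall a, 0 < Rpower eps a) by (intros; apply exp_pos).
assert (Hmon : forall a b, a <= b -> Rpower eps b <= Rpower eps a).
{ intros a b Hab; rewrite !HP; apply exp_le; nra. }
assert (Hdpos : 0 < d).
{ apply Rlt_le_trans with (2 := proj1 Hd); apply Rmult_lt_0_compat; [assumption|apply Hpos]. }
assert (Hepsd : eps / d <= eps / c1).
{ apply Rmult_le_compat_l; [lra|]; apply Rinv_le_contravar; [assumption|].
  apply Rle_trans with (2 := proj1 Hd).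
  assert (H1 : Rpower eps 0 <= Rpower eps (1 - sigma - delta)) by (apply Hmon; lra).
  rewrite Rpower_O in H1 by lra.
  apply Rle_trans with (c1 * 1); [lra|apply Rmult_le_compat_l; lra]. }
assert (Hkpos : 0 < k) by (rewrite Hk; apply Hpos).
assert (Hk32 : 32 * k <= eps).
{ rewrite Hk. replace sigma with ((sigma - 1) + 1) by ring.
  rewrite <- Hmul, H1p.
  apply Rle_trans with (32 * Rpower eps (sigma - 1) * eps); [right; ring|].
  apply Rle_trans with (1 * eps); [apply Rmult_le_compat_r; lra|lra]. }
assert (Hkd : c1 * Rpower eps (1 - delta) <= k * d <= c2 * Rpower eps (1 - delta)).
{ replace (1 - delta) with (sigma + (1 - sigma - delta)) by ring.
  rewrite <- Hmul, <- Hk.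
  split.
  - apply Rle_trans with (k * (c1 * Rpower eps (1 - sigma - delta))); [right; ring|].
    apply Rmult_le_compat_l; lra.
  - apply Rle_trans with (k * (c2 * Rpower eps (1 - sigma - delta))); [|right; ring].
    apply Rmult_le_compat_l; lra. }
assert (Hcos : cos theta0 <= cos theta).
{ destruct (Rle_lt_dec 0 theta).
  - rewrite Rabs_pos_eq in Htheta by assumption. apply cos_decr_1; lra.
  - rewrite Rabs_left in Htheta by assumption. rewrite <- (cos_neg theta). apply cos_decr_1; lra. }
(* In [eps = eps^delta eps^(1 - delta)] the second factor absorbs [L]. *)
assert (HepsL : eps * L <= Rpower eps delta * / (1 - delta)).
{ replace eps with (Rpower eps delta * Rpower eps (1 - delta)) at 1.
  - rewrite Rmult_assoc; apply Rmult_le_compat_l; [left; apply Hpos|].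
    rewrite HP; apply exp_neg_mult_le; lra.
  - rewrite Hmul; replace (delta + (1 - delta)) with 1 by ring; exact H1p. }
(* The origin of the rate [eps^delta]: [zeta d] is of order [eps^(1 - delta)], and [zeta] is
   comparable to [k] because [|theta|] stays below [theta0 < PI / 2]. *)
assert (Hfrac : eps / (zeta k theta * d) <= Rpower eps delta / (c1 * cos theta0)).
{ assert (Hz : c1 * cos theta0 * Rpower eps (1 - delta) <= zeta k theta * d).
  { unfold zeta; replace (k * cos theta * d) with (k * d * cos theta) by ring.
    replace (c1 * cos theta0 * Rpower eps (1 - delta)) with (c1 * Rpower eps (1 - delta) * cos theta0) by ring.
    apply Rmult_le_compat; try lra. apply Rmult_le_pos; [lra|left; apply Hpos]. }
  assert (Hp0 : 0 < c1 * cos theta0) by (apply Rmult_lt_0_compat; lra).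
  assert (Hp1 := Hpos (1 - delta)).
  apply Rle_trans with (eps / (c1 * cos theta0 * Rpower eps (1 - delta))).
  - apply Rmult_le_compat_l; [lra|]; apply Rinv_le_contravar; [|assumption].
    now apply Rmult_lt_0_compat.
  - right. replace eps with (Rpower eps delta * Rpower eps (1 - delta)) at 1.
    + field; repeat split; lra.
    + rewrite Hmul; replace (delta + (1 - delta)) with 1 by ring; exact H1p. }
assert (Hthle : th <= Cth * Rpower eps delta).
{ unfold th, Cth.
  assert (B1 : 160 * (m + 8) * (eps / (zeta k theta * d)) <= 160 * (m + 8) * (Rpower eps delta / (c1 * cos theta0)))
    by (apply Rmult_le_compat_l; lra).
  assert (B2 : 40 * (2 * m + 22) * (eps * L) <= 40 * (2 * m + 22) * (Rpower eps delta * / (1 - delta)))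
    by (apply Rmult_le_compat_l; lra).
  replace ((160 * (m + 8) / (c1 * cos theta0) + 40 * (2 * m + 22) / (1 - delta)) * Rpower eps delta)
    with (160 * (m + 8) * (Rpower eps delta / (c1 * cos theta0)) + 40 * (2 * m + 22) * (Rpower eps delta * / (1 - delta)))
    by (field; repeat split; lra).
  lra. }
assert (Hth8 : th <= 1 / 8) by lra.
assert (Hedel : eps <= Rpower eps delta).
{ rewrite <- H1p at 1; apply Hmon; lra. }
split; [|split; [exact HexpL|split; [lra|split; [exact Hth8|split; [exact Hthle|split; [lra|exact Hedel]]]]]].
split; try assumption.
- lra.
- assert (HPI := PI_bounds).
  replace (2 * PI / d * eps) with (2 * PI * (eps / d)) by (field; lra).
  apply Rle_trans with (8 * (eps / c1)).
  + apply Rmult_le_compat; [lra|apply Rdiv_le_0_compat; lra|lra|exact Hepsd].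
  + apply Rle_trans with (8 * (c1 / 80 / c1)).
    * apply Rmult_le_compat_l; [lra|]. apply Rmult_le_compat_r; [left; now apply Rinv_0_lt_compat|lra].
    * right; field; lra.
- apply Rle_trans with (k * d * (2 * L)).
  + rewrite <- Rmult_assoc; apply Rmult_le_compat_l; [left; now apply Rmult_lt_0_compat|lra].
  + apply Rle_trans with (c2 * Rpower eps (1 - delta) * (2 * L)); [apply Rmult_le_compat_r; lra|].
    (* One half of the exponent absorbs [L], the other half makes the product small. *)
    replace (1 - delta) with ((1 - delta) / 2 + (1 - delta) / 2) by field.
    rewrite <- Hmul.
    assert (B1 := exp_neg_mult_le ((1 - delta) / 2) L ltac:(lra) ltac:(lra)).
    rewrite <- HP in B1.
    set (w := Rpower eps ((1 - delta) / 2)) in *.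
    assert (Hw : 0 < w) by apply Hpos.
    apply Rle_trans with (c2 * w * (2 * / ((1 - delta) / 2))).
    * replace (c2 * (w * w) * (2 * L)) with (c2 * w * (2 * (w * L))) by ring.
      apply Rmult_le_compat_l; [apply Rmult_le_pos; lra|lra].
    * replace (c2 * w * (2 * / ((1 - delta) / 2))) with (16 * c2 / (1 - delta) * w / 4) by (field; lra).
      lra.
- unfold m.
  apply Rle_trans with (ln (c2 * Rpower eps (- sigma - delta))).
  + apply ln_monotone; split; [apply Rdiv_lt_0_compat; lra|].
    apply Rmult_le_reg_r with eps; [lra|].
    replace (d / eps * eps) with d by (field; lra).
    rewrite <- H1p at 2. rewrite Rmult_assoc, Hmul.
    replace (- sigma - delta + 1) with (1 - sigma - delta) by ring. apply Hd.
  + rewrite ln_mult by (try apply Hpos; assumption).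
    rewrite HP, ln_exp.
    assert (B1 := Rle_abs (ln c2)); assert (B2 := Rabs_pos (ln c2)). nra.
- assert (0 <= 160 * (m + 8) * (eps / (zeta k theta * d))).
  { apply Rmult_le_pos; [lra|]. apply Rdiv_le_0_compat; [lra|].
    unfold zeta; repeat apply Rmult_lt_0_compat; lra. }
  unfold th in Hth8; lra.
Qed.
End Asymptotics.

(** Being far from the ends is made quantitative by the distances [K eps] and [K eps ln (1 / eps)];
    at the latter, decay at the scale [eps] has become a power of [eps]. The phase is
    quasi-periodicity carried to the slit number [n] and equals [1] for [n = 0]. The constants
    precede [d], [theta] and the solution, so the estimates are uniform in them. *)
Theorem mainTheorem9 (sigma delta theta0 tau0 mu0 c1 c2 : R)
  (hsigma : 1 < sigma) (hdelta : 0 < delta < 1)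
  (htheta0 : 0 < theta0 < PI / 2)
  (htau0 : 0 < tau0) (hmu0 : 0 < mu0)
  (hc1 : 0 < c1) (hc2 : 0 < c2) :
  exists K M eps0 : R, 0 < K /\ 0 < M /\ 0 < eps0 < 1 /\
  forall (eps d k theta omega : R) (u E1 E2 : R * R -> C),
    0 < eps < eps0 ->
    c1 * Rpower eps (1 - sigma - delta) <= d
      <= c2 * Rpower eps (1 - sigma - delta) ->
    k = Rpower eps sigma ->
    k = omega * sqrt (tau0 * mu0) ->
    Rabs theta < theta0 ->
    scattering_solution eps d k theta u ->
    electric_field eps d omega tau0 u E1 E2 ->
    forall (n : Z) (p : R * R), slit eps d n p ->
      (K * eps <= snd p <= 1 - K * eps ->
        Cmod (u p - cexp (Ci * RtoC (kappa k theta * (IZR n * d)))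
                    * RtoC (2 * snd p))%C
        <= M * Rpower eps delta) /\
      (K * (eps * ln (/ eps)) <= snd p <= 1 - K * (eps * ln (/ eps)) ->
        Cmod (E1 p - cexp (Ci * RtoC (kappa k theta * (IZR n * d)))
                     * (RtoC 2 * Ci
                        / RtoC (Rpower eps sigma * sqrt (tau0 / mu0))))%C
        <= M * Rpower eps (delta - sigma)).
Proof.
destruct (regime_eventually hsigma hdelta htheta0 hc1 hc2) as [eps0 [Heps0 Hreg]].
set (m := Rabs (ln c2) + sigma + delta) in Hreg.
assert (HCth := Cth_pos hsigma hdelta htheta0 hc1 (c2 := c2)). fold m in HCth.
set (Cth := 160 * (m + 8) / (c1 * cos theta0) + 40 * (2 * m + 22) / (1 - delta)) in *.
set (s := sqrt (tau0 / mu0)).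
assert (Hs : 0 < s) by (apply sqrt_lt_R0, Rdiv_lt_0_compat; assumption).
(* The derivative bound is [4 T + k] with [T <= (12 Cth + 7) eps^delta] and [k <= eps^delta]. *)
set (M := 48 * Cth + 29).
assert (HM : 0 < M) by (unfold M; lra).
exists 4, (M * (1 + / s)), eps0.
assert (Hs' := Rinv_0_lt_compat _ Hs).
split; [lra|split; [apply Rmult_lt_0_compat; lra|split; [exact Heps0|]]].
intros eps d k theta omega u E1 E2 Heps Hd Hk Homega Htheta Sol HE n [xp y] [Hxp Hy].
simpl fst in *; simpl snd in *.
destruct (Hreg eps d k theta Heps Hd Hk Htheta) as [RG [HexpL [Hcos [Hth8 [Hth [Hke Hedel]]]]]].
set (L := ln (/ eps)) in *.
set (th := 160 * (m + 8) * (eps / (zeta k theta * d)) + 40 * eps * ((2 * m + 22) * L)) in *.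
set (x := xp - IZR n * d).
assert (Hx : 0 < x < eps) by (unfold x; lra).
assert (Hxp' : xp = x + IZR n * d) by (unfold x; ring).
assert (HO : Omega eps d (x, y)) by (apply Omega_slit; lra).
assert (HOp : Omega eps d (xp, y)) by (right; right; exists n; simpl; lra).
set (ph := expi (kappa k theta * (IZR n * d))).
rewrite cexp_Ci; fold ph.
assert (Hph : Cmod ph = 1) by apply Cmod_expi.
assert (Hkpos : 0 < k) by (rewrite Hk; apply exp_pos).
assert (Hpd : 0 < Rpower eps delta) by apply exp_pos.
assert (HT : 12 * th + 2 * k * eps + 5 * k ^ 2 <= (12 * Cth + 7) * Rpower eps delta).
{ assert (k * eps <= 1 * Rpower eps delta) by (apply Rmult_le_compat; lra).
  assert (k ^ 2 <= Rpower eps delta) by nra. lra. }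
split; intros Hrange.
- rewrite Hxp', (quasiperiodic_shift Sol n x y HO); fold ph.
  replace (ph * u (x, y) - ph * RtoC (2 * y))%C with (ph * (u (x, y) - RtoC (2 * y)))%C by ring.
  rewrite Cmod_mult, Hph, Rmult_1_l.
  apply Rle_trans with (1 := slit_value_estimate RG HexpL Hcos Hth8 Sol x y (conj Hx Hy)).
  apply Rle_trans with (1 := HT).
  apply Rmult_le_compat_r; [lra|].
  assert (0 < M * / s) by (apply Rmult_lt_0_compat; lra). unfold M in *; lra.
- destruct (HE (xp, y) HOp) as [HE1 _].
  assert (Hd2 := slit_derivative_estimate RG HexpL Hcos Hth8 Sol x y Hx Hrange).
  assert (Hshift := d2_shift Sol n x y Hx Hy). fold ph in Hshift; rewrite <- Hxp' in Hshift.
  assert (Hot : omega * tau0 = k * s).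
  { rewrite Homega; unfold s; rewrite Rmult_assoc, <- sqrt_mult.
    - replace (tau0 * mu0 * (tau0 / mu0)) with (tau0 ^ 2) by (field; lra).
      rewrite sqrt_pow2; lra.
    - apply Rmult_le_pos; lra.
    - apply Rdiv_le_0_compat; lra. }
  assert (Hks : 0 < k * s) by now apply Rmult_lt_0_compat.
  rewrite Hot in HE1. rewrite <- Hk.
  assert (Hne : RtoC (k * s) <> RtoC 0) by (intros H0; apply RtoC_inj in H0; lra).
  assert (HCi2 : (Ci * Ci)%C = RtoC (-1)) by (unfold Ci, Cmult, RtoC; simpl; f_equal; ring).
  (* The error of the electric field is that of the vertical derivative divided by [k s]; with
     [k = eps^sigma] the order becomes [eps^(delta - sigma)]. *)
  assert (Hdiff : (E1 (xp, y) - ph * (RtoC 2 * Ci / RtoC (k * s)))%C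
    = (Ci * / RtoC (k * s) * (ph * (Defs.d2 u (x, y) - RtoC 2)))%C).
  { replace (ph * (Defs.d2 u (x, y) - RtoC 2))%C with (Defs.d2 u (xp, y) - ph * RtoC 2)%C
      by (rewrite Hshift; ring).
    rewrite HE1.
    replace (Ci * / RtoC (k * s) * (- Ci * RtoC (k * s) * E1 (xp, y) - ph * RtoC 2))%C
      with (- (Ci * Ci) * (RtoC (k * s) * / RtoC (k * s)) * E1 (xp, y) - ph * (RtoC 2 * Ci / RtoC (k * s)))%C
      by (unfold Cdiv; ring).
    rewrite HCi2, Cinv_r by assumption.
    replace (- RtoC (-1))%C with (RtoC 1) by (rewrite <- RtoC_opp; f_equal; ring). ring. }
  rewrite Hdiff, !Cmod_mult, Hph, Cmod_inv, Cmod_R, Rabs_pos_eq by (assumption || lra).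
  replace (Cmod Ci) with 1.
  2:{ unfold Cmod; simpl; replace (0 * (0 * 1) + 1 * (1 * 1)) with 1 by ring; now rewrite sqrt_1. }
  rewrite !Rmult_1_l.
  apply Rle_trans with (/ (k * s) * (M * Rpower eps delta)).
  + apply Rmult_le_compat_l; [left; now apply Rinv_0_lt_compat|].
    apply Rle_trans with (1 := Hd2). fold th. unfold M; lra.
  + unfold Rminus; rewrite Rpower_plus, Rpower_Ropp, <- Hk.
    replace (/ (k * s) * (M * Rpower eps delta)) with (M * / s * (Rpower eps delta * / k))
      by (field; split; lra).
    apply Rmult_le_compat_r; [|lra].
    apply Rmult_le_pos; [lra|left; now apply Rinv_0_lt_compat].
Qed.
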